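(* Let $\mathcal{H}$ be an infinite-dimensional complex separable Hilbert space and let $N\in\mathcal{B}(\mathcal{H})$ be normal. The following are equivalent: (a) $\sigma(N)$ is a Lavrentieff set; (b) whenever $A\in\mathcal{B}(\mathcal{H})$ satisfies $\|p(A)\|=\|p(N)\|$ (operator norm) for every complex polynomial $p$, then $A$ is normal.
   Context: A compact set $K\subseteq\mathbb{C}$ is a Lavrentieff set if $\mathbb{C}\setminus K$ is connected and $K$ has empty interior. $\mathcal{B}(\mathcal{H})$ is the algebra of bounded linear operators on $\mathcal{H}$ with the operator norm. *)

(* Defs.v *)
From Stdlib Require Import Reals List.
Open Scope R_scope.

Definition Cpx : Type := (R * R)%type.
Definition C0 : Cpx := (0, 0).
Definition C1 : Cpx := (1, 0).
Definition Cadd (z w : Cpx) : Cpx := (fst z + fst w, snd z + snd w).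
Definition Copp (z : Cpx) : Cpx := (- fst z, - snd z).
Definition Csub (z w : Cpx) : Cpx := Cadd z (Copp w).
Definition Cmul (z w : Cpx) : Cpx :=
  (fst z * fst w - snd z * snd w, fst z * snd w + snd z * fst w).
Definition Cconj (z : Cpx) : Cpx := (fst z, - snd z).
Definition Cmod (z : Cpx) : R := sqrt (fst z * fst z + snd z * snd z).
Definition Cdist (z w : Cpx) : R := Cmod (Csub z w).

Definition C_open (U : Cpx -> Prop) : Prop :=
  forall z, U z -> exists eps, 0 < eps /\ forall w, Cdist w z < eps -> U w.

Definition C_compact (K : Cpx -> Prop) : Prop :=
  forall F : (Cpx -> Prop) -> Prop,
    (forall U, F U -> C_open U) ->
    (forall z, K z -> exists U, F U /\ U z) ->
    exists l : list (Cpx -> Prop),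
      (forall U, In U l -> F U) /\ (forall z, K z -> exists U, In U l /\ U z).

Definition C_connected (S : Cpx -> Prop) : Prop :=
  ~ exists U V : Cpx -> Prop,
      C_open U /\ C_open V /\
      (forall z, S z -> U z \/ V z) /\
      (exists z, S z /\ U z) /\ (exists z, S z /\ V z) /\
      (forall z, S z -> U z -> V z -> False).

Definition C_empty_interior (K : Cpx -> Prop) : Prop :=
  ~ exists z eps, 0 < eps /\ forall w, Cdist w z < eps -> K w.

Definition lavrentieff (K : Cpx -> Prop) : Prop :=
  C_compact K /\ C_connected (fun z => ~ K z) /\ C_empty_interior K.

Record InnerProductSpace : Type := {
  carrier :> Type;
  vzero : carrier;
  vadd : carrier -> carrier -> carrier;
  vopp : carrier -> carrier;
  vscal : Cpx -> carrier -> carrier;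
  inner : carrier -> carrier -> Cpx;
  vadd_assoc : forall x y z, vadd x (vadd y z) = vadd (vadd x y) z;
  vadd_comm : forall x y, vadd x y = vadd y x;
  vadd_zero : forall x, vadd x vzero = x;
  vadd_opp : forall x, vadd x (vopp x) = vzero;
  vscal_assoc : forall a b x, vscal a (vscal b x) = vscal (Cmul a b) x;
  vscal_one : forall x, vscal C1 x = x;
  vscal_distr_v : forall a x y, vscal a (vadd x y) = vadd (vscal a x) (vscal a y);
  vscal_distr_s : forall a b x, vscal (Cadd a b) x = vadd (vscal a x) (vscal b x);
  inner_add_l : forall x y z, inner (vadd x y) z = Cadd (inner x z) (inner y z);
  inner_scal_l : forall a x y, inner (vscal a x) y = Cmul a (inner x y);
  inner_conj_sym : forall x y, inner y x = Cconj (inner x y);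
  inner_pos : forall x, 0 <= fst (inner x x);
  inner_definite : forall x, inner x x = C0 -> x = vzero
}.

Section Ops.
Context {H : InnerProductSpace}.

Definition vsub (x y : H) : H := vadd H x (vopp H y).
Definition vnorm (x : H) : R := sqrt (fst (inner H x x)).

Definition complete_space : Prop :=
  forall u : nat -> H,
    (forall eps, 0 < eps -> exists n0, forall n m, (n0 <= n)%nat -> (n0 <= m)%nat ->
        vnorm (vsub (u n) (u m)) < eps) ->
    exists l : H, forall eps, 0 < eps -> exists n0, forall n, (n0 <= n)%nat ->
        vnorm (vsub (u n) l) < eps.

Definition separable_space : Prop :=
  exists d : nat -> H, forall x eps, 0 < eps -> exists n, vnorm (vsub x (d n)) < eps.

Fixpoint lincomb (n : nat) (c : nat -> Cpx) (v : nat -> H) : H :=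
  match n with
  | O => vzero H
  | S k => vadd H (lincomb k c v) (vscal H (c k) (v k))
  end.

Definition infinite_dimensional : Prop :=
  forall (n : nat) (v : nat -> H), exists x : H, ~ exists c, x = lincomb n c v.

Definition linear_op (T : H -> H) : Prop :=
  (forall x y, T (vadd H x y) = vadd H (T x) (T y)) /\
  (forall a x, T (vscal H a x) = vscal H a (T x)).

Definition bounded_op (T : H -> H) : Prop :=
  linear_op T /\ exists M, forall x, vnorm (T x) <= M * vnorm x.

Definition is_opnorm (T : H -> H) (r : R) : Prop :=
  is_lub (fun y => exists x, vnorm x <= 1 /\ y = vnorm (T x)) r.

(* p(T) for the complex polynomial p = c_0 + c_1 X + ... + c_k X^k,
   given by its coefficient list [c_0; ...; c_k] (Horner scheme) *)
Fixpoint poly_op (p : list Cpx) (T : H -> H) (x : H) : H :=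
  match p with
  | nil => vzero H
  | c :: p' => vadd H (vscal H c x) (T (poly_op p' T x))
  end.

Definition is_adjoint (T S : H -> H) : Prop :=
  forall x y, inner H (T x) y = inner H x (S y).

Definition normal_op (T : H -> H) : Prop :=
  exists S, is_adjoint T S /\ forall x, T (S x) = S (T x).

Definition spectrum (T : H -> H) (lam : Cpx) : Prop :=
  ~ exists S : H -> H, bounded_op S /\
      (forall x, S (vsub (T x) (vscal H lam x)) = x) /\
      (forall x, vsub (T (S x)) (vscal H lam (S x)) = x).

End Ops.
Arguments complete_space : clear implicits.
Arguments separable_space : clear implicits.
Arguments infinite_dimensional : clear implicits.

(* Main.v *)
(* (a) => (b).  First, the complex conjugate is a uniform limit of polynomials
   on K = spectrum N.  For a outside K and h > 0, connectedness of the complement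
   gives a chain outside K from a to some b with h <= |b - a| < 2h.  Continuing
   sqrt ((z-b)/(z-a)) along it, Joukowski's map turns this branch into a uniform
   limit of polynomials g with |g| <= 80/h on K and
   |g(z) - 1/(z-a)| <= 6h/|z-a|^2 away from a.  As K has empty interior, every
   node of a grid of mesh h is within h of such an a, and the sums of h^2 g over
   the grid converge uniformly to the area integral of 1/(z - zeta) over a tall
   box, that is to 2 pi Re z.  Next, write N' for the adjoint of N.  If
   |p(z) - conj z| <= eps on K then |p(N) - N'| <= eps: the norm of p(N) - N' is
   attained on approximate eigenvectors, and self-adjoint operators S commuting
   with everything localise these at a point of K (apply S^n until
   |S^(n+1) x| / |S^n x| stalls).  Hence p_n(A) converges to some B whenever
   p_n(N) -> N', and 1 + it (alpha A + conj alpha B) has the same norm as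
   1 + it (alpha N + conj alpha N'), at most 1 + O(t^2), which forces B to be the
   adjoint of A.

   (b) => (a).  The spectrum is compact.  If it is not Lavrentieff, there is a
   disc D(z0, r), inside K or in a bounded piece of its complement, on which
   |p| <= |p(N)| for all p.  Let V be an isometry whose range is orthogonal to
   orthonormal e0, e1, and let A be V N V' on the range of V and
   z0 + (r/2) <., e0> e1 on its orthogonal complement.  Since
   r |p'(z0)| <= 2 (M - |p(z0)|) whenever |p| <= M on the disc, the triangle
   inequality gives |p(A)| = |p(N)| for all p, but A is not normal. *)

Require Import Defs.
From Stdlib Require Import Reals List Lra Lia Psatz Classical ClassicalEpsilon.
From Coquelicot Require Import Coquelicot.
Open Scope R_scope.

(** * Polynomials and uniform limits of polynomials *)

(** The obstacle in (a) => (b) is the size of the kernels. A pole a outside K may lie arbitrarily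
    close to K, so 1/(z - a) must be replaced by a function of size 1/h that agrees with it to
    second order at infinity. This is possible because an arc of diameter h has analytic capacity
    comparable to h, and Joukowski's map exhibits it. The second order is what makes the sums
    converge: the errors h^2 * h / rho^2 over about 1/h^2 nodes tend to 0 with h. Only Re z has to
    be reached, so the Cauchy transform of one box is enough; the box is tall because the integral
    of 1/(X + iv) over a long vertical segment tends to pi times the sign of X. On the operator side
    everything is phrased through upper bounds and approximate eigenvectors, in place of a spectral
    measure. The test with 1 + itW works because the first-order term of |x + itW x|^2 is the
    imaginary part of <W x, x>: a bound 1 + O(t^2) says that the numerical range of W is real. In
    (b) => (a) polynomials see a two-dimensional Jordan block only through p(z0) and p'(z0), and
    both are controlled on a disc inside the polynomially convex hull of the spectrum. *)

Lemma Cmod_sub_sym (a b : C) : Cmod (a - b) = Cmod (b - a).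
Proof. rewrite <- Cmod_opp. f_equal. ring. Qed.

Lemma Cmod_sub_triangle (a b c : C) : Cmod (a - c) <= Cmod (a - b) + Cmod (b - c).
Proof. replace (a - c)%C with ((a - b) + (b - c))%C by ring. apply Cmod_triangle. Qed.

Lemma Cmod_triangle_sub (a b : C) : Cmod (a - b) <= Cmod a + Cmod b.
Proof. unfold Cminus. rewrite <- (Cmod_opp b). apply Cmod_triangle. Qed.

Lemma Cmod_triangle_inv (a b : C) : Cmod a - Cmod b <= Cmod (a - b).
Proof.
  assert (H := Cmod_triangle (a - b) b).
  replace (a - b + b)%C with a in H by ring. lra.
Qed.

Lemma Cmod_sq (z : C) : Cmod z * Cmod z = fst z * fst z + snd z * snd z.
Proof. unfold Cmod. rewrite sqrt_sqrt; [ring | nra]. Qed.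

Lemma Cmod_neq_0 (z : C) : 0 < Cmod z -> z <> RtoC 0.
Proof. intros H E. subst. rewrite Cmod_0 in H. lra. Qed.

Lemma Cmod_le_abs (z : C) : Cmod z <= Rabs (fst z) + Rabs (snd z).
Proof.
  assert (H := Cmod_sq z). assert (P := Cmod_ge_0 z).
  assert (A := Rabs_pos (fst z)). assert (B := Rabs_pos (snd z)).
  assert (A2 : Rabs (fst z) * Rabs (fst z) = fst z * fst z)
    by (rewrite <- Rabs_mult; apply Rabs_pos_eq; nra).
  assert (B2 : Rabs (snd z) * Rabs (snd z) = snd z * snd z)
    by (rewrite <- Rabs_mult; apply Rabs_pos_eq; nra).
  apply Rsqr_incr_0_var; unfold Rsqr; nra.
Qed.

Lemma fst_le_Cmod (z : C) : Rabs (fst z) <= Cmod z.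
Proof. exact (Rle_trans _ _ _ (Rmax_l _ _) (Rmax_Cmod z)). Qed.

Lemma snd_le_Cmod (z : C) : Rabs (snd z) <= Cmod z.
Proof. exact (Rle_trans _ _ _ (Rmax_r _ _) (Rmax_Cmod z)). Qed.

Lemma Cconj_RtoC (r : R) : Cconj (RtoC r) = RtoC r.
Proof. unfold Cconj. simpl. rewrite Ropp_0. reflexivity. Qed.

Lemma choice_function {A B : Type} (P : A -> B -> Prop) :
  (forall a, exists b, P a b) -> exists f, forall a, P a (f a).
Proof.
  intros E. exists (fun a => proj1_sig (constructive_indefinite_description _ (E a))).
  intros a. exact (proj2_sig (constructive_indefinite_description _ (E a))).
Qed.

Lemma exists_small_factor (M eps : R) : 0 < eps -> exists d, 0 < d /\ d * M <= eps.
Proof.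
  intros He. assert (P := Rabs_pos M). assert (Q := Rle_abs M).
  assert (Pd : 0 < eps / (Rabs M + 1)) by (apply Rdiv_lt_0_compat; lra).
  exists (eps / (Rabs M + 1)). split; [exact Pd|].
  assert (E : eps / (Rabs M + 1) * (Rabs M + 1) = eps) by (field; lra). nra.
Qed.

Fixpoint peval (p : list C) (z : C) : C :=
  match p with
  | nil => RtoC 0
  | c :: p' => (c + z * peval p' z)%C
  end.

Fixpoint padd (p q : list C) : list C :=
  match p, q with
  | nil, _ => q
  | _, nil => p
  | a :: p', b :: q' => (a + b)%C :: padd p' q'
  end.

Definition pscal (c : C) (p : list C) : list C := map (fun a => (c * a)%C) p.

Fixpoint pmul (p q : list C) : list C :=
  match p with
  | nil => nil
  | a :: p' => padd (pscal a q) (RtoC 0 :: pmul p' q)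
  end.

Lemma peval_add p q z : peval (padd p q) z = (peval p z + peval q z)%C.
Proof.
  revert q; induction p as [|a p IH]; intros [|b q]; simpl; try ring.
  rewrite IH. ring.
Qed.

Lemma peval_scal c p z : peval (pscal c p) z = (c * peval p z)%C.
Proof. induction p as [|a p IH]; simpl; [ring | rewrite IH; ring]. Qed.

Lemma peval_mul p q z : peval (pmul p q) z = (peval p z * peval q z)%C.
Proof.
  induction p as [|a p IH]; simpl; [ring | ].
  rewrite peval_add, peval_scal. simpl. rewrite IH. ring.
Qed.

Lemma peval_bounded p R0 : exists B, 0 <= B /\ forall z, Cmod z <= R0 -> Cmod (peval p z) <= B.
Proof.
  induction p as [|a p [B [HB IH]]].
  - exists 0. split; [lra|]. intros z _. simpl. rewrite Cmod_0. lra.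
  - exists (Cmod a + Rabs R0 * B). split.
    { assert (H1 := Cmod_ge_0 a). assert (H2 := Rabs_pos R0). nra. }
    intros z Hz. simpl.
    eapply Rle_trans; [apply Cmod_triangle|]. rewrite Cmod_mult.
    apply Rplus_le_compat_l. apply Rmult_le_compat; auto using Cmod_ge_0.
    eapply Rle_trans; [exact Hz | apply Rle_abs].
Qed.

(** Membership in P(K), the uniform closure of the polynomials on K. *)
Definition approx (K : C -> Prop) (f : C -> C) : Prop :=
  forall eps, 0 < eps -> exists p, forall z, K z -> Cmod (f z - peval p z) <= eps.

Definition bounded_by (K : C -> Prop) (R0 : R) : Prop := forall z, K z -> Cmod z <= R0.

Section Approx.
Context (K : C -> Prop) (R0 : R) (HK : bounded_by K R0).

Lemma approx_ext f g : (forall z, K z -> f z = g z) -> approx K f -> approx K g.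
Proof.
  intros E Hf eps He. destruct (Hf eps He) as [p Hp]. exists p.
  intros z Hz. rewrite <- E; auto.
Qed.

Lemma approx_peval p : approx K (peval p).
Proof.
  intros eps He. exists p. intros z _.
  replace (peval p z - peval p z)%C with (RtoC 0) by ring. rewrite Cmod_0. lra.
Qed.

Lemma approx_const c : approx K (fun _ => c).
Proof. apply (approx_ext (peval (c :: nil))); [|apply approx_peval]. intros; simpl; ring. Qed.

Lemma approx_id : approx K (fun z => z).
Proof.
  apply (approx_ext (peval (RtoC 0 :: RtoC 1 :: nil))); [|apply approx_peval].
  intros; simpl; ring.
Qed.

Lemma approx_plus f g : approx K f -> approx K g -> approx K (fun z => (f z + g z)%C).
Proof.
  intros Hf Hg eps He.
  destruct (Hf (eps / 2)) as [p Hp]; [lra|]. destruct (Hg (eps / 2)) as [q Hq]; [lra|].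
  exists (padd p q). intros z Hz. rewrite peval_add.
  replace (f z + g z - (peval p z + peval q z))%C
    with ((f z - peval p z) + (g z - peval q z))%C by ring.
  eapply Rle_trans; [apply Cmod_triangle|].
  specialize (Hp z Hz). specialize (Hq z Hz). lra.
Qed.

Lemma approx_bounded f : approx K f -> exists B, 0 < B /\ forall z, K z -> Cmod (f z) <= B.
Proof.
  intros Hf. destruct (Hf 1) as [p Hp]; [lra|].
  destruct (peval_bounded p R0) as [B [HB Hb]].
  exists (B + 1). split; [lra|]. intros z Hz.
  specialize (Hp z Hz). specialize (Hb z (HK z Hz)).
  assert (T := Cmod_triangle_inv (f z) (peval p z)). lra.
Qed.

Lemma approx_mult f g : approx K f -> approx K g -> approx K (fun z => (f z * g z)%C).
Proof.
  intros Hf Hg.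
  destruct (approx_bounded f Hf) as [A [HA Af]].
  intros eps He.
  destruct (Hg (eps / (2 * A))) as [q Hq]; [apply Rdiv_lt_0_compat; lra|].
  destruct (peval_bounded q R0) as [B [HB Hb]].
  destruct (Hf (eps / (2 * (B + 1)))) as [p Hp]; [apply Rdiv_lt_0_compat; lra|].
  exists (pmul p q). intros z Hz. rewrite peval_mul.
  replace (f z * g z - peval p z * peval q z)%C
    with (f z * (g z - peval q z) + (f z - peval p z) * peval q z)%C by ring.
  eapply Rle_trans; [apply Cmod_triangle|]. rewrite !Cmod_mult.
  specialize (Hp z Hz). specialize (Hq z Hz). specialize (Hb z (HK z Hz)). specialize (Af z Hz).
  assert (E1 : Cmod (f z) * Cmod (g z - peval q z) <= A * (eps / (2 * A)))
    by (apply Rmult_le_compat; auto using Cmod_ge_0).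
  assert (E2 : Cmod (f z - peval p z) * Cmod (peval q z) <= eps / (2 * (B + 1)) * (B + 1))
    by (apply Rmult_le_compat; auto using Cmod_ge_0; lra).
  replace (A * (eps / (2 * A))) with (eps / 2) in E1 by (field; lra).
  replace (eps / (2 * (B + 1)) * (B + 1)) with (eps / 2) in E2 by (field; lra).
  lra.
Qed.

(** Geometric rates suffice: both uses iterate a map that contracts by the factor 1/2 at every point
    of K. *)
Lemma approx_limit f (F : nat -> C -> C) M :
  (forall n, approx K (F n)) ->
  (forall n z, K z -> Cmod (f z - F n z) <= M * (/ 2) ^ n) -> approx K f.
Proof.
  intros HF Hlim eps He.
  assert (exists n, M * (/ 2) ^ n <= eps / 2) as [n Hn].
  { destruct (pow_lt_1_zero (/ 2)) with (y := eps / (2 * (Rabs M + 1))) as [n Hn].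
    - rewrite Rabs_pos_eq; lra.
    - assert (H := Rabs_pos M). apply Rdiv_lt_0_compat; lra.
    - exists n. specialize (Hn n (Nat.le_refl n)).
      assert (P : 0 < (/ 2) ^ n) by (apply pow_lt; lra).
      rewrite Rabs_pos_eq in Hn by lra.
      assert (H := Rabs_pos M). assert (H1 := Rle_abs M).
      apply Rle_trans with ((Rabs M + 1) * (/ 2) ^ n); [nra|].
      apply Rle_trans with ((Rabs M + 1) * (eps / (2 * (Rabs M + 1)))); [nra|].
      apply Req_le. field. lra. }
  destruct (HF n (eps / 2)) as [p Hp]; [lra|].
  exists p. intros z Hz.
  eapply Rle_trans; [apply (Cmod_sub_triangle _ (F n z))|].
  specialize (Hp z Hz). specialize (Hlim n z Hz). lra.
Qed.

Lemma approx_geometric u : approx K u -> (forall z, K z -> Cmod (u z) <= / 2) ->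
  approx K (fun z => (/ (1 - u z))%C).
Proof.
  intros Hu Hb.
  apply (approx_limit _
    (fun n z => Nat.iter n (fun y => (1 + u z * y)%C) (RtoC 0)) 2).
  - induction n as [|n IH]; simpl.
    + apply approx_const.
    + apply (approx_plus (fun _ => RtoC 1)); [apply approx_const|].
      apply approx_mult; assumption.
  - intros n z Hz. specialize (Hb z Hz).
    assert (D : Cmod (1 - u z) >= / 2).
    { assert (T := Cmod_triangle_inv 1 (u z)). rewrite Cmod_1 in T. lra. }
    assert (N : (1 - u z)%C <> RtoC 0) by (apply Cmod_neq_0; lra).
    induction n as [|n IH].
    + simpl. replace (/ (1 - u z) - 0)%C with (/ (1 - u z))%C by ring.
      rewrite Cmod_inv by exact N.
      replace (2 * 1) with (/ / 2) by field. apply Rinv_le_contravar; lra.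
    + simpl.
      replace (/ (1 - u z) - (1 + u z * Nat.iter n (fun y => 1 + u z * y) (RtoC 0)))%C
        with (u z * (/ (1 - u z) - Nat.iter n (fun y => 1 + u z * y) (RtoC 0)))%C
        by (field; exact N).
      rewrite Cmod_mult.
      assert (P := Cmod_ge_0 (/ (1 - u z) - Nat.iter n (fun y => (1 + u z * y)%C) (RtoC 0))).
      assert (Q := Cmod_ge_0 (u z)). nra.
Qed.

(** The principal square root on the right half-plane. Its values there lie in the sector |arg| <
    pi/4, which is how [csqrt_spec] pins down the branch. *)
Definition csqrt (w : C) : C :=
  let q := sqrt ((Cmod w + fst w) / 2) in (q, snd w / (2 * q)).

Lemma csqrt_spec w : 0 < fst w ->
  (csqrt w * csqrt w = w)%C /\ Rabs (snd (csqrt w)) < fst (csqrt w).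
Proof.
  intros Hw. unfold csqrt.
  assert (M := Cmod_sq w). assert (P := Cmod_ge_0 w).
  set (q := sqrt ((Cmod w + fst w) / 2)).
  assert (Q : 0 < q) by (apply sqrt_lt_R0; lra).
  assert (Q2 : q * q = (Cmod w + fst w) / 2) by (apply sqrt_sqrt; lra).
  set (m := Cmod w) in *. clearbody m q.
  destruct w as [x y]; simpl in *. split.
  - unfold Cmult; simpl. f_equal; [|field; lra].
    assert (E : 4 * (q * q) * (q * q) - y * y = x * (4 * (q * q))) by (rewrite Q2; nra).
    apply Rmult_eq_reg_r with (4 * (q * q)); [|nra].
    rewrite <- E. field. lra.
  - apply Rabs_def1.
    + apply Rmult_lt_reg_r with (2 * q); [lra|].
      replace (y / (2 * q) * (2 * q)) with y by (field; lra). nra.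
    + apply Rmult_lt_reg_r with (2 * q); [lra|].
      replace (y / (2 * q) * (2 * q)) with y by (field; lra). nra.
Qed.

Lemma one_minus_csqrt_small (s u : C) : (s * s = 1 - u)%C -> 0 < fst s ->
  Cmod (1 - s) <= Cmod u.
Proof.
  intros E Hs.
  assert (F : ((1 - s) * (1 + s) = u)%C).
  { replace u with (1 - (1 - u))%C by ring. rewrite <- E. ring. }
  rewrite <- F, Cmod_mult.
  assert (1 <= Cmod (1 + s)).
  { eapply Rle_trans; [|apply fst_le_Cmod]. simpl. rewrite Rabs_pos_eq; lra. }
  assert (P := Cmod_ge_0 (1 - s)). nra.
Qed.

Lemma fst_one_minus u : Cmod u <= / 2 -> 0 < fst (1 - u)%C.
Proof.
  intros H. assert (T := fst_le_Cmod u). assert (T1 := Rle_abs (fst u)). simpl. lra.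
Qed.

(** [1 - csqrt (1 - u)] is a fixed point of y -> (u + y^2)/2. For |u| <= 1/2 this map preserves the
    disc |y| <= 1/2 and contracts there by 1/2, and its iterates from 0 are polynomials in u. *)
Lemma approx_csqrt u : approx K u -> (forall z, K z -> Cmod (u z) <= / 2) ->
  approx K (fun z => csqrt (1 - u z)).
Proof.
  intros Hu Hb.
  apply (approx_ext (fun z => (1 + RtoC (-1) * (1 - csqrt (1 - u z)))%C)).
  { intros; ring. }
  apply (approx_plus (fun _ => RtoC 1)); [apply approx_const|].
  apply (approx_mult (fun _ => RtoC (-1))); [apply approx_const|].
  apply (approx_limit _
    (fun n z => Nat.iter n (fun y => (/ 2 * (u z + y * y))%C) (RtoC 0)) 1).
  - induction n as [|n IH]; simpl; [apply approx_const|].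
    apply (approx_mult (fun _ => (/ 2)%C)); [apply approx_const|].
    apply approx_plus; auto using approx_mult.
  - intros n z Hz. specialize (Hb z Hz).
    destruct (csqrt_spec (1 - u z)%C) as [S1 S2]; [apply fst_one_minus; auto|].
    assert (S3 : Cmod (1 - csqrt (1 - u z)) <= / 2).
    { eapply Rle_trans; [|exact Hb]. apply one_minus_csqrt_small; auto.
      assert (T := Rabs_pos (snd (csqrt (1 - u z)))). lra. }
    set (y := (1 - csqrt (1 - u z))%C) in *.
    assert (H2 : Cmod (/ 2) = / 2).
    { rewrite <- RtoC_inv, Cmod_R, Rabs_pos_eq; lra. }
    assert (Y : y = (/ 2 * (u z + y * y))%C).
    { unfold y.
      replace (u z + (1 - csqrt (1 - u z)) * (1 - csqrt (1 - u z)))%C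
        with (u z + 1 - 2 * csqrt (1 - u z) + csqrt (1 - u z) * csqrt (1 - u z))%C by ring.
      rewrite S1. field. }
    set (F := fun y0 : C => (/ 2 * (u z + y0 * y0))%C) in *.
    clearbody y. clear S1 S2.
    induction n as [|n IH].
    + simpl. replace (y - 0)%C with y by ring. lra.
    + assert (B : Cmod (Nat.iter n F (RtoC 0)) <= / 2).
      { clear IH. induction n as [|n IH]; simpl; [rewrite Cmod_0; lra|].
        unfold F at 1. rewrite Cmod_mult, H2.
        assert (T := Cmod_triangle (u z) (Nat.iter n F (RtoC 0) * Nat.iter n F (RtoC 0))).
        rewrite Cmod_mult in T. assert (P := Cmod_ge_0 (Nat.iter n F (RtoC 0))). nra. }
      simpl.
      replace (y - F (Nat.iter n F (RtoC 0)))%C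
        with (/ 2 * ((y - Nat.iter n F (RtoC 0)) * (y + Nat.iter n F (RtoC 0))))%C
        by (rewrite Y at 3; unfold F; ring).
      rewrite Cmod_mult, Cmod_mult, H2.
      assert (T := Cmod_triangle y (Nat.iter n F (RtoC 0))).
      assert (P := Cmod_ge_0 (y - Nat.iter n F (RtoC 0))).
      assert (P2 := Cmod_ge_0 (y + Nat.iter n F (RtoC 0))). nra.
Qed.

End Approx.

(** * Cauchy kernels with poles outside the compact set *)

Lemma Cdist_Cmod (w z : C) : Cdist w z = Cmod (w - z).
Proof. unfold Cdist, Defs.Cmod, Cmod. simpl. f_equal. ring. Qed.

(** The clopen argument as an induction principle along a connected set; it replaces explicit chains
    of points. It is applied to the complement of K, once for the approximability of 1/(z - a) and
    once for the square-root branch. *)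
Lemma connected_locally_constant (S U : C -> Prop) :
  C_connected S ->
  (forall w, S w -> exists d, 0 < d /\ forall w', Cmod (w' - w) < d -> S w' /\ (U w <-> U w')) ->
  (exists a, S a /\ U a) -> forall w, S w -> U w.
Proof.
  intros Hc Hl Ha w Hw. apply NNPP. intros Hn. apply Hc.
  exists (fun z => S z /\ U z), (fun z => S z /\ ~ U z).
  assert (E : forall P : Prop -> Prop,
    (forall w w', (U w <-> U w') -> P (U w) -> P (U w')) ->
    C_open (fun z => S z /\ P (U z))).
  { intros P HP z [Sz Uz]. destruct (Hl z Sz) as [d [Hd H]]. exists d. split; [exact Hd|].
    intros w' Hw'. rewrite Cdist_Cmod in Hw'. destruct (H w' Hw') as [S' U'].
    split; [exact S' | exact (HP _ _ U' Uz)]. }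
  split; [apply (E (fun P => P)); tauto|].
  split; [apply (E (fun P => ~ P)); tauto|].
  split; [intros z Hz; destruct (classic (U z)); tauto|].
  split; [destruct Ha as [a Ha]; exists a; tauto|].
  split; [exists w; tauto|].
  tauto.
Qed.

Section Lavrentieff.
Context (K : C -> Prop) (R0 : R) (HK : bounded_by K R0) (HR0 : 0 < R0).
Context (Hclosed : forall a, ~ K a -> exists d, 0 < d /\ forall z, K z -> d <= Cmod (z - a)).
Context (Hconn : C_connected (fun z => ~ K z)).

(** The factor 2 is stated in both directions so that a property passes from a to a' and back, as
    the equivalence in [connected_locally_constant] demands. *)
Lemma complement_nearby a : ~ K a ->
  exists d, 0 < d /\ forall a', Cmod (a' - a) < d ->
    ~ K a' /\ (forall z, K z -> 0 < Cmod (z - a) /\ 2 * Cmod (a' - a) <= Cmod (z - a)) /\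
    (forall z, K z -> 0 < Cmod (z - a') /\ 2 * Cmod (a - a') <= Cmod (z - a')).
Proof.
  intros Ha. destruct (Hclosed a Ha) as [d [Hd H]]. exists (d / 4). split; [lra|].
  intros a' Ha'.
  assert (H' : forall z, K z -> 3 * d / 4 <= Cmod (z - a')).
  { intros z Hz. specialize (H z Hz). assert (T := Cmod_sub_triangle z a' a). lra. }
  split; [|split].
  - intros Ka. specialize (H a' Ka). lra.
  - intros z Hz. specialize (H z Hz). lra.
  - intros z Hz. specialize (H' z Hz). rewrite (Cmod_sub_sym a a'). lra.
Qed.

Lemma step_ratio_small (z a b : C) : 0 < Cmod (z - a) ->
  2 * Cmod (b - a) <= Cmod (z - a) -> Cmod ((b - a) / (z - a)) <= / 2.
Proof.
  intros H1 H2. rewrite Cmod_div by (apply Cmod_neq_0; exact H1).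
  apply Rmult_le_reg_r with (Cmod (z - a)); [exact H1|].
  unfold Rdiv. rewrite Rmult_assoc, Rinv_l by lra. lra.
Qed.

Lemma approx_inv_step a b :
  (forall z, K z -> 0 < Cmod (z - a) /\ 2 * Cmod (b - a) <= Cmod (z - a)) ->
  approx K (fun z => (/ (z - a))%C) -> approx K (fun z => (/ (z - b))%C).
Proof.
  intros H Ha.
  apply (approx_ext K (fun z => (/ (z - a) * / (1 - (b - a) / (z - a)))%C)).
  { intros z Hz. destruct (H z Hz) as [H1 H2].
    assert (N : (z - a)%C <> RtoC 0) by (apply Cmod_neq_0; exact H1).
    assert (N' : (z - b)%C <> RtoC 0).
    { apply Cmod_neq_0. assert (T := Cmod_sub_triangle z b a). lra. }
    replace (1 - (b - a) / (z - a))%C with ((z - b) / (z - a))%C by (field; exact N).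
    field. split; assumption. }
  apply (approx_mult K R0 HK); [exact Ha|].
  apply (approx_geometric K R0 HK).
  - apply (approx_mult K R0 HK (fun _ => (b - a)%C)); [apply approx_const | exact Ha].
  - intros z Hz. destruct (H z Hz). apply step_ratio_small; assumption.
Qed.

(** The bound 2 R0 + 1 makes z/a at most 1/2 on K, for the expansion at infinity; the bound r lets a
    point escape from a given disc. *)
Lemma exists_far r : exists a : C, ~ K a /\ r <= Cmod a /\ 2 * R0 + 1 <= Cmod a.
Proof.
  exists (RtoC (Rabs r + 2 * R0 + 1)).
  assert (P := Rabs_pos r). assert (Q := Rle_abs r).
  assert (E : Cmod (RtoC (Rabs r + 2 * R0 + 1)) = Rabs r + 2 * R0 + 1)
    by (rewrite Cmod_R; apply Rabs_pos_eq; lra).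
  rewrite E. split; [|split; lra].
  intros Hz. specialize (HK _ Hz). rewrite E in HK. lra.
Qed.

(** Runge's pole pushing: far from the origin 1/(z - b) is a geometric series in z/b, and
    [approx_inv_step] moves the pole through the connected complement. *)
Lemma approx_inv a : ~ K a -> approx K (fun z => (/ (z - a))%C).
Proof.
  apply (connected_locally_constant _ (fun a => approx K (fun z => (/ (z - a))%C)) Hconn).
  - intros w Hw. destruct (complement_nearby w Hw) as [d [Hd H]]. exists d.
    split; [exact Hd|]. intros w' Hw'. destruct (H w' Hw') as [H1 [H2 H3]].
    split; [exact H1|]. split; apply approx_inv_step; assumption.
  - destruct (exists_far 0) as [b [Kb [_ Hb]]]. exists b. split; [exact Kb|].
    assert (N : b <> RtoC 0) by (apply Cmod_neq_0; lra).
    apply (approx_ext K (fun z => (- / b * / (1 - / b * z))%C)).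
    { intros z Hz. specialize (HK z Hz).
      assert (N' : (z - b)%C <> RtoC 0).
      { apply Cmod_neq_0. rewrite Cmod_sub_sym. assert (T := Cmod_triangle_inv b z). lra. }
      replace (1 - / b * z)%C with (- (z - b) / b)%C by (field; exact N).
      assert (N2 : (- (z - b))%C <> RtoC 0).
      { intros E. apply N'. replace (z - b)%C with (- (- (z - b)))%C by ring. rewrite E. ring. }
      field. repeat split; assumption. }
    apply (approx_mult K R0 HK (fun _ => (- / b)%C)); [apply approx_const|].
    apply (approx_geometric K R0 HK (fun z => (/ b * z)%C)).
    + apply (approx_mult K R0 HK (fun _ => (/ b)%C)); [apply approx_const | apply approx_id].
    + intros z Hz. specialize (HK z Hz). rewrite Cmod_mult, Cmod_inv by exact N.
      apply Rmult_le_reg_l with (Cmod b); [lra|].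
      rewrite <- Rmult_assoc, Rinv_r by lra. lra.
Qed.

(* [S] is the branch, continued along a chain from [a] to [b] outside [K], of
   sqrt ((z - b) / (z - a)); the last clause pins it down to the principal
   branch away from [a]. *)
Definition sqrt_branch (a : C) (h : R) (b : C) (S : C -> C) : Prop :=
  approx K S /\
  (forall z, K z -> (S z * S z * (z - a) = z - b)%C) /\
  (forall z, K z -> 4 * h <= Cmod (z - a) -> Rabs (snd (S z)) < fst (S z)).

(** The old branch is multiplied by the principal root of (z - b')/(z - b) = 1 - (b' - b)/(z - b),
    which is approximable because b lies outside K. *)
Lemma sqrt_branch_step a h b b' S : 0 < h -> ~ K a -> ~ K b ->
  (forall z, K z -> 0 < Cmod (z - b) /\ 2 * Cmod (b' - b) <= Cmod (z - b)) ->
  Cmod (b' - a) < 2 * h -> sqrt_branch a h b S -> exists S', sqrt_branch a h b' S'.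
Proof.
  intros Hh Ka Kb Hz Hb' [S1 [S2 S3]].
  set (f := fun z : C => csqrt (1 - (b' - b) / (z - b))).
  assert (Hf : forall z, K z ->
    (f z * f z = 1 - (b' - b) / (z - b))%C /\ Rabs (snd (f z)) < fst (f z)).
  { intros z Kz. destruct (Hz z Kz). apply csqrt_spec, fst_one_minus, step_ratio_small; assumption. }
  assert (E : forall z, K z -> (S z * f z * (S z * f z) * (z - a) = z - b')%C).
  { intros z Kz. destruct (Hf z Kz) as [F1 _]. destruct (Hz z Kz) as [Hp _].
    replace (S z * f z * (S z * f z) * (z - a))%C
      with (S z * S z * (z - a) * (f z * f z))%C by ring.
    rewrite S2, F1 by exact Kz. field. apply Cmod_neq_0. exact Hp. }
  exists (fun z => (S z * f z)%C). split; [|split].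
  - apply (approx_mult K R0 HK); [exact S1|].
    apply (approx_csqrt K R0 HK (fun z => ((b' - b) / (z - b))%C)).
    + apply (approx_mult K R0 HK (fun _ => (b' - b)%C)); [apply approx_const | apply approx_inv; exact Kb].
    + intros z Kz. destruct (Hz z Kz). apply step_ratio_small; assumption.
  - exact E.
  - intros z Kz Far. specialize (E z Kz). specialize (S3 z Kz Far).
    destruct (Hf z Kz) as [_ F].
    assert (N : (z - a)%C <> RtoC 0) by (apply Cmod_neq_0; lra).
    set (s := (S z * f z)%C) in *.
    (* Both factors have argument below pi/4 in modulus, so the product has positive real part. Its
       square is within 1/2 of 1, because |b' - a| < 2h <= |z - a|/2; hence its argument is again
       below pi/4. *)
    assert (P : 0 < fst s).
    { change (0 < fst (S z) * fst (f z) - snd (S z) * snd (f z)). apply Rabs_def2 in F. apply Rabs_def2 in S3.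
      assert (A1 : 0 < (fst (S z) - snd (S z)) * (fst (f z) + snd (f z)))
        by (apply Rmult_lt_0_compat; lra).
      assert (A2 : 0 < (fst (S z) + snd (S z)) * (fst (f z) - snd (f z)))
        by (apply Rmult_lt_0_compat; lra).
      lra. }
    assert (Q : (s * s = 1 - (b' - a) / (z - a))%C).
    { replace (s * s)%C with (s * s * (z - a) / (z - a))%C by (field; exact N).
      rewrite E. field. exact N. }
    assert (Q1 : 0 < fst (s * s)%C).
    { rewrite Q. apply fst_one_minus, step_ratio_small; lra. }
    change (0 < fst s * fst s - snd s * snd s) in Q1. clearbody s.
    apply Rabs_def1; apply Rnot_le_lt; intros L; nra.
Qed.

(** Suppose that no branch ends at a distance in [h, 2h) from a. Steps shorter than h cannot jump
    over this annulus, so being within h of a and the end of a branch is a locally constant property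
    of points outside K. It would then hold at points far away. *)
Lemma sqrt_branch_exists a h : ~ K a -> 0 < h ->
  exists b S, h <= Cmod (b - a) < 2 * h /\ sqrt_branch a h b S.
Proof.
  intros Ka Hh. apply NNPP. intros Hn.
  destruct (exists_far (Cmod a + h)) as [c [Kc [Hc _]]].
  assert (G : Cmod (c - a) < h /\ exists S, sqrt_branch a h c S).
  2:{ destruct G as [G _]. assert (T := Cmod_triangle_inv c a). lra. }
  revert c Kc Hc.
  enough (G : forall c, ~ K c -> Cmod (c - a) < h /\ exists S, sqrt_branch a h c S)
    by (intros; auto).
  apply (connected_locally_constant _
    (fun c => Cmod (c - a) < h /\ exists S, sqrt_branch a h c S) Hconn).
  - intros w Hw. destruct (complement_nearby w Hw) as [d [Hd H]]. exists (Rmin d h).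
    split; [apply Rmin_pos; assumption|]. intros w' Hw'.
    destruct (H w') as [H1 [H2 H3]].
    { eapply Rlt_le_trans; [exact Hw' | apply Rmin_l]. }
    assert (Hw'' : Cmod (w' - w) < h) by (eapply Rlt_le_trans; [exact Hw' | apply Rmin_r]).
    assert (Step : forall b b', ~ K b -> Cmod (b' - b) < h ->
      (forall z, K z -> 0 < Cmod (z - b) /\ 2 * Cmod (b' - b) <= Cmod (z - b)) ->
      (Cmod (b - a) < h /\ exists S, sqrt_branch a h b S) ->
      (Cmod (b' - a) < h /\ exists S, sqrt_branch a h b' S)).
    { intros b b' Kb Hbb Hz [Hb [S HS]].
      assert (T := Cmod_sub_triangle b' b a).
      destruct (sqrt_branch_step a h b b' S Hh Ka Kb Hz) as [S' HS']; [lra | exact HS |].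
      destruct (Rlt_le_dec (Cmod (b' - a)) h) as [L|L].
      - split; [exact L | exists S'; exact HS'].
      - exfalso. apply Hn. exists b', S'. split; [lra | exact HS']. }
    split; [exact H1|]. split; apply Step; auto. rewrite Cmod_sub_sym; exact Hw''.
  - exists a. split; [exact Ka|].
    replace (a - a)%C with (RtoC 0) by ring. rewrite Cmod_0. split; [exact Hh|].
    exists (fun _ => RtoC 1). split; [|split].
    + apply approx_const.
    + intros z _. ring.
    + intros z _ _. simpl. rewrite Rabs_R0. lra.
Qed.

(* Joukowski's map: z - (a+b)/2 - sqrt ((z-a)(z-b)) is bounded off an arc from
   [a] to [b] and behaves like (b-a)^2 / (8 (z-a)) at infinity. *)
Lemma cauchy_kernel_off a h : ~ K a -> 0 < h ->
  exists g, approx K g /\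
    (forall z, K z -> Cmod (g z) * h <= 80 /\ Cmod (g z) * Cmod (z - a) <= 320) /\
    (forall z, K z -> 4 * h <= Cmod (z - a) ->
       Cmod (g z - / (z - a)) * (Cmod (z - a) * Cmod (z - a)) <= 6 * h).
Proof.
  intros Ka Hh. destruct (sqrt_branch_exists a h Ka Hh) as [b [S [Hb [S1 [S2 S3]]]]].
  set (d := (b - a)%C) in *.
  assert (Nd : d <> RtoC 0) by (apply Cmod_neq_0; lra).
  (* The factor 8/d^2 normalises the leading term at infinity to 1/(z - a). *)
  set (g := fun z => (8 / (d * d) * ((z - a) - d / 2 - (z - a) * S z))%C).
  assert (Far : forall z, K z -> 4 * h <= Cmod (z - a) ->
    Cmod (g z - / (z - a)) * (Cmod (z - a) * Cmod (z - a)) <= 6 * h /\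
    Cmod (g z) * Cmod (z - a) <= 4).
  { intros z Kz Hz. specialize (S2 z Kz). specialize (S3 z Kz Hz).
    unfold g.
    set (t := (z - a)%C) in *. set (s := S z) in *. clearbody s.
    assert (Nt : t <> RtoC 0) by (apply Cmod_neq_0; lra).
    set (u := (d / t)%C).
    assert (Eu : (d = u * t)%C) by (unfold u; field; exact Nt).
    assert (Ct : 0 < Cmod t) by lra.
    assert (Cu : Cmod u * Cmod t = Cmod d) by (rewrite Eu, Cmod_mult; ring).
    assert (Nu : u <> RtoC 0).
    { intros E. rewrite E in Eu. apply Nd. rewrite Eu. ring. }
    assert (Q : (s * s = 1 - u)%C).
    { assert (Eb : (z - b = t - d)%C) by (unfold t, d; ring).
      rewrite Eb in S2.
      replace (s * s)%C with (s * s * t / t)%C by (field; exact Nt).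
      rewrite S2, Eu. field. exact Nt. }
    assert (Y : Cmod (1 - s) <= Cmod u).
    { apply one_minus_csqrt_small; [exact Q|]. assert (T := Rabs_pos (snd s)). lra. }
    set (y := (1 - s)%C) in *.
    assert (Yu : (2 * y = u + y * y)%C).
    { unfold y. replace ((1 - s) * (1 - s))%C with (1 - 2 * s + s * s)%C by ring.
      rewrite Q. ring. }
    (* Since 2y - u = y^2, the difference containing the square root becomes the quotient 4 y^2 /
       (u^2 t), in which y is about u/2; no cancellation is left to estimate. *)
    assert (Gy : (8 / (d * d) * (t - d / 2 - t * s) = 4 * (y * y) / (u * u * t))%C).
    { replace (t - d / 2 - t * s)%C with (t * (2 * y - u) / 2)%C
        by (unfold y; rewrite Eu; field).
      rewrite Yu, Eu. field. split; assumption. }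
    assert (C4 : Cmod 4 = 4) by (rewrite Cmod_R, Rabs_pos_eq; lra).
    assert (Pu : 0 < Cmod u) by (apply Cmod_gt_0; exact Nu).
    assert (Py := Cmod_ge_0 y).
    assert (Nuu : (u * u)%C <> RtoC 0) by (apply Cmult_neq_0; exact Nu).
    rewrite Gy. split.
    - replace (4 * (y * y) / (u * u * t) - / t)%C
        with (((2 * y - u) * (2 * y + u)) / (u * u * t))%C by (field; split; assumption).
      replace (2 * y - u)%C with (y * y)%C by (rewrite Yu; ring).
      rewrite Cmod_div by (apply Cmult_neq_0; assumption).
      rewrite !Cmod_mult.
      assert (T := Cmod_triangle (2 * y) u). rewrite Cmod_mult in T.
      assert (C2 : Cmod 2 = 2) by (rewrite Cmod_R, Rabs_pos_eq; lra).
      rewrite C2 in T.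
      replace (Cmod y * Cmod y * Cmod (2 * y + u) / (Cmod u * Cmod u * Cmod t) * (Cmod t * Cmod t))
        with ((Cmod y * Cmod y) / (Cmod u * Cmod u) * (Cmod (2 * y + u) * Cmod t))
        by (field; lra).
      assert (Q1 : (Cmod y * Cmod y) / (Cmod u * Cmod u) <= 1).
      { apply Rmult_le_reg_r with (Cmod u * Cmod u); [nra|].
        unfold Rdiv. rewrite Rmult_assoc, Rinv_l by nra. nra. }
      assert (Q0 : 0 <= (Cmod y * Cmod y) / (Cmod u * Cmod u)).
      { apply Rmult_le_pos; [nra|]. left. apply Rinv_0_lt_compat. nra. }
      assert (Q2 : Cmod (2 * y + u) * Cmod t <= 3 * Cmod d) by (rewrite <- Cu; nra).
      assert (Q3 : 0 <= Cmod (2 * y + u) * Cmod t) by (apply Rmult_le_pos; apply Cmod_ge_0).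
      nra.
    - rewrite Cmod_div by (apply Cmult_neq_0; assumption).
      rewrite !Cmod_mult, C4.
      replace (4 * (Cmod y * Cmod y) / (Cmod u * Cmod u * Cmod t) * Cmod t)
        with (4 * ((Cmod y * Cmod y) / (Cmod u * Cmod u))) by (field; lra).
      assert (Q1 : (Cmod y * Cmod y) / (Cmod u * Cmod u) <= 1).
      { apply Rmult_le_reg_r with (Cmod u * Cmod u); [nra|].
        unfold Rdiv. rewrite Rmult_assoc, Rinv_l by nra. nra. }
      lra. }
  exists g. split; [|split].
  - apply (approx_mult K R0 HK (fun _ => (8 / (d * d))%C)); [apply approx_const|].
    apply (approx_ext K (fun z => ((z + (- a - d / 2)) + (RtoC (-1)) * ((z + - a) * S z))%C)).
    { intros. replace (RtoC (-1)) with (- RtoC 1)%C by (rewrite <- RtoC_opp; reflexivity). ring. }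
    apply approx_plus.
    + apply approx_plus; [apply approx_id | apply approx_const].
    + apply (approx_mult K R0 HK (fun _ => RtoC (-1))); [apply approx_const|].
      apply (approx_mult K R0 HK); [|exact S1].
      apply approx_plus; [apply approx_id | apply approx_const].
  - intros z Kz. destruct (Rle_lt_dec (4 * h) (Cmod (z - a))) as [L|L].
    + destruct (Far z Kz L) as [_ F]. assert (P := Cmod_ge_0 (g z)). nra.
    + specialize (S2 z Kz). clear Far S3.
      (* Near a only the modulus of the branch is known: |(z - a) S|^2 = |z - a| |z - b| is at most
         4h * 6h, below the square of 5h. *)
      assert (E : Cmod ((z - a) * S z) <= 5 * h).
      { assert (Sq : (((z - a) * S z) * ((z - a) * S z) = (z - a) * (z - b))%C).
        { rewrite <- S2. ring. }
        apply (f_equal Cmod) in Sq. rewrite !(Cmod_mult (z - a)) in Sq.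
        rewrite (Cmod_mult (z - a)).
        assert (T : Cmod (z - b) <= 6 * h).
        { assert (T := Cmod_triangle_sub (z - a) d). unfold d in T.
          replace (z - a - (b - a))%C with (z - b)%C in T by ring. fold d in T. lra. }
        rewrite Cmod_mult, (Cmod_mult (z - a)) in Sq.
        assert (P := Cmod_ge_0 (z - a)). assert (P2 := Cmod_ge_0 (S z)).
        assert (P3 := Cmod_ge_0 (z - b)).
        apply Rsqr_incr_0_var; [|lra]. unfold Rsqr. nra. }
      assert (B : Cmod ((z - a) - d / 2 - (z - a) * S z) <= 10 * h).
      { eapply Rle_trans; [apply Cmod_triangle_sub|].
        assert (T := Cmod_triangle_sub (z - a) (d / 2)).
        rewrite Cmod_div in T by (apply Cmod_neq_0; rewrite Cmod_R, Rabs_pos_eq; lra).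
        replace (Cmod 2) with 2 in T by (rewrite Cmod_R, Rabs_pos_eq; lra). lra. }
      assert (G : Cmod (g z) * (h * h) <= 80 * h).
      { unfold g. rewrite Cmod_mult, Cmod_div by (apply Cmult_neq_0; assumption).
        rewrite Cmod_mult. replace (Cmod 8) with 8 by (rewrite Cmod_R, Rabs_pos_eq; lra).
        assert (Q1 : 8 / (Cmod d * Cmod d) * (h * h) <= 8).
        { apply Rmult_le_reg_r with (Cmod d * Cmod d); [nra|].
          replace (8 / (Cmod d * Cmod d) * (h * h) * (Cmod d * Cmod d)) with (8 * (h * h))
            by (field; lra). nra. }
        assert (Q0 : 0 <= 8 / (Cmod d * Cmod d) * (h * h)).
        { apply Rmult_le_pos; [|nra]. apply Rmult_le_pos; [lra|].
          left. apply Rinv_0_lt_compat. nra. }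
        assert (P := Cmod_ge_0 (z - a - d / 2 - (z - a) * S z)). nra. }
      assert (P := Cmod_ge_0 (g z)). assert (P1 := Cmod_ge_0 (z - a)).
      assert (G' : Cmod (g z) * h <= 80) by (apply Rmult_le_reg_r with h; nra).
      nra.
  - intros z Kz L. apply (Far z Kz L).
Qed.

(** Empty interior puts a pole a outside K within h of any centre; replacing a by zeta costs O(h /
    rho^2), the order of the error already present. The radius [rho] is a separate variable since
    the grid sum wants one bound for all distant cells. *)
Lemma cauchy_kernel_near zeta h : C_empty_interior K -> 0 < h ->
  exists g, approx K g /\
    (forall z, K z -> Cmod (g z) * h <= 400 /\ Cmod (g z) * Cmod (z - zeta) <= 400) /\
    (forall z rho, K z -> 10 * h <= rho -> rho <= Cmod (z - zeta) ->
       Cmod (g z - / (z - zeta)) * (rho * rho) <= 30 * h).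
Proof.
  intros Hint Hh.
  assert (exists a, ~ K a /\ Cmod (a - zeta) < h) as [a [Ka Ha]].
  { apply NNPP. intros Hn. apply Hint. exists zeta, h. split; [exact Hh|].
    intros w Hw. rewrite Cdist_Cmod in Hw. apply NNPP. intros Hk. apply Hn. exists w. tauto. }
  destruct (cauchy_kernel_off a h Ka Hh) as [g [G1 [G2 G3]]].
  exists g. split; [exact G1|]. split.
  - intros z Kz. destruct (G2 z Kz) as [A B]. assert (P := Cmod_ge_0 (g z)).
    split; [lra|]. assert (T := Cmod_sub_triangle z a zeta). nra.
  - intros z rho Kz Hr Hz.
    assert (T := Cmod_sub_triangle z a zeta).
    assert (L : 9 * rho / 10 <= Cmod (z - a)) by lra.
    assert (F := G3 z Kz ltac:(lra)).
    assert (N : (z - a)%C <> RtoC 0) by (apply Cmod_neq_0; lra).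
    assert (N' : (z - zeta)%C <> RtoC 0) by (apply Cmod_neq_0; lra).
    assert (D : Cmod (/ (z - a) - / (z - zeta)) * (rho * rho) <= 2 * h).
    { replace (/ (z - a) - / (z - zeta))%C with ((a - zeta) / ((z - a) * (z - zeta)))%C
        by (field; split; assumption).
      rewrite Cmod_div, Cmod_mult by (apply Cmult_neq_0; assumption).
      assert (Q : 81/100 * (rho * rho) <= Cmod (z - a) * Cmod (z - zeta)) by nra.
      assert (Qp : 0 < Cmod (z - a) * Cmod (z - zeta)) by nra.
      apply Rmult_le_reg_r with (Cmod (z - a) * Cmod (z - zeta)); [exact Qp|].
      replace (Cmod (a - zeta) / (Cmod (z - a) * Cmod (z - zeta)) * (rho * rho) *
        (Cmod (z - a) * Cmod (z - zeta))) with (Cmod (a - zeta) * (rho * rho)) by (field; lra).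
      assert (P := Cmod_ge_0 (a - zeta)). nra. }
    assert (F' : Cmod (g z - / (z - a)) * (rho * rho) <= 12 * h).
    { assert (P := Cmod_ge_0 (g z - / (z - a))).
      assert (81/100 * (rho * rho) <= Cmod (z - a) * Cmod (z - a)) by nra. nra. }
    assert (T2 := Cmod_sub_triangle (g z) (/ (z - a)) (/ (z - zeta))).
    assert (0 < rho * rho) by nra. nra.
Qed.

End Lavrentieff.

(** * Riemann sums for the Cauchy transform of a box *)

Fixpoint rsum (f : nat -> R) (n : nat) : R :=
  match n with O => 0 | S k => rsum f k + f k end.

Fixpoint csum (f : nat -> C) (n : nat) : C :=
  match n with O => RtoC 0 | S k => (csum f k + f k)%C end.

Lemma rsum_le f g n : (forall i, (i < n)%nat -> f i <= g i) -> rsum f n <= rsum g n.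
Proof.
  induction n as [|n IH]; simpl; intros H; [lra|].
  assert (A := IH (fun i Hi => H i ltac:(lia))). assert (B := H n ltac:(lia)). lra.
Qed.

Lemma rsum_telescope (G : nat -> R) n : rsum (fun i => G i - G (S i)) n = G O - G n.
Proof. induction n as [|n IH]; simpl; [ring | rewrite IH; ring]. Qed.

Lemma rsum_affine a b (f : nat -> R) n :
  rsum (fun i => a + b * f i) n = INR n * a + b * rsum f n.
Proof. induction n as [|n IH]; [simpl; ring|]. rewrite S_INR. simpl. rewrite IH. ring. Qed.

Lemma csum_telescope (G : nat -> C) n : csum (fun i => (G i - G (S i))%C) n = (G O - G n)%C.
Proof. induction n as [|n IH]; simpl; [ring | rewrite IH; ring]. Qed.

Lemma csum_dist_le (f g : nat -> C) n :
  Cmod (csum f n - csum g n) <= rsum (fun i => Cmod (f i - g i)) n.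
Proof.
  induction n as [|n IH]; simpl.
  - replace (0 - 0)%C with (RtoC 0) by ring. rewrite Cmod_0. lra.
  - replace (csum f n + f n - (csum g n + g n))%C
      with ((csum f n - csum g n) + (f n - g n))%C by ring.
    eapply Rle_trans; [apply Cmod_triangle|]. lra.
Qed.

Lemma csum_mod_le (f : nat -> C) n : Cmod (csum f n) <= rsum (fun i => Cmod (f i)) n.
Proof.
  induction n as [|n IH]; simpl; [rewrite Cmod_0; lra|].
  eapply Rle_trans; [apply Cmod_triangle|]. lra.
Qed.

Lemma approx_csum K (F : nat -> C -> C) n :
  (forall i, approx K (F i)) -> approx K (fun z => csum (fun i => F i z) n).
Proof.
  intros H. induction n as [|n IH]; simpl; [apply approx_const|].
  apply (approx_plus K (fun z => csum (fun i => F i z) n)); auto.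
Qed.

(* Odd square root: its increments dominate h / sqrt|s|, which turns sums of
   h / sqrt|s| over a grid into telescoping sums. *)
Definition osqrt (s : R) : R := if Rle_dec 0 s then sqrt s else - sqrt (- s).

Lemma osqrt_pos s : 0 <= s -> osqrt s = sqrt s.
Proof. intros H. unfold osqrt. destruct (Rle_dec 0 s); [reflexivity | lra]. Qed.

Lemma osqrt_neg s : s <= 0 -> osqrt s = - sqrt (- s).
Proof.
  intros H. unfold osqrt. destruct (Rle_dec 0 s) as [L|L]; [|reflexivity].
  replace s with 0 by lra. rewrite Ropp_0, sqrt_0. ring.
Qed.

Lemma osqrt_incr s t : s <= t -> osqrt s <= osqrt t.
Proof.
  intros H. destruct (Rle_dec 0 s) as [A|A].
  - rewrite !osqrt_pos by lra. apply sqrt_le_1_alt. exact H.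
  - rewrite (osqrt_neg s) by lra. destruct (Rle_dec 0 t) as [B|B].
    + rewrite osqrt_pos by lra. assert (P := sqrt_pos t). assert (Q := sqrt_pos (- s)). lra.
    + rewrite osqrt_neg by lra. apply Ropp_le_contravar, sqrt_le_1_alt. lra.
Qed.

Lemma sqrt_increment p h m : 0 < h -> h <= p -> h <= m -> p - h / 2 <= m ->
  h <= 4 * sqrt m * (sqrt p - sqrt (p - h)).
Proof.
  intros Hh Hp Hm Hpm.
  assert (A := sqrt_sqrt p ltac:(lra)). assert (B := sqrt_sqrt (p - h) ltac:(lra)).
  assert (M := sqrt_sqrt m ltac:(lra)).
  assert (A0 := sqrt_pos p). assert (B0 := sqrt_pos (p - h)). assert (M0 := sqrt_pos m).
  assert (BA : sqrt (p - h) <= sqrt p) by (apply sqrt_le_1_alt; lra).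
  set (a := sqrt p) in *. set (b := sqrt (p - h)) in *. set (c := sqrt m) in *.
  assert (E : a * a - b * b = h) by lra.
  assert (Q : a <= 2 * c).
  { apply Rsqr_incr_0_var; [|lra]. unfold Rsqr. nra. }
  nra.
Qed.

(** p - h/2 is the midpoint of the cell [p - h, p], and the maximum with h replaces |s| on cells
    close to 0. On a cell straddling 0 the increment sqrt p + sqrt (h - p) is at least sqrt h. *)
Lemma osqrt_increment p h : 0 < h ->
  h <= 4 * sqrt (Rmax h (Rabs (p - h / 2))) * (osqrt p - osqrt (p - h)).
Proof.
  intros Hh. set (m := Rmax h (Rabs (p - h / 2))).
  assert (M1 : h <= m) by apply Rmax_l.
  assert (M2 : Rabs (p - h / 2) <= m) by apply Rmax_r.
  assert (M3 : p - h / 2 <= m) by (eapply Rle_trans; [apply Rle_abs | exact M2]).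
  assert (M4 : - (p - h / 2) <= m).
  { eapply Rle_trans; [apply Rle_abs | rewrite Rabs_Ropp; exact M2]. }
  destruct (Rle_dec h p) as [A|A].
  - rewrite !osqrt_pos by lra. apply sqrt_increment; assumption.
  - rewrite (osqrt_neg (p - h)) by lra. destruct (Rle_dec p 0) as [B|B].
    + rewrite osqrt_neg by lra.
      assert (T := sqrt_increment (- (p - h)) h m Hh ltac:(lra) M1 ltac:(lra)).
      replace (- (p - h) - h) with (- p) in T by ring. lra.
    + rewrite osqrt_pos by lra.
      assert (Q := sqrt_sqrt m ltac:(lra)). assert (P := sqrt_pos m).
      assert (Q1 := sqrt_sqrt p ltac:(lra)). assert (P1 := sqrt_pos p).
      assert (Q2 := sqrt_sqrt (- (p - h)) ltac:(lra)). assert (P2 := sqrt_pos (- (p - h))).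
      assert (Q3 := sqrt_sqrt h ltac:(lra)). assert (P3 := sqrt_pos h).
      assert (L1 : sqrt h <= sqrt m) by (apply sqrt_le_1_alt; lra).
      assert (L2 : sqrt h <= sqrt p + sqrt (- (p - h))).
      { apply Rsqr_incr_0_var; [|lra]. unfold Rsqr. nra. }
      nra.
Qed.

(** Up to sign the two differences are the real and imaginary parts of 1/z - 1/w = (w - z)/(zw) for
    z = X + iY and w = X + iY', where |zw| >= rho^2. *)
Lemma mod_inv_diff (X Y Y' rho : R) : 0 < rho -> rho <= Rabs X ->
  Rabs (X / (X * X + Y * Y) - X / (X * X + Y' * Y')) <= Rabs (Y - Y') / (rho * rho) /\
  Rabs (Y / (X * X + Y * Y) - Y' / (X * X + Y' * Y')) <= Rabs (Y - Y') / (rho * rho).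
Proof.
  intros Hr HX.
  assert (X2 : rho * rho <= X * X).
  { replace (X * X) with (Rabs X * Rabs X)
      by (rewrite <- Rabs_mult; apply Rabs_pos_eq; nra). nra. }
  assert (P : 0 < rho * rho) by nra.
  set (z := (X, Y) : C). set (w := (X, Y') : C).
  assert (Nz : z <> RtoC 0) by (intros E; injection E; intros; nra).
  assert (Nw : w <> RtoC 0) by (intros E; injection E; intros; nra).
  assert (D : Cmod (/ z - / w) <= Rabs (Y - Y') / (rho * rho)).
  { replace (/ z - / w)%C with ((w - z) / (z * w))%C by (field; split; assumption).
    rewrite Cmod_div, Cmod_mult by (apply Cmult_neq_0; assumption).
    replace (Cmod (w - z)) with (Rabs (Y - Y')).
    2:{ rewrite Cmod_sub_sym. unfold z, w, Cmod, Cminus, Cplus, Copp. simpl.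
        rewrite <- sqrt_Rsqr_abs. f_equal. unfold Rsqr. ring. }
    assert (Lz : rho <= Cmod z) by (eapply Rle_trans; [exact HX | apply (fst_le_Cmod z)]).
    assert (Lw : rho <= Cmod w) by (eapply Rle_trans; [exact HX | apply (fst_le_Cmod w)]).
    apply Rmult_le_compat_l; [apply Rabs_pos|]. apply Rinv_le_contravar; nra. }
  assert (E1 : fst (/ z - / w)%C = X / (X * X + Y * Y) - X / (X * X + Y' * Y')).
  { unfold z, w. simpl. field. split; nra. }
  assert (E2 : snd (/ z - / w)%C = - (Y / (X * X + Y * Y) - Y' / (X * X + Y' * Y'))).
  { unfold z, w. simpl. field. split; nra. }
  split.
  - rewrite <- E1. eapply Rle_trans; [apply fst_le_Cmod | exact D].
  - rewrite <- Rabs_Ropp, <- E2. eapply Rle_trans; [apply snd_le_Cmod | exact D].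
Qed.

(* The derivative in [v] is 1 / (X + iv). *)
Definition vprim (X v : R) : C := (atan (v / X), - / 2 * ln (X * X + v * v)).

(** The mean value theorem gives separate points t and s for the real and the imaginary part; both
    lie in the cell, hence within h of its midpoint. *)
Lemma vprim_cell X v h rho : 0 < h -> 0 < rho -> rho <= Rabs X ->
  Cmod (RtoC h * / (X, v - h / 2) - (vprim X v - vprim X (v - h))) <= 2 * (h * h) / (rho * rho).
Proof.
  intros Hh Hr HX.
  assert (NX : X <> 0) by (intros E; rewrite E, Rabs_R0 in HX; lra).
  assert (XX : 0 < X * X) by nra.
  destruct (MVT_cor2 (fun t => atan (t / X)) (fun t => X / (X * X + t * t)) (v - h) v)
    as [t [Et Ht]]; [lra | |].
  { intros c _. apply is_derive_Reals. auto_derive; [exact I|]. field. split; nra. }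
  destruct (MVT_cor2 (fun t => - / 2 * ln (X * X + t * t)) (fun t => - (t / (X * X + t * t))) (v - h) v)
    as [s [Es Hs]]; [lra | |].
  { intros c _. apply is_derive_Reals. auto_derive; [nra|]. field. nra. }
  set (Y := v - h / 2) in *.
  assert (B : forall q, v - h < q < v -> Rabs (Y - q) <= h).
  { intros q Hq. unfold Y. apply Rabs_le. lra. }
  destruct (mod_inv_diff X Y t rho Hr HX) as [D1 _].
  destruct (mod_inv_diff X Y s rho Hr HX) as [_ D2].
  assert (Pr : 0 < / (rho * rho)) by (apply Rinv_0_lt_compat; nra).
  assert (D1' : Rabs (X / (X * X + Y * Y) - X / (X * X + t * t)) <= h * / (rho * rho)).
  { eapply Rle_trans; [exact D1|]. apply Rmult_le_compat_r; [lra|]. apply B, Ht. }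
  assert (D2' : Rabs (Y / (X * X + Y * Y) - s / (X * X + s * s)) <= h * / (rho * rho)).
  { eapply Rle_trans; [exact D2|]. apply Rmult_le_compat_r; [lra|]. apply B, Hs. }
  eapply Rle_trans; [apply Cmod_le_abs|].
  replace (fst (RtoC h * / (X, Y) - (vprim X v - vprim X (v - h)))%C)
    with (h * (X / (X * X + Y * Y) - X / (X * X + t * t))).
  2:{ unfold vprim. simpl.
      replace (atan (v / X) + - atan ((v - h) / X)) with (X / (X * X + t * t) * (v - (v - h)))
        by (rewrite <- Et; ring). field. repeat split; nra. }
  replace (snd (RtoC h * / (X, Y) - (vprim X v - vprim X (v - h)))%C)
    with (- h * (Y / (X * X + Y * Y) - s / (X * X + s * s))).
  2:{ unfold vprim. simpl.
      replace (- / 2 * ln (X * X + v * v) + - (- / 2 * ln (X * X + (v - h) * (v - h))))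
        with (- (s / (X * X + s * s)) * (v - (v - h)))
        by (rewrite <- Es; ring). field. repeat split; nra. }
  rewrite !Rabs_mult, Rabs_Ropp, (Rabs_pos_eq h) by lra.
  replace (2 * (h * h) / (rho * rho)) with (h * (h * / (rho * rho)) + h * (h * / (rho * rho)))
    by (field; lra).
  nra.
Qed.

Lemma atan_upper x : 0 <= x -> atan x <= x.
Proof.
  intros [H|H]; [|subst; rewrite atan_0; lra].
  destruct (MVT_cor2 atan (fun c => / (1 + c ^ 2)) 0 x H) as [c [E Hc]].
  { intros. apply derivable_pt_lim_atan. }
  rewrite atan_0 in E.
  assert (/ (1 + c ^ 2) <= 1).
  { rewrite <- Rinv_1 at 2. apply Rinv_le_contravar; nra. }
  nra.
Qed.

Lemma atan_near_pi2 w : 0 < w -> Rabs (PI / 2 - atan w) <= / w.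
Proof.
  intros H. rewrite <- (Rinv_inv w) at 1.
  assert (Q : 0 < / w) by (apply Rinv_0_lt_compat; exact H).
  rewrite atan_inv by exact Q.
  replace (PI / 2 - (PI / 2 - atan (/ w))) with (atan (/ w)) by ring.
  assert (U := atan_upper (/ w) ltac:(lra)).
  assert (atan 0 < atan (/ w)) by (apply atan_increasing; exact Q).
  rewrite atan_0 in *. rewrite Rabs_pos_eq; lra.
Qed.

Lemma ln_diff_le a b m : 0 < m -> m <= a -> m <= b -> Rabs (ln a - ln b) <= Rabs (a - b) / m.
Proof.
  intros Hm Ha Hb.
  assert (G : forall a b, m <= a -> a < b -> Rabs (ln a - ln b) <= Rabs (a - b) / m).
  { clear a b Ha Hb. intros a b Ha Hab.
    destruct (MVT_cor2 ln (fun c => / c) a b Hab) as [c [E Hc]].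
    { intros. apply derivable_pt_lim_ln. lra. }
    assert (Q : / c <= / m) by (apply Rinv_le_contravar; lra).
    assert (Q0 : 0 < / c) by (apply Rinv_0_lt_compat; lra).
    rewrite Rabs_minus_sym, E, (Rabs_minus_sym a), Rabs_pos_eq, Rabs_pos_eq by nra.
    unfold Rdiv. nra. }
  destruct (Rtotal_order a b) as [L|[L|L]].
  - apply G; assumption.
  - subst. rewrite !Rminus_diag, Rabs_R0. unfold Rdiv. lra.
  - rewrite (Rabs_minus_sym (ln a)), (Rabs_minus_sym a). apply G; assumption.
Qed.

Definition rsign (X : R) : R := if Rle_dec 0 X then 1 else -1.

Lemma atan_ratio_far (w X B L : R) : 0 < L -> X <> 0 -> Rabs X <= B -> L / 2 <= w ->
  Rabs (rsign X * (PI / 2) - atan (w / X)) <= 2 * B / L.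
Proof.
  intros HL NX HX Hw.
  assert (Q : / (w / Rabs X) <= 2 * B / L).
  { assert (P : 0 < Rabs X) by (apply Rabs_pos_lt; exact NX).
    replace (/ (w / Rabs X)) with (Rabs X * / w) by (field; lra).
    replace (2 * B / L) with (B * / (L / 2)) by (field; lra).
    apply Rmult_le_compat; try lra.
    - left. apply Rinv_0_lt_compat. lra.
    - apply Rinv_le_contravar; lra. }
  unfold rsign. destruct (Rle_dec 0 X) as [A|A].
  - rewrite Rabs_pos_eq in Q by exact A. rewrite Rmult_1_l.
    eapply Rle_trans; [apply atan_near_pi2 | exact Q].
    apply Rdiv_lt_0_compat; lra.
  - rewrite Rabs_left in Q by lra.
    replace (w / X) with (- (w / - X)) by (field; exact NX). rewrite atan_opp.
    replace (-1 * (PI / 2) - - atan (w / - X)) with (- (PI / 2 - atan (w / - X))) by ring.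
    rewrite Rabs_Ropp.
    eapply Rle_trans; [apply atan_near_pi2 | exact Q].
    apply Rdiv_lt_0_compat; lra.
Qed.

(** The arctangents at the ends of a tall segment combine to pi times the sign of X, and the
    logarithms cancel up to O(R0 / L) because the ends are nearly symmetric about the real axis. *)
Lemma vprim_total X y R0 L : 0 < R0 -> X <> 0 -> Rabs X <= 2 * R0 -> Rabs y <= R0 -> 2 * R0 <= L ->
  Cmod (vprim X (y + L) - vprim X (y - L) - RtoC (rsign X * PI)) <= 16 * R0 / L.
Proof.
  intros HR NX HX Hy HL.
  assert (Hy1 := Rle_abs y). assert (Hy2 := Rle_abs (- y)). rewrite Rabs_Ropp in Hy2.
  assert (A1 := atan_ratio_far (y + L) X (2 * R0) L ltac:(lra) NX HX ltac:(lra)).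
  assert (A2 := atan_ratio_far (L - y) X (2 * R0) L ltac:(lra) NX HX ltac:(lra)).
  assert (D := ln_diff_le (X * X + (y + L) * (y + L)) (X * X + (y - L) * (y - L)) (L / 2 * (L / 2))
    ltac:(nra) ltac:(nra) ltac:(nra)).
  eapply Rle_trans; [apply Cmod_le_abs|]. unfold vprim. simpl.
  replace (atan ((y + L) / X) + - atan ((y - L) / X) + - (rsign X * PI))
    with (- (rsign X * (PI / 2) - atan ((y + L) / X)) - (rsign X * (PI / 2) - atan ((L - y) / X))).
  2:{ replace ((y - L) / X) with (- ((L - y) / X)) by (field; exact NX).
      rewrite atan_opp. field. }
  replace (- / 2 * ln (X * X + (y + L) * (y + L)) + - (- / 2 * ln (X * X + (y - L) * (y - L))) + - 0)
    with (- / 2 * (ln (X * X + (y + L) * (y + L)) - ln (X * X + (y - L) * (y - L)))) by ring.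
  rewrite Rabs_mult, Rabs_Ropp, (Rabs_pos_eq (/ 2)) by lra.
  replace (X * X + (y + L) * (y + L) - (X * X + (y - L) * (y - L))) with (4 * L * y) in D by ring.
  rewrite Rabs_mult, (Rabs_pos_eq (4 * L)) in D by lra.
  assert (D' : 4 * L * Rabs y / (L / 2 * (L / 2)) <= 16 * R0 / L).
  { replace (4 * L * Rabs y / (L / 2 * (L / 2))) with (16 * Rabs y / L) by (field; lra).
    apply Rmult_le_compat_r; [left; apply Rinv_0_lt_compat; lra | lra]. }
  assert (T := Rabs_triang (- (rsign X * (PI / 2) - atan ((y + L) / X)))
     (- (rsign X * (PI / 2) - atan ((L - y) / X)))).
  rewrite !Rabs_Ropp in T.
  replace (2 * (2 * R0) / L) with (4 * R0 / L) in A1, A2 by (field; lra).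
  replace (16 * R0 / L) with (4 * R0 / L + 4 * R0 / L + / 2 * (16 * R0 / L)) by (field; lra).
  unfold Rminus at 1. lra.
Qed.

(* [g j] is the value at z of the kernel attached to the j-th cell of a column;
   z minus the centre of that cell is (X, y + L - j h - h / 2). *)
Lemma column_far (X y R0 L h rho : R) (J : nat) (g : nat -> C) :
  0 < R0 -> 0 < h -> 0 < rho -> rho <= Rabs X -> Rabs X <= 2 * R0 -> Rabs y <= R0 ->
  2 * R0 <= L -> INR J * h = 2 * L ->
  (forall j, Cmod (g j - / (X, y + L - INR j * h - h / 2)) * (rho * rho) <= 30 * h) ->
  Cmod (csum (fun j => (RtoC (h * h) * g j)%C) J - RtoC (h * (rsign X * PI)))
    <= h * (64 * L * h / (rho * rho) + 16 * R0 / L).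
Proof.
  intros HR Hh Hr HX HX2 Hy HL HJ Hg.
  assert (NX : X <> 0) by (intros E; rewrite E, Rabs_R0 in HX; lra).
  set (d := fun j : nat => (RtoC h * (vprim X (y + L - INR j * h) - vprim X (y + L - INR (S j) * h)))%C).
  assert (Pr : 0 < / (rho * rho)) by (apply Rinv_0_lt_compat; nra).
  (* Each cell errs by 30 h^3 / rho^2 from the kernel and by 2 h^3 / rho^2 from the midpoint rule;
     there are J = 2L / h cells. *)
  assert (A : Cmod (csum (fun j => (RtoC (h * h) * g j)%C) J - csum d J)
     <= INR J * (32 * (h * h * h) / (rho * rho))).
  { eapply Rle_trans; [apply csum_dist_le|].
    eapply Rle_trans; [apply (rsum_le _ (fun i => 32 * (h * h * h) / (rho * rho) + 0 * 0))|].
    2:{ rewrite (rsum_affine _ 0 (fun _ => 0)). lra. }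
    intros j _. rewrite Rmult_0_r, Rplus_0_r.
    set (w := (X, y + L - INR j * h - h / 2) : C).
    replace (RtoC (h * h) * g j - d j)%C
      with (RtoC (h * h) * (g j - / w) + RtoC h * (RtoC h * / w -
         (vprim X (y + L - INR j * h) - vprim X (y + L - INR j * h - h))))%C.
    2:{ unfold d. rewrite S_INR, RtoC_mult.
        replace (y + L - (INR j + 1) * h) with (y + L - INR j * h - h) by ring. ring. }
    eapply Rle_trans; [apply Cmod_triangle|]. rewrite !(Cmod_mult (RtoC _)), !Cmod_R.
    rewrite !Rabs_pos_eq by nra.
    assert (V := vprim_cell X (y + L - INR j * h) h rho Hh Hr HX). fold w in V.
    specialize (Hg j). fold w in Hg.
    assert (Hg' : Cmod (g j - / w) <= 30 * h * / (rho * rho)).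
    { apply Rmult_le_reg_r with (rho * rho); [nra|].
      rewrite Rmult_assoc, Rinv_l by nra. lra. }
    unfold Rdiv in *.
    replace (32 * (h * h * h) * / (rho * rho))
      with (h * h * (30 * h * / (rho * rho)) + h * (2 * (h * h) * / (rho * rho))) by ring.
    apply Rplus_le_compat; apply Rmult_le_compat_l; nra. }
  assert (B : csum d J = (RtoC h * (vprim X (y + L) - vprim X (y - L)))%C).
  { assert (S0 : forall n, csum d n = (RtoC h * (vprim X (y + L) - vprim X (y + L - INR n * h)))%C).
    { induction n as [|n IH].
      - simpl. rewrite Rmult_0_l, Rminus_0_r. ring.
      - change (csum d (S n)) with (csum d n + d n)%C. rewrite IH. unfold d.
        generalize (vprim X (y + L)) (vprim X (y + L - INR n * h)) (vprim X (y + L - INR (S n) * h)).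
        intros; ring. }
    rewrite S0, HJ. replace (y + L - 2 * L) with (y - L) by ring. reflexivity. }
  rewrite B in A.
  assert (V := vprim_total X y R0 L HR NX HX2 Hy HL).
  eapply Rle_trans; [apply (Cmod_sub_triangle _ (RtoC h * (vprim X (y + L) - vprim X (y - L))))|].
  assert (V' : Cmod (RtoC h * (vprim X (y + L) - vprim X (y - L)) - RtoC (h * (rsign X * PI)))
    <= h * (16 * R0 / L)).
  { replace (RtoC h * (vprim X (y + L) - vprim X (y - L)) - RtoC (h * (rsign X * PI)))%C
      with (RtoC h * (vprim X (y + L) - vprim X (y - L) - RtoC (rsign X * PI)))%C
      by (rewrite (RtoC_mult h); ring).
    rewrite Cmod_mult, Cmod_R, Rabs_pos_eq by lra. apply Rmult_le_compat_l; lra. }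
  replace (INR J * (32 * (h * h * h) / (rho * rho))) with (h * (64 * L * h / (rho * rho))) in A.
  2:{ replace (64 * L) with (32 * (INR J * h)) by (rewrite HJ; ring). field. lra. }
  lra.
Qed.

(** |g| is at most 400 / max(a, b), hence at most 400 / sqrt (a b), where a and b are |X| and |Y|
    cut off below at h. The bound separates, and each factor h / sqrt is dominated by increments of
    [osqrt]: those in y telescope here, those in x over the columns later. *)
Lemma column_near (X s y R0 L h : R) (J : nat) (g : nat -> C) :
  0 < R0 -> 0 < h -> Rabs y <= R0 -> 2 * R0 <= L -> INR J * h = 2 * L -> X = s - h / 2 ->
  (forall j, Cmod (g j) * h <= 400 /\
     Cmod (g j) * Cmod (X, y + L - INR j * h - h / 2) <= 400) ->
  Cmod (csum (fun j => (RtoC (h * h) * g j)%C) J)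
    <= 12800 * sqrt (2 * L) * (osqrt s - osqrt (s - h)).
Proof.
  intros HR Hh Hy HL HJ EX Hg.
  assert (Ox : 0 <= osqrt s - osqrt (s - h)).
  { assert (T := osqrt_incr (s - h) s ltac:(lra)). lra. }
  eapply Rle_trans; [apply csum_mod_le|].
  set (v := fun j : nat => osqrt (y + L - INR j * h)).
  eapply Rle_trans; [apply (rsum_le _
     (fun j => 0 + 6400 * (osqrt s - osqrt (s - h)) * (v j - v (S j))))|].
  - intros j _. destruct (Hg j) as [G1 G2].
    rewrite Cmod_mult, Cmod_R, Rabs_pos_eq by nra.
    assert (Ix := osqrt_increment s h Hh). rewrite <- EX in Ix.
    assert (Iy := osqrt_increment (y + L - INR j * h) h Hh).
    unfold v. rewrite S_INR.
    replace (y + L - (INR j + 1) * h) with (y + L - INR j * h - h) by ring.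
    set (Y := y + L - INR j * h - h / 2) in *.
    set (dx := osqrt s - osqrt (s - h)) in *.
    assert (Oy : 0 <= osqrt (y + L - INR j * h) - osqrt (y + L - INR j * h - h)).
    { assert (T := osqrt_incr (y + L - INR j * h - h) (y + L - INR j * h) ltac:(lra)). lra. }
    set (dy := osqrt (y + L - INR j * h) - osqrt (y + L - INR j * h - h)) in *.
    set (a := Rmax h (Rabs X)) in *. set (b := Rmax h (Rabs Y)) in *.
    assert (Pg := Cmod_ge_0 (g j)).
    assert (Fx := fst_le_Cmod (X, Y)). assert (Fy := snd_le_Cmod (X, Y)). simpl in Fx, Fy.
    assert (Ga : Cmod (g j) * a <= 400) by (unfold a; unfold Rmax; destruct (Rle_dec h (Rabs X)); nra).
    assert (Gb : Cmod (g j) * b <= 400) by (unfold b; unfold Rmax; destruct (Rle_dec h (Rabs Y)); nra).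
    assert (La : h <= a) by apply Rmax_l. assert (Lb : h <= b) by apply Rmax_l.
    assert (Qa := sqrt_sqrt a ltac:(lra)). assert (Qb := sqrt_sqrt b ltac:(lra)).
    assert (Pa := sqrt_pos a). assert (Pb := sqrt_pos b).
    set (p := sqrt a) in *. set (q := sqrt b) in *.
    clearbody a b p q dx dy.
    assert (Gpq : Cmod (g j) * (p * q) <= 400).
    { assert (T : p * q <= (a + b) / 2) by (assert (T := Rle_0_sqr (p - q)); unfold Rsqr in T; lra).
      apply Rle_trans with (Cmod (g j) * ((a + b) / 2)); [apply Rmult_le_compat_l; assumption | lra]. }
    assert (H2 : h * h <= (4 * p * dx) * (4 * q * dy)).
    { apply Rmult_le_compat; lra. }
    assert (H3 : h * h * Cmod (g j) <= (4 * p * dx) * (4 * q * dy) * Cmod (g j))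
      by (apply Rmult_le_compat_r; assumption).
    assert (0 <= dx * dy) by nra. nra.
  - rewrite rsum_affine, rsum_telescope. unfold v. simpl.
    replace (y + L - 0 * h) with (y + L) by ring.
    rewrite HJ. replace (y + L - 2 * L) with (y - L) by ring.
    assert (Hy1 := Rle_abs y). assert (Hy2 := Rle_abs (- y)). rewrite Rabs_Ropp in Hy2.
    assert (A : osqrt (y + L) <= sqrt (2 * L)).
    { rewrite osqrt_pos by lra. apply sqrt_le_1_alt. lra. }
    assert (B : - osqrt (y - L) <= sqrt (2 * L)).
    { rewrite osqrt_neg by lra. rewrite Ropp_involutive. apply sqrt_le_1_alt. lra. }
    nra.
Qed.

(** Truncation to [-r, r]. Composed with [osqrt], it lets a telescoping sum over all columns charge
    only those close to Re z. *)
Definition clip (r s : R) : R := Rmax (- r) (Rmin r s).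

Lemma clip_incr r s t : s <= t -> clip r s <= clip r t.
Proof. intros H. unfold clip. apply Rle_max_compat_l, Rle_min_compat_l, H. Qed.

Lemma clip_id r s : - r <= s <= r -> clip r s = s.
Proof. intros H. unfold clip. rewrite Rmin_right, Rmax_right; lra. Qed.

Lemma clip_bound r s : 0 <= r -> - r <= clip r s <= r.
Proof.
  intros H. unfold clip. split; [apply Rmax_l|]. apply Rmax_lub; [lra | apply Rmin_l].
Qed.

Lemma osqrt_clip_range r s t : 0 <= r -> osqrt (clip r s) - osqrt (clip r t) <= 2 * sqrt r.
Proof.
  intros H. assert (A := clip_bound r s H). assert (B := clip_bound r t H).
  assert (A' : osqrt (clip r s) <= osqrt r) by (apply osqrt_incr; lra).
  assert (B' : osqrt (- r) <= osqrt (clip r t)) by (apply osqrt_incr; lra).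
  rewrite (osqrt_pos r) in A' by lra. rewrite (osqrt_neg (- r)), Ropp_involutive in B' by lra. lra.
Qed.

(** * The grid of kernels and the approximation of conj z *)

Section Lavrentieff.
Context (K : C -> Prop) (R0 : R) (HK : bounded_by K R0) (HR0 : 0 < R0).
Context (Hclosed : forall a, ~ K a -> exists d, 0 < d /\ forall z, K z -> d <= Cmod (z - a)).
Context (Hconn : C_connected (fun z => ~ K z)) (Hint : C_empty_interior K).

(** The box [-R0, R0] x [-L, L] is cut into n by J squares of side h. Columns at horizontal distance
    at least rho from z are compared with their exact integral; the others are only bounded, and
    contribute O(sqrt rho) in total for fixed L. *)
Lemma grid_sum (L rho : R) (n J : nat) :
  2 * R0 <= L -> 0 < rho <= 1 ->
  let h := 2 * R0 / INR n in
  (0 < n)%nat -> INR J * h = 2 * L -> 10 * h <= rho ->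
  exists F, approx K F /\ forall z, K z ->
    Cmod (F z - RtoC (2 * PI * fst z)) <=
      2 * R0 * (64 * L * h / (rho * rho) + 16 * R0 / L) +
      (12800 * sqrt (2 * L) + 16) * (2 * sqrt (2 * rho)).
Proof.
  intros HL Hrho h Hn HJ Hhr.
  assert (Pn : 0 < INR n) by (apply lt_0_INR; exact Hn).
  assert (Hh : 0 < h) by (unfold h; apply Rdiv_lt_0_compat; lra).
  assert (Enh : INR n * h = 2 * R0) by (unfold h; field; lra).
  destruct (choice_function _ (fun zeta => cauchy_kernel_near K R0 HK HR0 Hclosed Hconn zeta h Hint Hh))
    as [G HG].
  set (node := fun m j : nat => (- R0 + INR m * h + h / 2, - L + INR j * h + h / 2) : C).
  set (col := fun (m : nat) (z : C) => csum (fun j => (RtoC (h * h) * G (node m j) z)%C) J).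
  exists (fun z => csum (fun m => col m z) n). split.
  { apply approx_csum. intros m. apply (approx_csum K (fun j z => (RtoC (h * h) * G (node m j) z)%C)).
    intros j. apply (approx_mult K R0 HK (fun _ => RtoC (h * h))); [apply approx_const | apply HG]. }
  intros z Kz.
  assert (Hx := fst_le_Cmod z). assert (Hy := snd_le_Cmod z). assert (Hz := HK z Kz).
  destruct z as [x y]. simpl in Hx, Hy.
  change (fst (x, y)) with x.
  assert (Hx' : - R0 <= x <= R0).
  { assert (T1 := Rle_abs x). assert (T2 := Rle_abs (- x)). rewrite Rabs_Ropp in T2. lra. }
  set (s := fun m : nat => x + R0 - INR m * h).
  assert (Ss : forall m, s (S m) = s m - h) by (intros m; unfold s; rewrite S_INR; ring).
  (* In the limit of a tall box a column left of z integrates to pi h and one right of z to - pi h.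
     Both are decrements of pi |s|, so the main term telescopes to pi (x + R0) - pi (R0 - x). *)
  set (tau := fun m : nat => PI * Rabs (s m)).
  set (oc := fun m : nat => osqrt (clip (2 * rho) (s m))).
  set (alpha := 64 * L * h / (rho * rho) + 16 * R0 / L).
  set (beta := 12800 * sqrt (2 * L) + 16).
  assert (Pi4 : 0 < PI <= 4) by (split; [apply PI_RGT_0 | apply PI_4]).
  assert (Pb : 0 <= sqrt (2 * L)) by apply sqrt_pos.
  assert (Ebd : forall m, (m < n)%nat ->
    Cmod (col m (x, y) - (RtoC (tau m) - RtoC (tau (S m)))) <= h * alpha + beta * (oc m - oc (S m))).
  { intros m Hm. unfold col.
    assert (Sub : forall j, ((x, y) - node m j)%C =
      (s m - h / 2, y + L - INR j * h - h / 2)).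
    { intros j. unfold node, s, Cminus, Cplus, Copp. simpl. f_equal; ring. }
    set (X := s m - h / 2) in *.
    assert (Hm' : INR m + 1 <= INR n) by (rewrite <- S_INR; apply le_INR; lia).
    assert (Pm := pos_INR m).
    assert (Xb : Rabs X <= 2 * R0).
    { unfold X, s. apply Rabs_le. assert (INR m * h <= 2 * R0 - h) by nra.
      assert (0 <= INR m * h) by nra. lra. }
    assert (Po : 0 <= oc m - oc (S m)).
    { unfold oc. rewrite Ss. assert (T := osqrt_incr _ _ (clip_incr (2 * rho) (s m - h) (s m) ltac:(lra))). lra. }
    assert (Pa : 0 <= alpha).
    { unfold alpha, Rdiv. assert (0 < / (rho * rho)) by (apply Rinv_0_lt_compat; nra).
      assert (0 < / L) by (apply Rinv_0_lt_compat; lra).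
      apply Rplus_le_le_0_compat; apply Rmult_le_pos; nra. }
    destruct (Rle_lt_dec rho (Rabs X)) as [Far|Near].
    - assert (E : tau m - tau (S m) = h * (rsign X * PI)).
      { unfold tau. rewrite Ss. unfold rsign. destruct (Rle_dec 0 X) as [A|A].
        - rewrite Rabs_pos_eq in Far by exact A. unfold X in Far.
          rewrite !Rabs_pos_eq by lra. ring.
        - rewrite Rabs_left in Far by lra. unfold X in Far.
          rewrite !Rabs_left by lra. ring. }
      rewrite <- RtoC_minus, E.
      assert (C1 := column_far X y R0 L h rho J (fun j => G (node m j) (x, y)) HR0 Hh
        ltac:(lra) Far Xb ltac:(lra) HL HJ).
      assert (0 <= beta * (oc m - oc (S m))) by (apply Rmult_le_pos; unfold beta; lra).
      enough (Cmod (csum (fun j => (RtoC (h * h) * G (node m j) (x, y))%C) J - RtoC (h * (rsign X * PI)))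
         <= h * alpha) by lra.
      apply C1. intros j. destruct (HG (node m j)) as [_ [_ G3]].
      rewrite <- Sub. apply G3; [exact Kz | exact Hhr |].
      rewrite Sub. eapply Rle_trans; [exact Far | apply (fst_le_Cmod (X, _))].
    - assert (Hs : - rho - h / 2 <= s m - h /\ s m <= rho + h / 2).
      { assert (T1 := Rle_abs X). assert (T2 := Rle_abs (- X)). rewrite Rabs_Ropp in T2.
        unfold X in *. lra. }
      assert (Eo : oc m - oc (S m) = osqrt (s m) - osqrt (s m - h)).
      { unfold oc. rewrite Ss, !clip_id by lra. reflexivity. }
      assert (C1 := column_near X (s m) y R0 L h J (fun j => G (node m j) (x, y)) HR0 Hh
        ltac:(lra) HL HJ eq_refl).
      assert (C2 : Cmod (csum (fun j => (RtoC (h * h) * G (node m j) (x, y))%C) J)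
         <= 12800 * sqrt (2 * L) * (osqrt (s m) - osqrt (s m - h))).
      { apply C1. intros j. destruct (HG (node m j)) as [_ [G2 _]]. rewrite <- Sub. apply G2, Kz. }
      (* Near z the main term is bounded as well: it is at most pi h <= 4h, and h is at most four
         increments of [osqrt] because the midpoint is within distance 1. This gives the 16 in
         [beta] and uses rho <= 1. *)
      assert (I := osqrt_increment (s m) h Hh).
      assert (Q : sqrt (Rmax h (Rabs (s m - h / 2))) <= 1).
      { rewrite <- sqrt_1. apply sqrt_le_1_alt. apply Rmax_lub; fold X; lra. }
      assert (Q0 := sqrt_pos (Rmax h (Rabs (s m - h / 2)))).
      rewrite Eo in Po. rewrite Eo.
      assert (I' : h <= 4 * (osqrt (s m) - osqrt (s m - h))) by nra.
      assert (T : Rabs (tau m - tau (S m)) <= PI * h).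
      { unfold tau. rewrite Ss, <- Rmult_minus_distr_l, Rabs_mult, (Rabs_pos_eq PI) by lra.
        apply Rmult_le_compat_l; [lra|].
        eapply Rle_trans; [apply Rabs_triang_inv2|].
        replace (s m - (s m - h)) with h by ring. rewrite Rabs_pos_eq; lra. }
      eapply Rle_trans; [apply Cmod_triangle_sub|].
      rewrite <- RtoC_minus, Cmod_R.
      assert (0 <= h * alpha) by nra. unfold beta.
      assert (PI * h <= 16 * (osqrt (s m) - osqrt (s m - h))) by nra.
      lra. }
  assert (Ts : csum (fun m => (RtoC (tau m) - RtoC (tau (S m)))%C) n = RtoC (2 * PI * x)).
  { rewrite (csum_telescope (fun m => RtoC (tau m))), <- RtoC_minus. f_equal.
    unfold tau, s. rewrite Enh. simpl INR. rewrite Rmult_0_l.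
    rewrite Rabs_pos_eq, Rabs_left1 by lra. ring. }
  rewrite <- Ts.
  eapply Rle_trans; [apply csum_dist_le|].
  eapply Rle_trans; [apply (rsum_le _ _ n Ebd)|].
  rewrite rsum_affine, rsum_telescope.
  replace (INR n * (h * alpha)) with (2 * R0 * alpha) by (rewrite <- Enh; ring).
  apply Rplus_le_compat_l. apply Rmult_le_compat_l; [unfold beta; lra|].
  apply osqrt_clip_range. lra.
Qed.

Lemma nat_above (r : R) : exists n, (0 < n)%nat /\ r <= INR n.
Proof.
  destruct (INR_unbounded r) as [n Hn]. exists (S n). split; [lia|]. rewrite S_INR. lra.
Qed.

(** conj z = 2 Re z - z. The parameters are fixed in the order L, rho, h: the factor of sqrt rho
    depends on L, and the error 64 L h / rho^2 depends on both. *)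
Lemma approx_conj : approx K Cconj.
Proof.
  apply (approx_ext K (fun z => (RtoC (/ PI) * RtoC (2 * PI * fst z) + RtoC (-1) * z)%C)).
  { intros [x y] _. assert (P := PI_RGT_0). unfold Cconj, Cplus, Cmult. simpl. f_equal; field; lra. }
  apply approx_plus.
  2:{ apply (approx_mult K R0 HK (fun _ => RtoC (-1))); [apply approx_const | apply approx_id]. }
  apply (approx_mult K R0 HK (fun _ => RtoC (/ PI))); [apply approx_const|].
  intros eps He.
  enough (exists F, approx K F /\ forall z, K z -> Cmod (F z - RtoC (2 * PI * fst z)) <= eps / 2)
    as [F [HF HF2]].
  { destruct (HF (eps / 2)) as [p Hp]; [lra|]. exists p. intros z Kz.
    specialize (Hp z Kz). specialize (HF2 z Kz). rewrite Cmod_sub_sym in HF2.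
    assert (T := Cmod_sub_triangle (RtoC (2 * PI * fst z)) (F z) (peval p z)). lra. }
  set (e := eps / 6).
  destruct (nat_above (Rmax 2 (32 * R0 / e))) as [k [Hk Hk2]].
  assert (Pe : 0 < e) by (unfold e; lra).
  assert (K2 : 2 <= INR k) by (eapply Rle_trans; [apply Rmax_l | exact Hk2]).
  assert (K3 : 32 * R0 / e <= INR k) by (eapply Rle_trans; [apply Rmax_r | exact Hk2]).
  set (L := INR k * R0).
  assert (HL : 2 * R0 <= L) by (unfold L; nra).
  set (b := 12800 * sqrt (2 * L) + 16).
  assert (Pb : 16 <= b) by (unfold b; assert (T := sqrt_pos (2 * L)); lra).
  set (q := e / (2 * b)).
  assert (Pq : 0 < q) by (apply Rdiv_lt_0_compat; lra).
  set (rho := Rmin 1 (q * q / 2)).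
  assert (Hrho : 0 < rho <= 1) by (split; [apply Rmin_pos; nra | apply Rmin_l]).
  assert (Hs : sqrt (2 * rho) <= q).
  { rewrite <- (sqrt_Rsqr q) by lra. apply sqrt_le_1_alt. unfold Rsqr.
    assert (T : rho <= q * q / 2) by apply Rmin_r. lra. }
  destruct (nat_above (Rmax (20 * R0 / rho) (256 * R0 * R0 * L / (rho * rho * e)))) as [n [Hn Hn2]].
  assert (Pn : 0 < INR n) by (apply lt_0_INR; exact Hn).
  assert (N1 : 20 * R0 / rho <= INR n) by (eapply Rle_trans; [apply Rmax_l | exact Hn2]).
  assert (N2 : 256 * R0 * R0 * L / (rho * rho * e) <= INR n) by (eapply Rle_trans; [apply Rmax_r | exact Hn2]).
  set (h := 2 * R0 / INR n).
  (* L is the integer multiple k R0, so that k n squares of side 2 R0 / n fill the height 2L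
     exactly. *)
  destruct (grid_sum L rho n (k * n) HL Hrho Hn) as [F [HF HF2]].
  - rewrite mult_INR. unfold L. field. lra.
  - apply Rmult_le_reg_r with (INR n / rho); [apply Rdiv_lt_0_compat; lra|].
    replace (10 * (2 * R0 / INR n) * (INR n / rho)) with (20 * R0 / rho) by (field; lra).
    replace (rho * (INR n / rho)) with (INR n) by (field; lra). exact N1.
  - exists F. split; [exact HF|]. intros z Kz. eapply Rle_trans; [apply (HF2 z Kz)|].
    fold h b.
    assert (A1 : 2 * R0 * (16 * R0 / L) <= e).
    { unfold L. replace (2 * R0 * (16 * R0 / (INR k * R0))) with (32 * R0 / e * (e / INR k)) by (field; lra).
      replace e with (INR k * (e / INR k)) at 3 by (field; lra).
      apply Rmult_le_compat_r; [|exact K3]. left. apply Rdiv_lt_0_compat; lra. }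
    assert (A2 : 2 * R0 * (64 * L * h / (rho * rho)) <= e).
    { unfold h. replace (2 * R0 * (64 * L * (2 * R0 / INR n) / (rho * rho)))
        with (256 * R0 * R0 * L / (rho * rho * e) * (e / INR n)) by (field; lra).
      replace e with (INR n * (e / INR n)) at 3 by (field; lra).
      apply Rmult_le_compat_r; [|exact N2]. left. apply Rdiv_lt_0_compat; lra. }
    assert (A3 : b * (2 * sqrt (2 * rho)) <= e).
    { replace e with (b * (2 * q)) by (unfold q; field; lra).
      apply Rmult_le_compat_l; lra. }
    unfold e in *. lra.
Qed.

End Lavrentieff.

(** * Inner product spaces *)

Notation "x [+] y" := (vadd _ x y) (at level 50, left associativity).
Notation "x [-] y" := (vsub x y) (at level 50, left associativity).
Notation "a [*] x" := (vscal _ a x) (at level 40, left associativity).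

Section Hilbert.
Context {H : InnerProductSpace}.
Implicit Types (x y z : H) (T S : H -> H).

(** The inner product with values in [C], so that [ring] and the rules for complex numbers apply to
    it. *)
Definition ip x y : C := inner H x y.

Lemma ip_add_l x y z : ip (x [+] y) z = (ip x z + ip y z)%C.
Proof. exact (inner_add_l H x y z). Qed.

Lemma ip_scal_l (a : C) x y : ip (a [*] x) y = (a * ip x y)%C.
Proof. exact (inner_scal_l H a x y). Qed.

Lemma ip_conj x y : ip y x = Cconj (ip x y).
Proof. exact (inner_conj_sym H x y). Qed.

Lemma ip_add_r x y z : ip z (x [+] y) = (ip z x + ip z y)%C.
Proof.
  rewrite ip_conj, ip_add_l, Cplus_conj, <- !ip_conj. reflexivity.
Qed.

Lemma ip_scal_r (a : C) x y : ip y (a [*] x) = (Cconj a * ip y x)%C.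
Proof. rewrite ip_conj, ip_scal_l, Cmult_conj, <- ip_conj. reflexivity. Qed.

Lemma ip_zero_l x : ip (vzero H) x = RtoC 0.
Proof.
  assert (E : (ip (vzero H) x + ip (vzero H) x = ip (vzero H) x)%C).
  { rewrite <- ip_add_l, vadd_zero. reflexivity. }
  replace (ip (vzero H) x) with (ip (vzero H) x + ip (vzero H) x - ip (vzero H) x)%C at 1 by ring.
  rewrite E. ring.
Qed.

Lemma ip_zero_r x : ip x (vzero H) = RtoC 0.
Proof. rewrite ip_conj, ip_zero_l. apply Cconj_RtoC. Qed.

Lemma ip_opp_l x y : ip (vopp H x) y = (- ip x y)%C.
Proof.
  assert (E : (ip x y + ip (vopp H x) y = 0)%C).
  { rewrite <- ip_add_l, vadd_opp. apply ip_zero_l. }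
  replace (ip (vopp H x) y) with (ip x y + ip (vopp H x) y - ip x y)%C by ring.
  rewrite E. ring.
Qed.

Lemma ip_sub_l x y z : ip (x [-] y) z = (ip x z - ip y z)%C.
Proof. unfold vsub. rewrite ip_add_l, ip_opp_l. reflexivity. Qed.

Lemma ip_sub_r x y z : ip z (x [-] y) = (ip z x - ip z y)%C.
Proof. rewrite ip_conj, ip_sub_l, Cminus_conj, <- !ip_conj. reflexivity. Qed.

Lemma vext x y : (forall z, ip x z = ip y z) -> x = y.
Proof.
  intros E.
  assert (D : x [-] y = vzero H).
  { apply inner_definite. change (ip (x [-] y) (x [-] y) = RtoC 0).
    rewrite ip_sub_l, E. ring. }
  rewrite <- (vadd_zero H y), <- D. unfold vsub.
  rewrite (vadd_comm H x), vadd_assoc, vadd_opp, vadd_comm, vadd_zero. reflexivity.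
Qed.

End Hilbert.

Create HintDb ip.
#[export] Hint Rewrite @ip_add_l @ip_add_r @ip_scal_l @ip_scal_r @ip_sub_l @ip_sub_r
  @ip_zero_l @ip_zero_r @ip_opp_l : ip.

(** Pairing with an arbitrary vector turns a vector identity into a ring identity between complex
    numbers. *)
Ltac vring := apply vext; intros; autorewrite with ip; ring.

(** * Norms, adjoints and polynomials of an operator *)

Section Norm.
Context {H : InnerProductSpace}.
Implicit Types (x y z : H) (T S : H -> H).

Definition nsq x : R := fst (ip x x).

Lemma snd_ip_self x : snd (ip x x) = 0.
Proof. assert (E := f_equal snd (ip_conj x x)). simpl in E. lra. Qed.

Lemma ip_self x : ip x x = RtoC (nsq x).
Proof. unfold nsq. apply injective_projections; [reflexivity | apply snd_ip_self]. Qed.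

Lemma nsq_pos x : 0 <= nsq x.
Proof. exact (inner_pos H x). Qed.

Lemma vnorm_sq x : vnorm x * vnorm x = nsq x.
Proof. apply sqrt_sqrt, nsq_pos. Qed.

Lemma vnorm_pos x : 0 <= vnorm x.
Proof. apply sqrt_pos. Qed.

Lemma nsq_eq_0 x : nsq x = 0 -> x = vzero H.
Proof. intros E. apply inner_definite. change (ip x x = RtoC 0). rewrite ip_self, E. reflexivity. Qed.

Lemma vnorm_eq_0 x : vnorm x = 0 -> x = vzero H.
Proof. intros E. apply nsq_eq_0. rewrite <- vnorm_sq, E. ring. Qed.

Lemma vnorm_zero : vnorm (vzero H) = 0.
Proof.
  assert (E : nsq (vzero H) = 0) by (unfold nsq; rewrite ip_zero_l; reflexivity).
  unfold vnorm. change (sqrt (nsq (vzero H)) = 0). rewrite E. apply sqrt_0.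
Qed.

Lemma vnorm_le_sq x (b : R) : 0 <= b -> nsq x <= b * b -> vnorm x <= b.
Proof. intros Hb E. apply Rsqr_incr_0_var; [|exact Hb]. unfold Rsqr. rewrite vnorm_sq. exact E. Qed.

Lemma vnorm_eq_sq x y : nsq x = nsq y -> vnorm x = vnorm y.
Proof. intros E. change (sqrt (nsq x) = sqrt (nsq y)). rewrite E. reflexivity. Qed.

Lemma nsq_add x y : nsq (x [+] y) = nsq x + 2 * fst (ip x y) + nsq y.
Proof.
  unfold nsq. autorewrite with ip. rewrite (ip_conj x y). simpl. ring.
Qed.

Lemma nsq_sub x y : nsq (x [-] y) = nsq x - 2 * fst (ip x y) + nsq y.
Proof.
  unfold nsq. autorewrite with ip. rewrite (ip_conj x y). simpl. ring.
Qed.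

Lemma nsq_scal (a : C) x : nsq (a [*] x) = Cmod a * Cmod a * nsq x.
Proof.
  unfold nsq. autorewrite with ip. rewrite ip_self, Cmod_sq. simpl. ring.
Qed.

Lemma vnorm_scal (a : C) x : vnorm (a [*] x) = Cmod a * vnorm x.
Proof.
  apply Rsqr_inj; [apply vnorm_pos | apply Rmult_le_pos; [apply Cmod_ge_0 | apply vnorm_pos] |].
  unfold Rsqr. rewrite vnorm_sq, nsq_scal, <- vnorm_sq. ring.
Qed.

Lemma cauchy_schwarz_re x y : fst (ip x y) <= vnorm x * vnorm y.
Proof.
  assert (Px := vnorm_pos x). assert (Py := vnorm_pos y).
  destruct (Req_dec (vnorm x) 0) as [Ex|Ex].
  { rewrite (vnorm_eq_0 x Ex), ip_zero_l. simpl. rewrite vnorm_zero. lra. }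
  destruct (Req_dec (vnorm y) 0) as [Ey|Ey].
  { rewrite (vnorm_eq_0 y Ey), ip_zero_r. simpl. rewrite vnorm_zero. lra. }
  assert (E := nsq_pos (RtoC (vnorm y) [*] x [-] RtoC (vnorm x) [*] y)).
  rewrite nsq_sub, !nsq_scal, !Cmod_R, !Rabs_pos_eq, <- !vnorm_sq in E by assumption.
  rewrite ip_scal_l, ip_scal_r in E. simpl in E.
  set (a := vnorm x) in *. set (b := vnorm y) in *.
  assert (0 < a * b) by (apply Rmult_lt_0_compat; lra).
  apply Rmult_le_reg_l with (a * b); [assumption|]. nra.
Qed.

Lemma cauchy_schwarz x y : Cmod (ip x y) <= vnorm x * vnorm y.
Proof.
  set (c := ip x y).
  assert (E := cauchy_schwarz_re (Cconj c [*] x) y).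
  rewrite ip_scal_l in E. fold c in E.
  replace (fst (Cconj c * c)%C) with (Cmod c * Cmod c) in E by (rewrite Cmod_sq; simpl; ring).
  rewrite vnorm_scal, Cmod_conj in E.
  assert (P := Cmod_ge_0 c).
  assert (Q : 0 <= vnorm x * vnorm y) by (apply Rmult_le_pos; apply vnorm_pos).
  nra.
Qed.

Lemma vnorm_triangle x y : vnorm (x [+] y) <= vnorm x + vnorm y.
Proof.
  assert (Px := vnorm_pos x). assert (Py := vnorm_pos y).
  apply vnorm_le_sq; [lra|]. rewrite nsq_add, <- !vnorm_sq.
  assert (T := cauchy_schwarz_re x y). nra.
Qed.

Lemma vnorm_opp x : vnorm (vopp H x) = vnorm x.
Proof.
  replace (vopp H x) with (RtoC (-1) [*] x) by vring.
  rewrite vnorm_scal, Cmod_R, Rabs_left by lra. ring.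
Qed.

Lemma vnorm_sub_sym x y : vnorm (x [-] y) = vnorm (y [-] x).
Proof. rewrite <- vnorm_opp. f_equal. vring. Qed.

Lemma vnorm_sub_triangle x y z : vnorm (x [-] z) <= vnorm (x [-] y) + vnorm (y [-] z).
Proof. replace (x [-] z) with ((x [-] y) [+] (y [-] z)) by vring. apply vnorm_triangle. Qed.

Lemma vnorm_triangle_sub x y : vnorm (x [-] y) <= vnorm x + vnorm y.
Proof. unfold vsub. rewrite <- (vnorm_opp y). apply vnorm_triangle. Qed.

Lemma vnorm_triangle_inv x y : vnorm x - vnorm y <= vnorm (x [-] y).
Proof.
  assert (T := vnorm_triangle (x [-] y) y).
  replace (x [-] y [+] y) with x in T by vring. lra.
Qed.

Lemma vsub_zero x y : x [-] y = vzero H -> x = y.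
Proof.
  intros E. replace x with (x [-] y [+] y) by vring. rewrite E. vring.
Qed.

Lemma vnorm_small_eq x y : (forall eps, 0 < eps -> vnorm (x [-] y) <= eps) -> x = y.
Proof.
  intros E. apply vsub_zero, vnorm_eq_0. assert (P := vnorm_pos (x [-] y)).
  destruct (Rle_lt_or_eq_dec _ _ P) as [L|L]; [|auto].
  specialize (E (vnorm (x [-] y) / 2)). lra.
Qed.

(** Operators are compared through all their upper bounds; [is_opnorm_iff] turns equality of these
    into equality of norms. *)
Definition opbound T (c : R) : Prop := forall x, vnorm (T x) <= c * vnorm x.

Lemma opbound_weaken T c c' : c <= c' -> opbound T c -> opbound T c'.
Proof.
  intros Hc HT x. specialize (HT x). assert (P := vnorm_pos x). nra.
Qed.

Lemma bounded_opbound T : bounded_op T -> exists c, 1 <= c /\ opbound T c.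
Proof.
  intros [_ [M HM]]. exists (Rmax 1 M). split; [apply Rmax_l|].
  apply (opbound_weaken T M); [apply Rmax_r | exact HM].
Qed.

Lemma lin_add T : linear_op T -> forall x y, T (x [+] y) = T x [+] T y.
Proof. intros [E _]. exact E. Qed.

Lemma lin_scal T : linear_op T -> forall (a : C) x, T (a [*] x) = a [*] T x.
Proof. intros [_ E]. exact E. Qed.

Lemma lin_zero T : linear_op T -> T (vzero H) = vzero H.
Proof.
  intros HT. replace (vzero H) with (RtoC 0 [*] vzero H) by vring.
  rewrite (lin_scal T HT). vring.
Qed.

Lemma lin_sub T : linear_op T -> forall x y, T (x [-] y) = T x [-] T y.
Proof.
  intros HT x y. replace (x [-] y) with (x [+] RtoC (-1) [*] y) by vring.
  rewrite (lin_add T HT), (lin_scal T HT). vring.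
Qed.

Lemma adjoint_ip T S : is_adjoint T S -> forall x y, ip (T x) y = ip x (S y).
Proof. intros E. exact E. Qed.

Lemma adjoint_sym T S : is_adjoint T S -> is_adjoint S T.
Proof.
  intros E x y. change (ip (S x) y = ip x (T y)).
  rewrite ip_conj, <- (adjoint_ip T S E), <- ip_conj. reflexivity.
Qed.

Lemma adjoint_linear T S : is_adjoint T S -> linear_op T.
Proof.
  intros E. split.
  - intros x y. apply vext. intros z.
    rewrite (adjoint_ip T S E), !ip_add_l, !(adjoint_ip T S E). reflexivity.
  - intros a x. apply vext. intros z.
    rewrite (adjoint_ip T S E), !ip_scal_l, !(adjoint_ip T S E). reflexivity.
Qed.

Lemma adjoint_opbound T S c : 0 <= c -> is_adjoint T S -> opbound T c -> opbound S c.
Proof.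
  intros Hc E HT x.
  assert (Q := cauchy_schwarz_re (T (S x)) x).
  rewrite (adjoint_ip T S E) in Q. change (nsq (S x) <= vnorm (T (S x)) * vnorm x) in Q.
  rewrite <- vnorm_sq in Q. specialize (HT (S x)).
  assert (P := vnorm_pos x). assert (P' := vnorm_pos (S x)).
  destruct (Rle_lt_or_eq_dec _ _ P') as [L|L]; [|rewrite <- L; nra].
  apply Rmult_le_reg_l with (vnorm (S x)); [exact L|].
  apply Rle_trans with (vnorm (T (S x)) * vnorm x); [exact Q|]. nra.
Qed.

Lemma normal_norm T S : is_adjoint T S -> (forall x, T (S x) = S (T x)) ->
  forall x, vnorm (S x) = vnorm (T x).
Proof.
  intros E C x. apply vnorm_eq_sq. unfold nsq.
  rewrite (adjoint_ip T S E x), <- C, <- (adjoint_ip S T (adjoint_sym _ _ E)). reflexivity.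
Qed.

Lemma poly_op_add T p q x : linear_op T ->
  poly_op (padd p q) T x = poly_op p T x [+] poly_op q T x.
Proof.
  intros HT. revert q. induction p as [|a p IH]; intros [|b q]; simpl; try vring.
  rewrite IH, (lin_add T HT). vring.
Qed.

Lemma poly_op_scal T c p x : linear_op T -> poly_op (pscal c p) T x = c [*] poly_op p T x.
Proof.
  intros HT. induction p as [|a p IH]; simpl; [vring|].
  change (map (fun a => (c * a)%C) p) with (pscal c p).
  rewrite IH, (lin_scal T HT). vring.
Qed.

Lemma poly_op_linear T p : linear_op T -> linear_op (poly_op p T).
Proof.
  intros HT. induction p as [|a p IH]; split; intros; simpl; try vring.
  - rewrite (lin_add _ IH), (lin_add T HT). vring.
  - rewrite (lin_scal _ IH), (lin_scal T HT). vring.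
Qed.

Lemma poly_op_opbound T p c : 0 <= c -> opbound T c -> exists b, 0 <= b /\ opbound (poly_op p T) b.
Proof.
  intros Hc HT. induction p as [|a p [b [Hb IH]]].
  - exists 0. split; [lra|]. intros x. simpl. rewrite vnorm_zero. lra.
  - exists (Cmod a + c * b). assert (Pa := Cmod_ge_0 a). split; [nra|].
    intros x. simpl. eapply Rle_trans; [apply vnorm_triangle|]. rewrite vnorm_scal.
    specialize (IH x). specialize (HT (poly_op p T x)). assert (P := vnorm_pos x). nra.
Qed.

Lemma poly_op_commute T B p x : linear_op B -> (forall y, B (T y) = T (B y)) ->
  B (poly_op p T x) = poly_op p T (B x).
Proof.
  intros HB HC. induction p as [|a p IH]; simpl; [apply lin_zero, HB|].
  rewrite (lin_add B HB), (lin_scal B HB), HC, IH. reflexivity.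
Qed.

Lemma poly_op_adjoint T S p : is_adjoint T S ->
  is_adjoint (poly_op p T) (poly_op (map Cconj p) S).
Proof.
  intros E x y. change (ip (poly_op p T x) y = ip x (poly_op (map Cconj p) S y)).
  assert (LS := adjoint_linear S T (adjoint_sym _ _ E)).
  revert x y. induction p as [|a p IH]; intros x y; simpl.
  - rewrite ip_zero_l, ip_zero_r. reflexivity.
  - rewrite ip_add_l, ip_add_r, ip_scal_l, ip_scal_r, Cconj_conj, (adjoint_ip T S E), IH.
    rewrite (poly_op_commute S S) by (auto). reflexivity.
Qed.

End Norm.

(** * Fixed points and surjectivity in a complete space *)

Section Complete.
Context {H : InnerProductSpace} (Hc : complete_space H).
Implicit Types (x y z : H) (T S : H -> H).

Lemma contraction_fixed_point (F : H -> H) q : 0 <= q < 1 ->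
  (forall x y, vnorm (F x [-] F y) <= q * vnorm (x [-] y)) -> exists x, F x = x.
Proof.
  intros Hq HF.
  set (u := fun n => Nat.iter n F (vzero H)).
  set (d := vnorm (u 1%nat [-] u O)).
  assert (Pd : 0 <= d) by apply vnorm_pos.
  assert (Step : forall n, vnorm (u (S n) [-] u n) <= q ^ n * d).
  { induction n as [|n IH]; [simpl; unfold d; simpl; lra|].
    change (vnorm (F (u (S n)) [-] F (u n)) <= q ^ S n * d).
    eapply Rle_trans; [apply HF|].
    rewrite <- tech_pow_Rmult, Rmult_assoc. apply Rmult_le_compat_l; [lra | exact IH]. }
  assert (Pq : forall n, 0 <= q ^ n) by (intros; apply pow_le; lra).
  assert (Tail : forall k n, (1 - q) * vnorm (u (n + k)%nat [-] u n) <= (q ^ n - q ^ (n + k)) * d).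
  { induction k as [|k IH]; intros n.
    - rewrite Nat.add_0_r. replace (u n [-] u n) with (vzero H) by vring. rewrite vnorm_zero. lra.
    - rewrite Nat.add_succ_r.
      assert (T := vnorm_sub_triangle (u (S (n + k))) (u (n + k)%nat) (u n)).
      specialize (IH n). specialize (Step (n + k)%nat). simpl pow.
      assert (0 <= 1 - q) by lra.
      apply Rle_trans with ((1 - q) * (vnorm (u (S (n + k)) [-] u (n + k)%nat) + vnorm (u (n + k)%nat [-] u n)));
        [apply Rmult_le_compat_l; assumption|]. nra. }
  assert (Small : forall eps, 0 < eps -> exists N, forall n, (N <= n)%nat -> q ^ n * d < eps).
  { intros eps He. destruct (pow_lt_1_zero q) with (y := eps / (d + 1)) as [N HN].
    - rewrite Rabs_pos_eq; lra.
    - apply Rdiv_lt_0_compat; lra.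
    - exists N. intros n Hn. specialize (HN n Hn). rewrite Rabs_pos_eq in HN by apply Pq.
      apply Rmult_lt_compat_r with (r := d + 1) in HN; [|lra].
      replace (eps / (d + 1) * (d + 1)) with eps in HN by (field; lra).
      specialize (Pq n). nra. }
  assert (Pair : forall n m, (n <= m)%nat -> (1 - q) * vnorm (u m [-] u n) <= q ^ n * d).
  { intros n m Hnm. replace m with (n + (m - n))%nat by lia.
    eapply Rle_trans; [apply Tail|]. specialize (Pq (n + (m - n))%nat). nra. }
  destruct (Hc u) as [l Hl].
  { intros eps He. destruct (Small ((1 - q) * eps)) as [N HN]; [nra|]. exists N.
    assert (G : forall n m, (N <= n)%nat -> (n <= m)%nat -> vnorm (u m [-] u n) < eps).
    { intros n m Hn Hm. specialize (Pair n m Hm). specialize (HN n Hn).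
      apply Rmult_lt_reg_l with (1 - q); lra. }
    intros n m Hn Hm. destruct (Nat.le_ge_cases n m) as [L|L].
    - rewrite vnorm_sub_sym. apply G; assumption.
    - apply G; assumption. }
  exists l. apply vnorm_small_eq. intros eps He.
  destruct (Hl (eps / 2)) as [N HN]; [lra|].
  assert (A := HN N (Nat.le_refl N)). assert (B := HN (S N) ltac:(lia)).
  assert (T := vnorm_sub_triangle (F l) (F (u N)) l). specialize (HF l (u N)).
  rewrite (vnorm_sub_sym l) in HF.
  change (F (u N)) with (u (S N)) in *.
  assert (P := vnorm_pos (u N [-] l)). nra.
Qed.

(* Solve T* T x = y by iterating x - (T* T x - y) / c^2, a contraction when T is bounded below. *)
Lemma normal_bounded_below_onto T S c d : 0 < c -> 0 < d ->
  is_adjoint T S -> (forall x, T (S x) = S (T x)) ->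
  opbound T c -> (forall x, d * vnorm x <= vnorm (T x)) -> forall y, exists x, T x = y.
Proof.
  intros Pc Pd E C Tc Td y.
  assert (LT := adjoint_linear T S E). assert (LS := adjoint_linear S T (adjoint_sym _ _ E)).
  assert (NS := normal_norm T S E C).
  assert (Sc := adjoint_opbound T S c ltac:(lra) E Tc).
  set (k := RtoC (/ (c * c))).
  (* Expanding |w - k T'T w|^2 with k = 1/c^2 leaves at most |w|^2 - k |T w|^2 <= (1 - d^2/c^2)
     |w|^2. The minimum keeps the factor nonnegative when d > c. *)
  set (q2 := 1 - Rmin (c * c) (d * d) * / (c * c)).
  assert (Pcc : 0 < / (c * c)) by (apply Rinv_0_lt_compat; nra).
  assert (Pm : 0 < Rmin (c * c) (d * d)) by (apply Rmin_pos; nra).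
  assert (Hm : Rmin (c * c) (d * d) <= d * d) by apply Rmin_r.
  assert (Hm' : Rmin (c * c) (d * d) * / (c * c) <= 1).
  { rewrite <- (Rinv_r (c * c)) by nra. apply Rmult_le_compat_r; [lra | apply Rmin_l]. }
  assert (Hq2 : 0 <= q2 < 1).
  { unfold q2. assert (0 < Rmin (c * c) (d * d) * / (c * c)) by (apply Rmult_lt_0_compat; lra). lra. }
  destruct (contraction_fixed_point (fun x => x [-] k [*] (S (T x) [-] S y)) (sqrt q2)) as [x Hx].
  - split; [apply sqrt_pos|]. rewrite <- sqrt_1. apply sqrt_lt_1_alt. exact Hq2.
  - intros x x'.
    replace (x [-] k [*] (S (T x) [-] S y) [-] (x' [-] k [*] (S (T x') [-] S y)))
      with ((x [-] x') [-] k [*] S (T (x [-] x')))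
      by (rewrite (lin_sub T LT), (lin_sub S LS); vring).
    set (w := x [-] x').
    apply vnorm_le_sq; [apply Rmult_le_pos; [apply sqrt_pos | apply vnorm_pos]|].
    rewrite nsq_sub, nsq_scal, ip_scal_r, <- (adjoint_ip T S E).
    unfold k. rewrite Cmod_R, Rabs_pos_eq by lra. rewrite ip_self, <- !vnorm_sq, (NS (T w)).
    replace (sqrt q2 * vnorm w * (sqrt q2 * vnorm w)) with ((sqrt q2 * sqrt q2) * (vnorm w * vnorm w)) by ring.
    rewrite sqrt_sqrt by lra. simpl.
    assert (A := Tc (T w)). assert (B := Td w). assert (P0 := vnorm_pos (T w)).
    assert (P1 := vnorm_pos w). assert (P2 := vnorm_pos (T (T w))).
    assert (Q1 : vnorm (T (T w)) * vnorm (T (T w)) <= c * c * (vnorm (T w) * vnorm (T w))) by nra.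
    assert (Q2 : Rmin (c * c) (d * d) * (vnorm w * vnorm w) <= vnorm (T w) * vnorm (T w)).
    { apply Rle_trans with (d * d * (vnorm w * vnorm w)); [apply Rmult_le_compat_r; nra|].
      replace (d * d * (vnorm w * vnorm w)) with ((d * vnorm w) * (d * vnorm w)) by ring.
      apply Rmult_le_compat; nra. }
    unfold q2. set (m := Rmin (c * c) (d * d)) in *.
    set (t := vnorm (T w) * vnorm (T w)) in *. set (i := / (c * c)) in *.
    assert (Q3 : i * i * (vnorm (T (T w)) * vnorm (T (T w))) <= i * t).
    { apply Rle_trans with (i * i * (c * c * t)); [apply Rmult_le_compat_l; nra|].
      apply Req_le. replace (i * i * (c * c * t)) with (i * (i * (c * c)) * t) by ring.
      unfold i. rewrite Rinv_l by nra. ring. }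
    assert (Q4 : i * (m * (vnorm w * vnorm w)) <= i * t) by (apply Rmult_le_compat_l; lra).
    lra.
  - exists x.
    (* The fixed point only gives S (T x - y) = 0; by normality S is bounded below like T, hence
       injective. *)
    assert (E1 : S (T x [-] y) = vzero H).
    { rewrite (lin_sub S LS).
      assert (E0 : k [*] (S (T x) [-] S y) = vzero H).
      { replace (k [*] (S (T x) [-] S y)) with (x [-] (x [-] k [*] (S (T x) [-] S y))) by vring.
        rewrite Hx. vring. }
      replace (S (T x) [-] S y) with (RtoC (c * c) [*] (k [*] (S (T x) [-] S y))).
      - rewrite E0. vring.
      - assert (E2 : (RtoC (c * c) * k)%C = RtoC 1).
        { unfold k. rewrite <- RtoC_mult, Rinv_r by nra. reflexivity. }
        apply vext. intros z. rewrite !ip_scal_l, Cmult_assoc, E2. ring. }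
    apply vsub_zero, vnorm_eq_0.
    assert (B := Td (T x [-] y)). rewrite <- NS, E1, vnorm_zero in B.
    assert (P := vnorm_pos (T x [-] y)). nra.
Qed.

End Complete.

(** * Joint approximate eigenvectors *)

Section Localisation.
Context {H : InnerProductSpace}.
Implicit Types (x y z : H) (T S D : H -> H).

Definition approx_eigenvalue T (lam : C) : Prop :=
  forall delta, 0 < delta -> exists x, 0 < vnorm x /\ vnorm (T x [-] lam [*] x) <= delta * vnorm x.

(** A common approximate null vector; for shifts of commuting operators it stands in for a point of
    the joint spectrum. *)
Definition jointly_small (Ds : list (H -> H)) : Prop :=
  forall delta, 0 < delta -> exists x, 0 < vnorm x /\
    forall D, In D Ds -> vnorm (D x) <= delta * vnorm x.

Lemma coercive_lower S : (forall x, nsq x <= fst (ip (S x) x)) -> forall x, vnorm x <= vnorm (S x).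
Proof.
  intros HS x. assert (A := HS x). assert (B := cauchy_schwarz_re (S x) x).
  rewrite <- vnorm_sq in A. assert (P := vnorm_pos x). assert (P' := vnorm_pos (S x)).
  destruct (Rle_lt_or_eq_dec _ _ P) as [L|L]; [|lra].
  apply Rmult_le_reg_r with (vnorm x); [exact L | lra].
Qed.

(* Otherwise |S^(n+1) x| / |S^n x| would grow geometrically, against |S| <= c. *)
Lemma power_ratio_stalls S c eta : 0 < eta -> opbound S c -> (forall x, vnorm x <= vnorm (S x)) ->
  exists n0, forall x, 0 < vnorm x -> exists n, (n <= n0)%nat /\
    vnorm (Nat.iter (2 + n) S x) * vnorm (Nat.iter n S x) <=
      (1 + eta) * (vnorm (Nat.iter (1 + n) S x) * vnorm (Nat.iter (1 + n) S x)).
Proof.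
  intros He Sc Sl.
  (* The number of steps depends on c and eta alone, since the next lemma must know the loss c^n0
     before it picks the starting vector. *)
  destruct (Pow_x_infinity (1 + eta)) with (b := c + 1) as [n0 Hn0]; [rewrite Rabs_pos_eq; lra|].
  specialize (Hn0 n0 (Nat.le_refl n0)).
  assert (Pp : forall n, 0 < (1 + eta) ^ n) by (intros; apply pow_lt; lra).
  rewrite Rabs_pos_eq in Hn0 by (left; apply Pp).
  exists n0. intros x Hx. apply NNPP. intros Hn.
  set (a := fun n => vnorm (Nat.iter n S x)).
  assert (Pa : forall n, 0 < a n).
  { induction n as [|n IH]; [exact Hx|]. eapply Rlt_le_trans; [exact IH | apply Sl]. }
  assert (G : forall n, (n <= n0)%nat -> (1 + eta) ^ n * a n <= a (1 + n)%nat).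
  { induction n as [|n IH]; intros Hle.
    - simpl pow. rewrite Rmult_1_l. apply Sl.
    - specialize (IH ltac:(lia)).
      assert (F : (1 + eta) * (a (1 + n)%nat * a (1 + n)%nat) < a (2 + n)%nat * a n).
      { apply Rnot_le_lt. intros L. apply Hn. exists n. split; [lia | exact L]. }
      assert (A0 := Pa n). assert (A1 := Pa (1 + n)%nat).
      apply Rmult_le_reg_r with (a n); [exact A0|].
      change (1 + Datatypes.S n)%nat with (2 + n)%nat. change (Datatypes.S n) with (1 + n)%nat.
      simpl pow. simpl Nat.add in *.
      apply Rle_trans with ((1 + eta) * (a (Datatypes.S n) * a (Datatypes.S n))); [|lra].
      replace ((1 + eta) * (1 + eta) ^ n * a (Datatypes.S n) * a n)
        with ((1 + eta) * a (Datatypes.S n) * ((1 + eta) ^ n * a n)) by ring.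
      apply Rle_trans with ((1 + eta) * a (Datatypes.S n) * a (Datatypes.S n)); [|apply Req_le; ring].
      apply Rmult_le_compat_l; [nra | exact IH]. }
  specialize (G n0 (Nat.le_refl n0)).
  assert (B : a (1 + n0)%nat <= c * a n0) by apply Sc.
  assert (A0 := Pa n0). nra.
Qed.

(** Cauchy-Schwarz gives |S x|^2 <= |S^2 x| |x|, and near equality S^2 x is close to r^2 x with r =
    |S x| / |x|. Writing S^2 - r^2 = (S + r)(S - r) and cancelling S + r, which is bounded below by
    1, leaves S x close to r x. As the [D] commute with S, they stay small on S^n x0. *)
Lemma coercive_approx_eigenvalue S c Ds delta :
  is_adjoint S S -> 1 <= c -> opbound S c -> (forall x, nsq x <= fst (ip (S x) x)) ->
  (forall D, In D Ds -> forall x, D (S x) = S (D x)) -> jointly_small Ds -> 0 < delta ->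
  exists r x, 1 <= r <= c /\ 0 < vnorm x /\ vnorm (S x [-] RtoC r [*] x) <= delta * vnorm x /\
    forall D, In D Ds -> vnorm (D x) <= delta * vnorm x.
Proof.
  intros Sa Hc Sc Sco Com Js Hd.
  assert (Sl := coercive_lower S Sco).
  assert (LS := adjoint_linear S S Sa).
  (* Chosen so that (2 eta + eta^2) c^4 <= delta^2: the square of |S^2 x - r^2 x| is at most ((1 +
     eta)^2 - 1) r^4 |x|^2. *)
  set (eta := delta * delta / (3 * (c * c * (c * c)) + 3 * (delta * delta))).
  assert (Pcc : 1 <= c * c * (c * c)) by (assert (1 <= c * c) by nra; nra).
  assert (Pdd : 0 < delta * delta) by nra.
  assert (He : 0 < eta) by (apply Rdiv_lt_0_compat; lra).
  assert (Eeta : eta * (3 * (c * c * (c * c)) + 3 * (delta * delta)) = delta * delta) by (unfold eta; field; lra).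
  assert (He1 : eta <= 1) by nra.
  assert (He2 : (2 * eta + eta * eta) * (c * c * (c * c)) <= delta * delta) by nra.
  destruct (power_ratio_stalls S c eta He Sc Sl) as [n0 Hn0].
  assert (Pc0 : 0 < c ^ n0) by (apply pow_lt; lra).
  destruct (Js (delta / c ^ n0)) as [x0 [Px0 Dx0]]; [apply Rdiv_lt_0_compat; lra|].
  destruct (Hn0 x0 Px0) as [n [Hn Hr]].
  assert (Pc : forall n, 0 < c ^ n) by (intros; apply pow_lt; lra).
  set (x := Nat.iter n S x0) in *.
  assert (Grow : vnorm x0 <= vnorm x).
  { assert (G : forall k, vnorm x0 <= vnorm (Nat.iter k S x0)); [|apply G].
    induction k as [|k IH]; [simpl; lra|]. eapply Rle_trans; [exact IH | apply Sl]. }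
  assert (Px : 0 < vnorm x) by lra.
  assert (Px1 : vnorm x <= vnorm (S x)) by apply Sl.
  simpl in Hr. fold x in Hr.
  set (r := vnorm (S x) / vnorm x).
  assert (Er : vnorm (S x) = r * vnorm x) by (unfold r; field; lra).
  assert (R1 : 1 <= r) by (apply Rmult_le_reg_r with (vnorm x); lra).
  assert (R2 : r <= c) by (apply Rmult_le_reg_r with (vnorm x); [exact Px|]; rewrite <- Er; apply Sc).
  assert (Q2 : vnorm (S (S x)) <= (1 + eta) * (r * r) * vnorm x).
  { apply Rmult_le_reg_r with (vnorm x); [exact Px|]. rewrite Er in Hr. lra. }
  assert (Small : vnorm (S (S x) [-] RtoC (r * r) [*] x) <= delta * vnorm x).
  { apply vnorm_le_sq; [nra|].
    rewrite nsq_sub, nsq_scal, ip_scal_r, (adjoint_ip S S Sa), ip_self.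
    rewrite Cmod_R, Rabs_pos_eq by nra. simpl. rewrite <- !vnorm_sq, Er.
    assert (P2 := vnorm_pos (S (S x))).
    assert (Q3 : vnorm (S (S x)) * vnorm (S (S x)) <=
      ((1 + eta) * (r * r) * vnorm x) * ((1 + eta) * (r * r) * vnorm x))
      by (apply Rmult_le_compat; assumption).
    assert (Rr : r * r * (r * r) <= c * c * (c * c)).
    { assert (r * r <= c * c) by nra. nra. }
    assert (Q4 : (2 * eta + eta * eta) * (r * r * (r * r)) <= delta * delta).
    { eapply Rle_trans; [apply Rmult_le_compat_l; [nra | exact Rr] | exact He2]. }
    assert (Q5 := Rmult_le_compat_r (vnorm x * vnorm x) _ _ ltac:(nra) Q4).
    lra. }
  exists r, x. split; [lra|]. split; [exact Px|]. split.
  - eapply Rle_trans; [|exact Small].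
    set (z := S x [-] RtoC r [*] x).
    assert (Ez : S (S x) [-] RtoC (r * r) [*] x = S z [+] RtoC r [*] z).
    { unfold z. rewrite (lin_sub S LS), (lin_scal S LS). rewrite RtoC_mult. vring. }
    rewrite Ez.
    assert (A := cauchy_schwarz_re (S z [+] RtoC r [*] z) z).
    rewrite ip_add_l, ip_scal_l, ip_self in A. simpl in A.
    assert (B := Sco z). rewrite <- !vnorm_sq in *.
    assert (P := vnorm_pos z). assert (P' := vnorm_pos (S z [+] RtoC r [*] z)).
    destruct (Rle_lt_or_eq_dec _ _ P) as [L|L]; [|lra].
    apply Rmult_le_reg_r with (vnorm z); [exact L|]. nra.
  - intros D HD.
    assert (E : forall k y, D (Nat.iter k S y) = Nat.iter k S (D y)).
    { induction k as [|k IH]; intros y; simpl; [reflexivity|]. rewrite Com, IH by exact HD. reflexivity. }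
    assert (Bk : forall k y, vnorm (Nat.iter k S y) <= c ^ k * vnorm y).
    { induction k as [|k IH]; intros y; simpl; [lra|].
      eapply Rle_trans; [apply Sc|]. specialize (IH y). nra. }
    unfold x. rewrite E. fold x. eapply Rle_trans; [apply Bk|].
    apply Rle_trans with (c ^ n0 * (delta / c ^ n0 * vnorm x0)).
    + apply Rmult_le_compat; [left; apply Pc | apply vnorm_pos | apply Rle_pow; lra || lia | apply Dx0, HD].
    + replace (c ^ n0 * (delta / c ^ n0 * vnorm x0)) with (delta * vnorm x0) by (field; lra). nra.
Qed.

(** Adding c + 1 makes S coercive. The approximate eigenvalues for the tolerances 1/(n + 1) then lie
    in the compact interval [1, 2c + 1], and a cluster point serves all tolerances at once. *)
Lemma jointly_small_eigenvalue S c Ds : 0 <= c ->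
  is_adjoint S S -> opbound S c -> (forall D, In D Ds -> linear_op D) ->
  (forall D, In D Ds -> forall x, D (S x) = S (D x)) -> jointly_small Ds ->
  exists r, jointly_small ((fun x => S x [-] RtoC r [*] x) :: Ds).
Proof.
  intros Hc Sa Sc DL Com Js.
  set (S' := fun x => S x [+] RtoC (c + 1) [*] x).
  assert (Sa' : is_adjoint S' S').
  { intros x y. change (ip (S' x) y = ip x (S' y)). unfold S'.
    rewrite ip_add_l, ip_add_r, ip_scal_l, ip_scal_r, (adjoint_ip S S Sa).
    rewrite Cconj_RtoC. reflexivity. }
  assert (Sc' : opbound S' (2 * c + 1)).
  { intros x. unfold S'. eapply Rle_trans; [apply vnorm_triangle|].
    rewrite vnorm_scal, Cmod_R, Rabs_pos_eq by lra. specialize (Sc x). lra. }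
  assert (Sco : forall x, nsq x <= fst (ip (S' x) x)).
  { intros x. unfold S'. rewrite ip_add_l, ip_scal_l, ip_self. simpl. rewrite <- vnorm_sq.
    assert (A := cauchy_schwarz_re (RtoC (-1) [*] S x) x).
    rewrite ip_scal_l, vnorm_scal, Cmod_R, Rabs_left in A by lra. simpl in A.
    specialize (Sc x). assert (P := vnorm_pos x). nra. }
  assert (Com' : forall D, In D Ds -> forall x, D (S' x) = S' (D x)).
  { intros D HD x. unfold S'. rewrite (lin_add D (DL D HD)), (lin_scal D (DL D HD)), Com by exact HD.
    reflexivity. }
  set (pr := fun (n : nat) (r : R) => 1 <= r <= 2 * c + 1 /\
    exists x, 0 < vnorm x /\ vnorm (S' x [-] RtoC r [*] x) <= / (INR n + 1) * vnorm x /\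
    forall D, In D Ds -> vnorm (D x) <= / (INR n + 1) * vnorm x).
  assert (Pn : forall n, 0 < / (INR n + 1)).
  { intros n. apply Rinv_0_lt_compat. assert (P := pos_INR n). lra. }
  assert (Ex : forall n, exists r, pr n r).
  { intros n. destruct (coercive_approx_eigenvalue S' (2 * c + 1) Ds (/ (INR n + 1)) Sa' ltac:(lra) Sc' Sco Com' Js (Pn n))
      as [r [x [A B]]]. exists r. split; [exact A|]. exists x. exact B. }
  destruct (choice_function pr Ex) as [u Hu].
  destruct (Bolzano_Weierstrass u (fun r => 1 <= r <= 2 * c + 1) (compact_P3 _ _)) as [r Hr].
  { intros n. apply Hu. }
  exists (r - (c + 1)). intros delta Hd.
  destruct (INR_unbounded (2 / delta)) as [m Hm].
  destruct (Hr (disc r (mkposreal (delta / 2) ltac:(lra))) m) as [n [Hn Hdisc]].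
  { exists (mkposreal (delta / 2) ltac:(lra)). intros t Ht. exact Ht. }
  unfold disc in Hdisc. simpl in Hdisc.
  destruct (Hu n) as [_ [x [Px [Hx HD]]]].
  assert (Hin : / (INR n + 1) <= delta / 2).
  { rewrite <- (Rinv_inv (delta / 2)). assert (E : / (delta / 2) = 2 / delta) by (field; lra).
    rewrite E. apply Rinv_le_contravar; [apply Rdiv_lt_0_compat; lra|].
    assert (INR m <= INR n) by (apply le_INR; exact Hn). lra. }
  exists x. split; [exact Px|]. intros D [E|E].
  - subst D.
    replace (S x [-] RtoC (r - (c + 1)) [*] x)
      with ((S' x [-] RtoC (u n) [*] x) [+] RtoC (u n - r) [*] x).
    2:{ unfold S'. rewrite !RtoC_minus, !RtoC_plus. vring. }
    eapply Rle_trans; [apply vnorm_triangle|]. rewrite vnorm_scal, Cmod_R. nra.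
  - specialize (HD D E). nra.
Qed.

Lemma opnorm_exists T b : 0 <= b -> opbound T b ->
  exists k, 0 <= k /\ opbound T k /\ forall c, 0 <= c -> opbound T c -> k <= c.
Proof.
  intros Hb HT.
  (* The least bound is an infimum, obtained as minus the supremum of the opposites. *)
  destruct (completeness (fun m => exists c, m = - c /\ 0 <= c /\ opbound T c)) as [m [Hm1 Hm2]].
  - exists 0. intros m [c [E [P _]]]. lra.
  - exists (- b), b. auto.
  - exists (- m). split; [|split].
    + assert (m <= 0); [|lra]. apply Hm2. intros t [c [E [P _]]]. lra.
    + intros x. assert (P := vnorm_pos x).
      destruct (Rle_lt_or_eq_dec _ _ P) as [L|L].
      * apply Rmult_le_reg_r with (/ vnorm x); [apply Rinv_0_lt_compat; exact L|].
        rewrite (Rmult_assoc (- m)), Rinv_r by lra.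
        assert (m <= - (vnorm (T x) * / vnorm x)); [|lra].
        apply Hm2. intros t [c [E [Pc Hc]]]. subst t.
        apply Ropp_le_contravar. specialize (Hc x).
        apply Rmult_le_reg_r with (vnorm x); [exact L|].
        rewrite Rmult_assoc, Rinv_l by lra. lra.
      * specialize (HT x). rewrite <- L in *. lra.
    + intros c Pc Hc. assert (- c <= m); [|lra]. apply Hm1. exists c. auto.
Qed.

(** |S T x - k^2 x|^2 <= k^2 (k^2 |x|^2 - |T x|^2), which is small when x nearly attains the norm k.
    The threshold t satisfies k^2 (k^2 - t) <= delta^2. *)
Lemma opnorm_jointly_small T S k : 0 < k -> is_adjoint T S -> opbound T k ->
  (forall c, 0 <= c -> opbound T c -> k <= c) ->
  jointly_small ((fun x => S (T x) [-] RtoC (k * k) [*] x) :: nil).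
Proof.
  intros Hk E HT Hmin delta Hd.
  assert (HS := adjoint_opbound T S k ltac:(lra) E HT).
  set (t := Rmax 0 (k * k - delta * delta / (k * k))).
  assert (Pd : 0 < delta * delta / (k * k)) by (apply Rdiv_lt_0_compat; nra).
  assert (Pt : 0 <= t) by apply Rmax_l.
  assert (Pt2 : k * k - delta * delta / (k * k) <= t) by apply Rmax_r.
  assert (Pt3 : t < k * k) by (apply Rmax_lub_lt; nra).
  assert (Sq := sqrt_sqrt t Pt). assert (Sp := sqrt_pos t).
  assert (Lt : sqrt t < k) by (apply Rnot_le_lt; intros L; nra).
  assert (Ex : exists x, sqrt t * vnorm x < vnorm (T x)).
  { apply NNPP. intros Hn. assert (k <= sqrt t); [|lra]. apply Hmin; [exact Sp|].
    intros x. apply Rnot_lt_le. intros L. apply Hn. exists x. exact L. }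
  destruct Ex as [x Hx]. exists x.
  assert (P := vnorm_pos x). assert (P1 := vnorm_pos (T x)). specialize (HT x).
  assert (Px : 0 < vnorm x).
  { destruct (Rle_lt_or_eq_dec _ _ P) as [L|L]; [exact L|]. rewrite <- L in *. lra. }
  split; [exact Px|]. intros D [<-|[]].
  apply vnorm_le_sq; [nra|].
  rewrite nsq_sub, nsq_scal, ip_scal_r, (adjoint_ip S T (adjoint_sym _ _ E)), ip_self.
  rewrite Cmod_R, Rabs_pos_eq by nra. simpl. rewrite <- !vnorm_sq.
  specialize (HS (T x)). assert (P2 := vnorm_pos (S (T x))).
  assert (Q1 : vnorm (S (T x)) * vnorm (S (T x)) <= k * vnorm (T x) * (k * vnorm (T x)))
    by (apply Rmult_le_compat; assumption).
  assert (Q2 : t * (vnorm x * vnorm x) <= vnorm (T x) * vnorm (T x)).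
  { rewrite <- Sq. replace (sqrt t * sqrt t * (vnorm x * vnorm x))
      with (sqrt t * vnorm x * (sqrt t * vnorm x)) by ring.
    apply Rmult_le_compat; nra. }
  assert (Q3 : k * k * (k * k - t) <= delta * delta).
  { apply Rle_trans with (k * k * (delta * delta / (k * k))); [apply Rmult_le_compat_l; nra|].
    apply Req_le. field. lra. }
  assert (Q4 := Rmult_le_compat_r (vnorm x * vnorm x) _ _ ltac:(nra) Q3).
  assert (Q5 := Rmult_le_compat_l (k * k) _ _ ltac:(nra) Q2).
  lra.
Qed.

(** T - lam divides p(T) - p(lam), with a bounded quotient. *)
Lemma poly_op_eigen T c p (lam : C) : 0 <= c -> linear_op T -> opbound T c ->
  exists b, 0 <= b /\ forall x,
    vnorm (poly_op p T x [-] peval p lam [*] x) <= b * vnorm (T x [-] lam [*] x).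
Proof.
  intros Hc LT HT. induction p as [|a p [b [Hb IH]]].
  - exists 0. split; [lra|]. intros x. simpl.
    replace (vzero H [-] RtoC 0 [*] x) with (vzero H) by vring. rewrite vnorm_zero. lra.
  - exists (c * b + Cmod (peval p lam)). assert (P := Cmod_ge_0 (peval p lam)).
    split; [nra|]. intros x. simpl.
    replace (a [*] x [+] T (poly_op p T x) [-] (a + lam * peval p lam)%C [*] x)
      with (T (poly_op p T x [-] peval p lam [*] x) [+] peval p lam [*] (T x [-] lam [*] x)).
    2:{ rewrite (lin_sub T LT), (lin_scal T LT). vring. }
    eapply Rle_trans; [apply vnorm_triangle|]. rewrite vnorm_scal.
    specialize (HT (poly_op p T x [-] peval p lam [*] x)). specialize (IH x).
    nra.
Qed.

End Localisation.

(** * Normal operators *)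

Section Normal.
Context {H : InnerProductSpace} (Hc : complete_space H).
Context (N Ns : H -> H) (HE : is_adjoint N Ns) (HC : forall x, N (Ns x) = Ns (N x)).
Context (c : R) (Pc : 0 <= c) (HN : opbound N c).

Let LN : linear_op N := adjoint_linear N Ns HE.
Let LNs : linear_op Ns := adjoint_linear Ns N (adjoint_sym _ _ HE).
Let HNs : opbound Ns c := adjoint_opbound N Ns c Pc HE HN.

Lemma normal_shift (lam : C) :
  let T := fun x => N x [-] lam [*] x in let S := fun x => Ns x [-] Cconj lam [*] x in
  is_adjoint T S /\ (forall x, T (S x) = S (T x)) /\ opbound T (c + Cmod lam).
Proof.
  intros T S. split; [|split].
  - intros x y. change (ip (T x) y = ip x (S y)). unfold T, S.
    rewrite ip_sub_l, ip_sub_r, ip_scal_l, ip_scal_r, Cconj_conj, (adjoint_ip N Ns HE). reflexivity.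
  - intros x. unfold T, S. rewrite (lin_sub N LN), (lin_sub Ns LNs), (lin_scal N LN), (lin_scal Ns LNs), HC.
    vring.
  - intros x. unfold T. eapply Rle_trans; [apply vnorm_triangle_sub|]. rewrite vnorm_scal.
    assert (HNx := HN x). lra.
Qed.

Lemma bounded_below_not_spectrum (lam : C) d : 0 < d ->
  (forall x, d * vnorm x <= vnorm (N x [-] lam [*] x)) -> ~ spectrum N lam.
Proof.
  intros Pd Hb Hs. apply Hs.
  destruct (normal_shift lam) as [TE [TC TB]].
  set (T := fun x => N x [-] lam [*] x) in *.
  assert (LT := adjoint_linear _ _ TE).
  assert (Pl := Cmod_ge_0 lam).
  assert (Onto := normal_bounded_below_onto Hc T _ (c + Cmod lam + 1) d ltac:(lra) Pd TE TC
    ltac:(apply (opbound_weaken T (c + Cmod lam)); [lra | exact TB]) Hb).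
  destruct (choice_function _ Onto) as [S TS].
  assert (Inj : forall x y, T x = T y -> x = y).
  { intros x y Exy. apply vsub_zero, vnorm_eq_0. assert (B := Hb (x [-] y)).
    change (d * vnorm (x [-] y) <= vnorm (T (x [-] y))) in B.
    rewrite (lin_sub T LT), Exy in B. replace (T y [-] T y) with (vzero H) in B by vring.
    rewrite vnorm_zero in B. assert (P := vnorm_pos (x [-] y)). nra. }
  exists S. split; [|split].
  - split; [split|].
    + intros x y. apply Inj. rewrite (lin_add T LT), !TS. reflexivity.
    + intros a x. apply Inj. rewrite (lin_scal T LT), !TS. reflexivity.
    + exists (/ d). intros x. apply Rmult_le_reg_l with d; [exact Pd|].
      rewrite <- Rmult_assoc, Rinv_r, Rmult_1_l by lra. rewrite <- (TS x) at 2. apply Hb.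
  - intros x. apply Inj. apply TS.
  - exact TS.
Qed.

(** A normal operator has no residual spectrum: bounded below already implies onto, so only
    approximate eigenvectors obstruct an inverse. *)
Lemma spectrum_iff_approx_eigenvalue (lam : C) : spectrum N lam <-> approx_eigenvalue N lam.
Proof.
  split.
  - intros Hs delta Hd. apply NNPP. intros Hn.
    apply (bounded_below_not_spectrum lam delta Hd); [|exact Hs].
    intros x. apply Rnot_lt_le. intros L. apply Hn. exists x.
    split; [|lra]. assert (P := vnorm_pos x). assert (P' := vnorm_pos (N x [-] lam [*] x)).
    destruct (Rle_lt_or_eq_dec _ _ P) as [L'|L']; [exact L'|]. rewrite <- L' in L. lra.
  - intros Ha [S [[_ [M HM]] [HS _]]].
    destruct (exists_small_factor M (/ 2)) as [d [Pd Hd]]; [lra|].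
    destruct (Ha d Pd) as [x [Px Hx]].
    specialize (HM (N x [-] lam [*] x)). rewrite HS in HM.
    assert (P' := vnorm_pos (N x [-] lam [*] x)).
    destruct (Rle_dec 0 M); nra.
Qed.

Lemma spectrum_bounded (lam : C) : spectrum N lam -> Cmod lam <= c.
Proof.
  intros Hs. apply Rnot_lt_le. intros L.
  apply (bounded_below_not_spectrum lam (Cmod lam - c) ltac:(lra)); [|exact Hs].
  intros x. rewrite vnorm_sub_sym.
  assert (T := vnorm_triangle_inv (lam [*] x) (N x)). rewrite vnorm_scal in T.
  assert (HNx := HN x). lra.
Qed.

Lemma spectrum_closed (a : C) : ~ spectrum N a ->
  exists d, 0 < d /\ forall z, spectrum N z -> d <= Cmod (z - a).
Proof.
  intros Ha. rewrite spectrum_iff_approx_eigenvalue in Ha.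
  assert (exists d, 0 < d /\ forall x, d * vnorm x <= vnorm (N x [-] a [*] x)) as [d [Pd Hd]].
  { apply NNPP. intros Hn. apply Ha. intros delta Pd. apply NNPP. intros Hx. apply Hn.
    exists delta. split; [exact Pd|]. intros x. apply Rnot_lt_le. intros L. apply Hx.
    exists x. split; [|lra]. assert (P := vnorm_pos x). assert (P' := vnorm_pos (N x [-] a [*] x)).
    destruct (Rle_lt_or_eq_dec _ _ P) as [L'|L']; [exact L'|]. rewrite <- L' in L. lra. }
  exists d. split; [exact Pd|]. intros z Hz. apply Rnot_lt_le. intros L.
  apply (bounded_below_not_spectrum z (d - Cmod (z - a)) ltac:(lra)); [|exact Hz].
  intros x. specialize (Hd x).
  replace (N x [-] a [*] x) with ((N x [-] z [*] x) [+] (z - a)%C [*] x) in Hd by vring.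
  assert (T := vnorm_triangle (N x [-] z [*] x) ((z - a)%C [*] x)). rewrite vnorm_scal in T. lra.
Qed.

Lemma spectrum_peval_le p (lam : C) M : spectrum N lam -> opbound (poly_op p N) M -> Cmod (peval p lam) <= M.
Proof.
  intros Hs HM. rewrite spectrum_iff_approx_eigenvalue in Hs.
  destruct (poly_op_eigen N c p lam Pc LN HN) as [b [Pb Hb]].
  apply le_epsilon. intros eps He.
  destruct (exists_small_factor b eps He) as [d [Pd Hd]].
  destruct (Hs d Pd) as [x [Px Hx]].
  specialize (Hb x). specialize (HM x).
  assert (T := vnorm_triangle_inv (peval p lam [*] x) (poly_op p N x)).
  rewrite vnorm_scal, vnorm_sub_sym in T.
  assert (A : b * vnorm (N x [-] lam [*] x) <= eps * vnorm x) by nra.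
  apply Rmult_le_reg_r with (vnorm x); [exact Px|]. lra.
Qed.

(** The self-adjoint real and imaginary parts of N; [(0, - / 2)] is 1/(2i). *)
Let N1 := fun x => RtoC (/ 2) [*] (N x [+] Ns x).
Let N2 := fun x => (0, - / 2) [*] (N x [-] Ns x).

Lemma cartesian_parts : is_adjoint N1 N1 /\ is_adjoint N2 N2 /\ opbound N1 c /\ opbound N2 c.
Proof.
  assert (Eh : Cmod (0, - / 2) = / 2).
  { unfold Cmod. simpl. replace (0 * (0 * 1) + - / 2 * (- / 2 * 1)) with (/ 2 * / 2) by field.
    apply sqrt_square. lra. }
  split; [|split; [|split]].
  - intros x y. change (ip (N1 x) y = ip x (N1 y)). unfold N1.
    rewrite ip_scal_l, ip_scal_r, ip_add_l, ip_add_r, (adjoint_ip N Ns HE),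
      (adjoint_ip Ns N (adjoint_sym _ _ HE)).
    rewrite Cconj_RtoC. ring.
  - intros x y. change (ip (N2 x) y = ip x (N2 y)). unfold N2.
    rewrite ip_scal_l, ip_scal_r, ip_sub_l, ip_sub_r, (adjoint_ip N Ns HE),
      (adjoint_ip Ns N (adjoint_sym _ _ HE)).
    replace (Cconj (0, - / 2)) with (Copp (0%R, (- / 2)%R))
      by (unfold Cconj, Copp; simpl; f_equal; ring).
    ring.
  - intros x. unfold N1. rewrite vnorm_scal, Cmod_R, Rabs_pos_eq by lra.
    assert (T := vnorm_triangle (N x) (Ns x)). assert (A := HN x). assert (B := HNs x). lra.
  - intros x. unfold N2. rewrite vnorm_scal, Eh.
    assert (T := vnorm_triangle_sub (N x) (Ns x)). assert (A := HN x). assert (B := HNs x). lra.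
Qed.

Lemma cartesian_decomposition r1 r2 x :
  N x [-] (r1, r2) [*] x =
    (N1 x [-] RtoC r1 [*] x) [+] Ci [*] (N2 x [-] RtoC r2 [*] x) /\
  Ns x [-] Cconj (r1, r2) [*] x =
    (N1 x [-] RtoC r1 [*] x) [-] Ci [*] (N2 x [-] RtoC r2 [*] x).
Proof.
  split; apply vext; intros y; unfold N1, N2; autorewrite with ip;
    destruct (ip (N x) y) as [a b], (ip (Ns x) y) as [a' b'], (ip x y) as [u v];
    apply injective_projections; simpl; field.
Qed.

Lemma commute_cartesian D : linear_op D ->
  (forall x, D (N x) = N (D x)) -> (forall x, D (Ns x) = Ns (D x)) ->
  (forall x, D (N1 x) = N1 (D x)) /\ (forall x, D (N2 x) = N2 (D x)).
Proof.
  intros LD C1 C2. split; intros x; unfold N1, N2.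
  - rewrite (lin_scal D LD), (lin_add D LD), C1, C2. reflexivity.
  - rewrite (lin_scal D LD), (lin_sub D LD), C1, C2. reflexivity.
Qed.

(** T'T is localised at k^2, then the real part of N at r1, then its imaginary part at r2.
    Commutation lets each localisation keep the earlier ones, and the two parts recombine into N and
    its adjoint. *)
Lemma joint_spectral_point T S k : 0 < k -> is_adjoint T S -> opbound T k ->
  (forall b, 0 <= b -> opbound T b -> k <= b) ->
  (forall x, T (N x) = N (T x)) -> (forall x, T (Ns x) = Ns (T x)) ->
  (forall x, S (N x) = N (S x)) -> (forall x, S (Ns x) = Ns (S x)) ->
  exists lam, spectrum N lam /\ forall delta, 0 < delta -> exists x, 0 < vnorm x /\
    vnorm (S (T x) [-] RtoC (k * k) [*] x) <= delta * vnorm x /\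
    vnorm (N x [-] lam [*] x) <= delta * vnorm x /\
    vnorm (Ns x [-] Cconj lam [*] x) <= delta * vnorm x.
Proof.
  intros Pk TE Tk Tmin C1 C2 C3 C4.
  assert (LT := adjoint_linear T S TE). assert (LS := adjoint_linear S T (adjoint_sym _ _ TE)).
  destruct cartesian_parts as [A1 [A2 [B1 B2]]].
  assert (L1 := adjoint_linear N1 N1 A1). assert (L2 := adjoint_linear N2 N2 A2).
  assert (J0 := opnorm_jointly_small T S k Pk TE Tk Tmin).
  set (D0 := fun x => S (T x) [-] RtoC (k * k) [*] x) in *.
  assert (Lsub : forall (A : H -> H) (a : C), linear_op A -> linear_op (fun x => A x [-] a [*] x)).
  { intros A a LA. split; intros.
    - rewrite (lin_add A LA). vring.
    - rewrite (lin_scal A LA). vring. }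
  assert (LD0 : linear_op D0).
  { apply (Lsub (fun x => S (T x))). split; intros.
    - rewrite (lin_add T LT), (lin_add S LS). reflexivity.
    - rewrite (lin_scal T LT), (lin_scal S LS). reflexivity. }
  destruct (commute_cartesian D0 LD0) as [CD1 CD2].
  { intros x. unfold D0. rewrite C1, C3, (lin_sub N LN), (lin_scal N LN). reflexivity. }
  { intros x. unfold D0. rewrite C2, C4, (lin_sub Ns LNs), (lin_scal Ns LNs). reflexivity. }
  destruct (jointly_small_eigenvalue N1 c (D0 :: nil) Pc A1 B1) as [r1 J1].
  { intros D [<-|[]]. exact LD0. }
  { intros D [<-|[]]. exact CD1. }
  { exact J0. }
  set (D1 := fun x => N1 x [-] RtoC r1 [*] x) in *.
  assert (LD1 : linear_op D1) by (apply Lsub, L1).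
  assert (CN : forall x, N1 (N2 x) = N2 (N1 x)).
  { apply (commute_cartesian N1 L1); intros x; unfold N1.
    - rewrite (lin_scal N LN), (lin_add N LN), HC. reflexivity.
    - rewrite (lin_scal Ns LNs), (lin_add Ns LNs), HC. reflexivity. }
  destruct (jointly_small_eigenvalue N2 c (D1 :: D0 :: nil) Pc A2 B2) as [r2 J2].
  { intros D [<-|[<-|[]]]; assumption. }
  { intros D [<-|[<-|[]]]; [|exact CD2]. intros x. unfold D1.
    rewrite CN, (lin_sub N2 L2), (lin_scal N2 L2). reflexivity. }
  { exact J1. }
  set (D2 := fun x => N2 x [-] RtoC r2 [*] x) in *.
  assert (Main : forall delta, 0 < delta -> exists x, 0 < vnorm x /\
    vnorm (D0 x) <= delta * vnorm x /\
    vnorm (N x [-] (r1, r2) [*] x) <= delta * vnorm x /\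
    vnorm (Ns x [-] Cconj (r1, r2) [*] x) <= delta * vnorm x).
  { intros delta Hd. destruct (J2 (delta / 2)) as [x [Px Hx]]; [lra|].
    assert (X0 := Hx D0 ltac:(simpl; tauto)).
    assert (X1 := Hx D1 ltac:(simpl; tauto)).
    assert (X2 := Hx D2 ltac:(simpl; tauto)).
    exists x. destruct (cartesian_decomposition r1 r2 x) as [E1 E2].
    assert (X2' : vnorm (Ci [*] D2 x) <= delta / 2 * vnorm x).
    { rewrite vnorm_scal, Cmod_Ci. lra. }
    split; [exact Px|]. split; [nra|]. split.
    - rewrite E1. eapply Rle_trans; [apply vnorm_triangle|].
      change (vnorm (D1 x) + vnorm (Ci [*] D2 x) <= delta * vnorm x). lra.
    - rewrite E2. eapply Rle_trans; [apply vnorm_triangle_sub|].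
      change (vnorm (D1 x) + vnorm (Ci [*] D2 x) <= delta * vnorm x). lra. }
  exists (r1, r2). split; [|exact Main].
  apply spectrum_iff_approx_eigenvalue. intros delta Hd.
  destruct (Main delta Hd) as [x Hx]. exists x. tauto.
Qed.

(** Suppose that the norm k of T exceeds eps. At the joint spectral point, T x is close to (p(lam) -
    conj lam) x, so |T x|^2 is at most about eps^2 |x|^2, while <S T x, x> = |T x|^2 is about k^2
    |x|^2. *)
Lemma poly_minus_adjoint_opbound p eps : 0 <= eps ->
  (forall lam, spectrum N lam -> Cmod (Cconj lam - peval p lam) <= eps) ->
  opbound (fun x => poly_op p N x [-] Ns x) eps.
Proof.
  intros Pe Hp.
  set (T := fun x => poly_op p N x [-] Ns x).
  set (S := fun x => poly_op (map Cconj p) Ns x [-] N x).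
  assert (PE := poly_op_adjoint N Ns p HE).
  assert (Lp := poly_op_linear N p LN). assert (Lq := poly_op_linear Ns (map Cconj p) LNs).
  assert (TE : is_adjoint T S).
  { intros x y. change (ip (T x) y = ip x (S y)). unfold T, S.
    rewrite ip_sub_l, ip_sub_r, (adjoint_ip _ _ PE), (adjoint_ip Ns N (adjoint_sym _ _ HE)). reflexivity. }
  destruct (poly_op_opbound N p c Pc HN) as [b [Pb Hb]].
  destruct (opnorm_exists T (b + c)) as [k [Pk [Tk Tmin]]]; [lra| |].
  { intros x. unfold T. eapply Rle_trans; [apply vnorm_triangle_sub|].
    assert (A := Hb x). assert (B := HNs x). lra. }
  apply (opbound_weaken T k); [|exact Tk].
  apply Rnot_lt_le. intros L.
  destruct (joint_spectral_point T S k ltac:(lra) TE Tk Tmin) as [lam [Hs Hx]].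
  { intros x. unfold T. rewrite (lin_sub N LN), (poly_op_commute N N), HC by auto. reflexivity. }
  { intros x. unfold T. rewrite (lin_sub Ns LNs), (poly_op_commute N Ns) by auto. reflexivity. }
  { intros x. unfold S. rewrite (lin_sub N LN), (poly_op_commute Ns N) by auto. reflexivity. }
  { intros x. unfold S. rewrite (lin_sub Ns LNs), (poly_op_commute Ns Ns), HC by auto. reflexivity. }
  specialize (Hp lam Hs).
  destruct (poly_op_eigen N c p lam Pc LN HN) as [B [PB HB]].
  set (M := B + 1).
  (* Makes (eps + M delta)^2 + delta at most eps^2 + (k^2 - eps^2)/2 < k^2; delta <= 1 absorbs the
     quadratic term. *)
  set (delta := Rmin 1 ((k * k - eps * eps) / (2 * (1 + 2 * eps * M + M * M)))).
  assert (PM : 1 <= M) by (unfold M; lra).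
  assert (Pden : 0 < 1 + 2 * eps * M + M * M) by nra.
  assert (Pd : 0 < delta).
  { apply Rmin_pos; [lra|]. apply Rdiv_lt_0_compat; nra. }
  assert (Pd1 : delta <= 1) by apply Rmin_l.
  assert (Pd2 : delta * (1 + 2 * eps * M + M * M) <= (k * k - eps * eps) / 2).
  { apply Rle_trans with ((k * k - eps * eps) / (2 * (1 + 2 * eps * M + M * M)) * (1 + 2 * eps * M + M * M)).
    - apply Rmult_le_compat_r; [lra | apply Rmin_r].
    - apply Req_le. field. lra. }
  destruct (Hx delta Pd) as [x [Px [X0 [X1 X2]]]].
  assert (U : vnorm (T x) <= (eps + M * delta) * vnorm x).
  { replace (T x) with ((poly_op p N x [-] peval p lam [*] x) [-] (Ns x [-] Cconj lam [*] x)
       [-] (Cconj lam - peval p lam)%C [*] x) by (unfold T; vring).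
    eapply Rle_trans; [apply vnorm_triangle_sub|]. rewrite vnorm_scal.
    assert (T0 := vnorm_triangle_sub (poly_op p N x [-] peval p lam [*] x) (Ns x [-] Cconj lam [*] x)).
    specialize (HB x). unfold M. nra. }
  assert (V : (k * k - delta) * (vnorm x * vnorm x) <= vnorm (T x) * vnorm (T x)).
  { assert (Q := cauchy_schwarz_re (RtoC (-1) [*] (S (T x) [-] RtoC (k * k) [*] x)) x).
    rewrite vnorm_scal, Cmod_R, Rabs_left in Q by lra.
    rewrite ip_scal_l, ip_sub_l, ip_scal_l, (adjoint_ip S T (adjoint_sym _ _ TE)), !ip_self in Q.
    simpl in Q. rewrite <- !vnorm_sq in Q. nra. }
  assert (PT := vnorm_pos (T x)).
  assert (W : vnorm (T x) * vnorm (T x) <= (eps + M * delta) * vnorm x * ((eps + M * delta) * vnorm x))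
    by (apply Rmult_le_compat; assumption).
  assert (X : k * k - delta <= (eps + M * delta) * (eps + M * delta)).
  { apply Rmult_le_reg_r with (vnorm x * vnorm x); [nra | lra]. }
  assert (M * M * (delta * delta) <= M * M * delta) by (apply Rmult_le_compat_l; nra).
  nra.
Qed.

End Normal.

(** * Upper bounds versus operator norms *)

Section Transfer.
Context {H : InnerProductSpace}.

Lemma is_opnorm_opbound (T : H -> H) r : linear_op T -> is_opnorm T r -> 0 <= r /\ opbound T r.
Proof.
  intros LT [Hub _].
  assert (P0 : 0 <= r).
  { apply Hub. exists (vzero H). rewrite (lin_zero T LT), vnorm_zero. split; [lra | reflexivity]. }
  split; [exact P0|]. intros x. assert (P := vnorm_pos x).
  destruct (Rle_lt_or_eq_dec _ _ P) as [L|L].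
  - assert (Q : vnorm (T (RtoC (/ vnorm x) [*] x)) <= r).
    { apply Hub. exists (RtoC (/ vnorm x) [*] x). split; [|reflexivity].
      rewrite vnorm_scal, Cmod_R, Rabs_pos_eq by (left; apply Rinv_0_lt_compat; exact L).
      rewrite Rinv_l; lra. }
    rewrite (lin_scal T LT), vnorm_scal, Cmod_R, Rabs_pos_eq in Q
      by (left; apply Rinv_0_lt_compat; exact L).
    apply Rmult_le_reg_l with (/ vnorm x); [apply Rinv_0_lt_compat; exact L|].
    replace (/ vnorm x * (r * vnorm x)) with r by (field; lra). exact Q.
  - rewrite (vnorm_eq_0 x (eq_sym L)), (lin_zero T LT), vnorm_zero. lra.
Qed.

Lemma opbound_is_opnorm (T : H -> H) b : 0 <= b -> opbound T b -> exists r, is_opnorm T r /\ r <= b.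
Proof.
  intros Pb HT.
  assert (Ub : is_upper_bound (fun y => exists x, vnorm x <= 1 /\ y = vnorm (T x)) b).
  { intros y [x [Hx E]]. subst. specialize (HT x). nra. }
  destruct (completeness (fun y => exists x, vnorm x <= 1 /\ y = vnorm (T x))) as [r Hr].
  - exists b. exact Ub.
  - exists (vnorm (T (vzero H))), (vzero H). rewrite vnorm_zero. split; [lra | reflexivity].
  - exists r. split; [exact Hr|]. apply Hr, Ub.
Qed.

Lemma is_opnorm_iff (T S : H -> H) : linear_op T -> linear_op S ->
  (forall b, 0 <= b -> opbound T b <-> opbound S b) -> forall r, is_opnorm T r -> is_opnorm S r.
Proof.
  intros LT LS E r Hr. destruct (is_opnorm_opbound T r LT Hr) as [P B].
  apply (E r P) in B. destruct (opbound_is_opnorm S r P B) as [r' [Hr' L]].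
  replace r with r'; [exact Hr'|]. apply Rle_antisym; [exact L|].
  destruct (is_opnorm_opbound S r' LS Hr') as [P' B']. apply (E r' P') in B'.
  apply Hr. intros y [x [Hx Ey]]. subst. specialize (B' x). nra.
Qed.

End Transfer.

(** * The adjoint as a limit of polynomials *)

Section Forward.
Context {H : InnerProductSpace} (Hc : complete_space H).
Implicit Types (x y z : H).

(** Polarisation: the quadratic forms at x + y and x + iy determine the sesquilinear form. *)
Lemma adjoint_of_diagonal (A B : H -> H) : linear_op A -> linear_op B ->
  (forall x, ip (B x) x = ip x (A x)) -> is_adjoint A B.
Proof.
  intros LA LB Hd x y. change (ip (A x) y = ip x (B y)).
  assert (D : forall z, ip (A z) z = ip z (B z)).
  { intros z. rewrite (ip_conj (B z) z), Hd, <- ip_conj. reflexivity. }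
  assert (E1 := D (x [+] y)). assert (E2 := D (x [+] Ci [*] y)).
  rewrite (lin_add A LA), (lin_add B LB) in E1.
  rewrite (lin_add A LA), (lin_add B LB), (lin_scal A LA), (lin_scal B LB) in E2.
  autorewrite with ip in E1, E2. rewrite !(D x), !(D y) in E1, E2.
  destruct (ip (A x) y) as [a b], (ip x (B y)) as [a' b'],
    (ip (A y) x) as [u v], (ip y (B x)) as [u' v'],
    (ip x (B x)) as [d1 d2], (ip y (B y)) as [d3 d4].
  injection E1. injection E2. simpl. intros. apply injective_projections; simpl; lra.
Qed.

(** The first-order term is - 2 t Im <W, x>, and t takes both signs, so a bound of order t^2 forces
    it to vanish. *)
Lemma real_form_of_norm_bound (W x : H) M :
  (forall t, nsq (x [+] (0, t) [*] W) <= nsq x + t * t * M) -> snd (ip W x) = 0.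
Proof.
  intros Ht.
  assert (G : forall t, - (2 * t * snd (ip W x)) <= t * t * M).
  { intros t. specialize (Ht t). rewrite nsq_add, nsq_scal, ip_scal_r, (ip_conj W x) in Ht.
    assert (P : 0 <= Cmod (0, t) * Cmod (0, t) * nsq W).
    { apply Rmult_le_pos; [|apply nsq_pos]. apply Rle_0_sqr. }
    simpl in Ht. lra. }
  set (b := snd (ip W x)) in *.
  assert (PM := Rabs_pos M). assert (QM := Rle_abs M).
  destruct (Rtotal_order b 0) as [L|[L|L]]; [|exact L|]; exfalso.
  - specialize (G (- b / (Rabs M + 1))).
    assert (P : 0 < - b / (Rabs M + 1)) by (apply Rdiv_lt_0_compat; lra).
    set (s := - b / (Rabs M + 1)) in *.
    assert (Es : s * (Rabs M + 1) = - b) by (unfold s; field; lra). nra.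
  - specialize (G (- (b / (Rabs M + 1)))).
    assert (P : 0 < b / (Rabs M + 1)) by (apply Rdiv_lt_0_compat; lra).
    set (s := b / (Rabs M + 1)) in *.
    assert (Es : s * (Rabs M + 1) = b) by (unfold s; field; lra). nra.
Qed.

Lemma normal_of_polynomial_norms (N Ns A : H -> H) c cA :
  is_adjoint N Ns -> 0 <= c -> opbound N c ->
  linear_op A -> 0 <= cA -> opbound A cA ->
  (forall eps, 0 < eps -> exists p, opbound (fun x => poly_op p N x [-] Ns x) eps) ->
  (forall p b, 0 <= b -> opbound (poly_op p N) b -> opbound (poly_op p A) b) ->
  normal_op A.
Proof.
  intros HE Pc HN LA PcA HA Happ Htr.
  assert (LN := adjoint_linear N Ns HE). assert (LNs := adjoint_linear Ns N (adjoint_sym _ _ HE)).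
  assert (HNs := adjoint_opbound N Ns c Pc HE HN).
  set (e := fun n : nat => / (INR n + 1)).
  assert (Pe : forall n, 0 < e n).
  { intros n. apply Rinv_0_lt_compat. assert (P := pos_INR n). lra. }
  assert (Le : forall eps, 0 < eps -> exists n0, forall n, (n0 <= n)%nat -> e n < eps).
  { intros eps He. destruct (INR_unbounded (/ eps)) as [n0 Hn0]. exists n0. intros n Hn.
    unfold e. rewrite <- (Rinv_inv eps). apply Rinv_lt_contravar.
    - apply Rmult_lt_0_compat; [apply Rinv_0_lt_compat; exact He|]. assert (P := pos_INR n). lra.
    - assert (INR n0 <= INR n) by (apply le_INR; exact Hn). lra. }
  destruct (choice_function (fun n q => opbound (fun x => poly_op q N x [-] Ns x) (e n)))
    as [p Hp]; [auto|].
  (* p_n - p_m is itself a polynomial, so its small norm at N carries over to A: the p_n(A) form a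
     Cauchy sequence. *)
  assert (Diff : forall n m x, vnorm (poly_op (p n) A x [-] poly_op (p m) A x) <= (e n + e m) * vnorm x).
  { intros n m.
    assert (Q : forall T x, linear_op T -> poly_op (padd (p n) (pscal (RtoC (-1)) (p m))) T x =
      poly_op (p n) T x [-] poly_op (p m) T x).
    { intros T x LT. rewrite poly_op_add, poly_op_scal by exact LT. vring. }
    intros x. rewrite <- Q by exact LA. revert x.
    apply (Htr _ (e n + e m)); [assert (A1 := Pe n); assert (A2 := Pe m); lra|].
    intros x. rewrite Q by exact LN.
    eapply Rle_trans; [apply (vnorm_sub_triangle _ (Ns x))|].
    rewrite (vnorm_sub_sym (Ns x)). assert (A1 := Hp n x). assert (A2 := Hp m x). cbv beta in *. lra. }
  assert (Lim : forall x, exists l, forall n, vnorm (poly_op (p n) A x [-] l) <= e n * vnorm x).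
  { intros x. assert (Px := vnorm_pos x).
    destruct (Hc (fun n => poly_op (p n) A x)) as [l Hl].
    { intros eps He. destruct (exists_small_factor (2 * vnorm x) (eps / 2)) as [d [Pd Hd]]; [lra|].
      destruct (Le d Pd) as [n0 Hn0].
      exists n0. intros n m Hn Hm. eapply Rle_lt_trans; [apply Diff|].
      assert (A1 := Hn0 n Hn). assert (A2 := Hn0 m Hm). nra. }
    exists l. intros n. apply le_epsilon. intros eps He.
    destruct (Hl (eps / 2)) as [m1 Hm1]; [lra|].
    destruct (exists_small_factor (vnorm x) (eps / 2)) as [d [Pd Hd]]; [lra|].
    destruct (Le d Pd) as [m2 Hm2].
    assert (A1 := Hm1 (m1 + m2)%nat ltac:(lia)). assert (A2 := Hm2 (m1 + m2)%nat ltac:(lia)).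
    assert (A3 := Diff n (m1 + m2)%nat x).
    assert (A4 := vnorm_sub_triangle (poly_op (p n) A x) (poly_op (p (m1 + m2)%nat) A x) l).
    assert (A5 : e (m1 + m2)%nat * vnorm x <= eps / 2) by nra.
    lra. }
  destruct (choice_function _ Lim) as [B HB]. clear Lim.
  assert (LpA : forall n, linear_op (poly_op (p n) A)) by (intros; apply poly_op_linear, LA).
  assert (Tozero : forall M x y, (forall n, vnorm (x [-] y) <= e n * M) -> x = y).
  { intros M x y HM. apply vnorm_small_eq. intros eps He.
    destruct (exists_small_factor (Rabs M) eps He) as [d [Pd Hd]].
    destruct (Le d Pd) as [n Hn].
    specialize (Hn n (Nat.le_refl n)). specialize (HM n). specialize (Pe n).
    assert (P := Rabs_pos M). assert (Q := Rle_abs M). nra. }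
  assert (LB : linear_op B).
  { split.
    - intros x y. apply (Tozero (vnorm (x [+] y) + vnorm x + vnorm y)). intros n.
      replace (B (x [+] y) [-] (B x [+] B y)) with
        (((poly_op (p n) A x [-] B x) [+] (poly_op (p n) A y [-] B y)) [-]
          (poly_op (p n) A (x [+] y) [-] B (x [+] y))) by (rewrite (lin_add _ (LpA n)); vring).
      eapply Rle_trans; [apply vnorm_triangle_sub|].
      assert (T := vnorm_triangle (poly_op (p n) A x [-] B x) (poly_op (p n) A y [-] B y)).
      assert (A1 := HB x n). assert (A2 := HB y n). assert (A3 := HB (x [+] y) n). lra.
    - intros a x. apply (Tozero (vnorm (a [*] x) + Cmod a * vnorm x)). intros n.
      replace (B (a [*] x) [-] a [*] B x) with
        (a [*] (poly_op (p n) A x [-] B x) [-] (poly_op (p n) A (a [*] x) [-] B (a [*] x)))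
        by (rewrite (lin_scal _ (LpA n)); vring).
      eapply Rle_trans; [apply vnorm_triangle_sub|].
      rewrite (vnorm_scal a (poly_op (p n) A x [-] B x)).
      assert (A1 := HB x n). assert (A3 := HB (a [*] x) n). assert (A4 := Cmod_ge_0 a). nra. }
  assert (CAB : forall x, A (B x) = B (A x)).
  { intros x. apply (Tozero (cA * vnorm x + vnorm (A x))). intros n.
    replace (A (B x) [-] B (A x)) with
      ((poly_op (p n) A (A x) [-] B (A x)) [-] A (poly_op (p n) A x [-] B x))
      by (rewrite (lin_sub A LA), (poly_op_commute A A) by auto; vring).
    eapply Rle_trans; [apply vnorm_triangle_sub|].
    assert (A1 := HB x n). assert (A2 := HB (A x) n). assert (A3 := HA (poly_op (p n) A x [-] B x)). nra. }
  exists B. split; [|exact CAB].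
  (* The values al = 1 and al = i give the imaginary and the real part of <B x, x> = conj <A x,
     x>. *)
  assert (Key : forall (al : C) x, Cmod al = 1 -> snd (ip (al [*] A x [+] Cconj al [*] B x) x) = 0).
  { intros al x Hal. apply (real_form_of_norm_bound _ _ (2 * c * (2 * c) * nsq x)). intros t.
    set (kt := sqrt (1 + t * t * (2 * c * (2 * c)))).
    assert (Pk : 0 <= 1 + t * t * (2 * c * (2 * c))).
    { assert (0 <= t * t) by apply Rle_0_sqr. nra. }
    assert (Ek : kt * kt = 1 + t * t * (2 * c * (2 * c))) by (apply sqrt_sqrt; exact Pk).
    assert (Pk0 : 0 <= kt) by apply sqrt_pos.
    assert (Ct : Cmod (0, t) = Rabs t).
    { unfold Cmod. simpl. replace (0 * (0 * 1) + t * (t * 1)) with (Rsqr t) by (unfold Rsqr; ring).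
      apply sqrt_Rsqr_abs. }
    assert (Pt := Rabs_pos t).
    (* al N + conj al N' is self-adjoint, so the cross term vanishes and |y + itW|^2 = |y|^2 + t^2
       |W|^2. *)
    assert (BN : forall y, vnorm (y [+] (0, t) [*] (al [*] N y [+] Cconj al [*] Ns y)) <= kt * vnorm y).
    { intros y. set (W := al [*] N y [+] Cconj al [*] Ns y).
      assert (WB : vnorm W <= 2 * c * vnorm y).
      { unfold W. eapply Rle_trans; [apply vnorm_triangle|]. rewrite !vnorm_scal, Cmod_conj, Hal.
        assert (A1 := HN y). assert (A2 := HNs y). lra. }
      assert (WR : snd (ip y W) = 0).
      { unfold W. autorewrite with ip. rewrite Cconj_conj, <- (adjoint_ip N Ns HE y y), (ip_conj (N y) y).
        simpl. ring. }
      assert (PW := vnorm_pos W). assert (Py := vnorm_pos y).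
      apply vnorm_le_sq; [apply Rmult_le_pos; assumption|].
      rewrite nsq_add, nsq_scal, ip_scal_r. simpl fst. rewrite WR.
      rewrite Cmod_sq. simpl. rewrite <- !vnorm_sq.
      replace (kt * vnorm y * (kt * vnorm y)) with (kt * kt * (vnorm y * vnorm y)) by ring.
      rewrite Ek. assert (0 <= t * t) by apply Rle_0_sqr.
      assert (vnorm W * vnorm W <= 2 * c * vnorm y * (2 * c * vnorm y)) by (apply Rmult_le_compat; assumption).
      assert (t * t * (vnorm W * vnorm W) <= t * t * (2 * c * vnorm y * (2 * c * vnorm y)))
        by (apply Rmult_le_compat_l; assumption).
      lra. }
    (* The polynomial 1 + it (al X + conj al p_n(X)), whose value at N tends to the operator bounded
       by [BN] and at A to the one in [Key]. *)
    set (q := fun n => padd (RtoC 1 :: nil) (pscal (0, t)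
      (padd (RtoC 0 :: al :: nil) (pscal (Cconj al) (p n))))).
    assert (Eq : forall n T y, linear_op T -> poly_op (q n) T y =
      y [+] (0, t) [*] (al [*] T y [+] Cconj al [*] poly_op (p n) T y)).
    { intros n T y LT. unfold q. rewrite poly_op_add, poly_op_scal, poly_op_add, poly_op_scal by exact LT.
      simpl. rewrite (lin_zero T LT), !vadd_zero, (lin_scal T LT). vring. }
    assert (BA : forall n, vnorm (x [+] (0, t) [*] (al [*] A x [+] Cconj al [*] B x))
      <= kt * vnorm x + e n * (2 * Rabs t * vnorm x)).
    { intros n.
      assert (Q : vnorm (poly_op (q n) A x) <= (kt + Rabs t * e n) * vnorm x).
      { revert x. apply (Htr (q n) (kt + Rabs t * e n)).
        - assert (A1 := Pe n). nra.
        - intros y. rewrite Eq by exact LN.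
          replace (y [+] (0, t) [*] (al [*] N y [+] Cconj al [*] poly_op (p n) N y))
            with ((y [+] (0, t) [*] (al [*] N y [+] Cconj al [*] Ns y)) [+]
              (0, t) [*] (Cconj al [*] (poly_op (p n) N y [-] Ns y))) by vring.
          eapply Rle_trans; [apply vnorm_triangle|]. rewrite (vnorm_scal (0, t) (Cconj al [*] _)), vnorm_scal, Cmod_conj, Hal, Ct.
          assert (A1 := BN y). assert (A2 := Hp n y). cbv beta in A2. nra. }
      rewrite Eq in Q by exact LA.
      replace (x [+] (0, t) [*] (al [*] A x [+] Cconj al [*] B x))
        with ((x [+] (0, t) [*] (al [*] A x [+] Cconj al [*] poly_op (p n) A x)) [-]
          (0, t) [*] (Cconj al [*] (poly_op (p n) A x [-] B x))) by vring.
      eapply Rle_trans; [apply vnorm_triangle_sub|].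
      rewrite (vnorm_scal (0, t) (Cconj al [*] _)), vnorm_scal, Cmod_conj, Hal, Ct.
      assert (A2 := HB x n). nra. }
    assert (BL : vnorm (x [+] (0, t) [*] (al [*] A x [+] Cconj al [*] B x)) <= kt * vnorm x).
    { apply le_epsilon. intros eps He.
      assert (Px := vnorm_pos x).
      assert (PM : 0 <= 2 * Rabs t * vnorm x) by nra.
      destruct (exists_small_factor (2 * Rabs t * vnorm x) eps He) as [d [Pd Hd]].
      destruct (Le d Pd) as [n Hn].
      specialize (Hn n (Nat.le_refl n)). eapply Rle_trans; [apply (BA n)|]. nra. }
    assert (P0 := vnorm_pos (x [+] (0, t) [*] (al [*] A x [+] Cconj al [*] B x))).
    assert (R := Rmult_le_compat _ _ _ _ P0 P0 BL BL).
    replace (kt * vnorm x * (kt * vnorm x)) with (kt * kt * (vnorm x * vnorm x)) in R by ring.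
    rewrite Ek, !vnorm_sq in R. lra. }
  apply adjoint_of_diagonal; [exact LA | exact LB |].
  intros x. assert (K1 := Key (RtoC 1) x Cmod_1). assert (K2 := Key Ci x Cmod_Ci).
  rewrite ip_add_l, !ip_scal_l in K1, K2. rewrite (ip_conj (A x) x).
  destruct (ip (A x) x) as [a b], (ip (B x) x) as [a' b']. simpl in K1, K2.
  unfold Cconj. simpl. f_equal; lra.
Qed.

End Forward.

(** * Compactness and the maximum modulus principle *)

Lemma closed_bounded_compact (K : C -> Prop) R0 : bounded_by K R0 ->
  (forall a, ~ K a -> exists d, 0 < d /\ forall z, K z -> d <= Cmod (z - a)) -> C_compact K.
Proof.
  intros HK Hcl F Fo Fc.
  set (near := fun (t : R * (R * unit)) (d : R) (w : C) =>
    Rabs (fst w - fst t) < d /\ Rabs (snd w - fst (snd t)) < d).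
  assert (NearC : forall (t : R * (R * unit)) d w, near t d w -> Cmod (w - (fst t, fst (snd t))) < 2 * d).
  { intros t d w [A B]. eapply Rle_lt_trans; [apply Cmod_le_abs|]. simpl.
    replace (fst w + - fst t) with (fst w - fst t) by ring.
    replace (snd w + - fst (snd t)) with (snd w - fst (snd t)) by ring. lra. }
  (* The gauge at t is a square that lies in one member of the cover or misses K; a finite
     gauge-fine family then yields the subcover. [R * (R * unit)] is the plane in the form used by
     [compactness_list]. *)
  assert (Gauge : forall t : R * (R * unit), exists d : posreal,
    (exists U, F U /\ forall w, near t d w -> U w) \/ (forall w, near t d w -> ~ K w)).
  { intros t. set (z := (fst t, fst (snd t)) : C).
    destruct (classic (K z)) as [Kz|Kz].
    - destruct (Fc z Kz) as [U [FU Uz]]. destruct (Fo U FU z Uz) as [eps [He HU]].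
      exists (mkposreal (eps / 2) ltac:(lra)). left. exists U. split; [exact FU|].
      intros w Hw. apply HU. rewrite Cdist_Cmod.
      apply NearC in Hw. simpl in Hw. fold z in Hw. lra.
    - destruct (Hcl z Kz) as [d [Hd HKd]].
      exists (mkposreal (d / 2) ltac:(lra)). right. intros w Hw Kw.
      apply NearC in Hw. simpl in Hw. fold z in Hw. specialize (HKd w Kw). lra. }
  destruct (choice_function _ Gauge) as [delta Hdelta].
  assert (Sel : forall l : list (R * (R * unit)), exists lU : list (C -> Prop),
    (forall U, In U lU -> F U) /\
    forall t w, In t l -> near t (delta t) w -> K w -> exists U, In U lU /\ U w).
  { induction l as [|t l [lU [A B]]].
    - exists nil. split; [intros U [] | intros t w []].
    - destruct (Hdelta t) as [[U [FU HU]]|HnK].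
      + exists (U :: lU). split.
        * intros U' [<-|HI]; auto.
        * intros t' w [<-|HI] Hw Kw; [exists U; split; [left; reflexivity | auto]|].
          destruct (B t' w HI Hw Kw) as [U' [I1 I2]]. exists U'. split; [right|]; assumption.
      + exists lU. split; [exact A|]. intros t' w [<-|HI] Hw Kw; [elim (HnK w Hw Kw) | eauto]. }
  destruct (NNPP _ (compactness_list 2 (- R0, (- R0, tt)) (R0, (R0, tt)) delta)) as [l Hl].
  destruct (Sel l) as [lU [A B]]. exists lU. split; [exact A|].
  intros z Kz.
  assert (Hz := HK z Kz). assert (Hx := fst_le_Cmod z). assert (Hy := snd_le_Cmod z).
  destruct (Hl (fst z, (snd z, tt))) as [t [It [_ Ct]]].
  { assert (A1 : - R0 <= fst z <= R0) by (apply Rabs_le_between; lra).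
    assert (A2 : - R0 <= snd z <= R0) by (apply Rabs_le_between; lra).
    simpl. tauto. }
  apply (B t z It); [|exact Kz]. destruct t as [t1 [t2 []]]. simpl in Ct. unfold near. simpl. tauto.
Qed.

Lemma list_max_exists {A : Type} (f : A -> R) (l : list A) a : In a l ->
  exists b, In b l /\ forall x, In x l -> f x <= f b.
Proof.
  revert a. induction l as [|x l IH]; intros a; [intros []|]. intros _.
  destruct l as [|y l].
  - exists x. split; [left; reflexivity|]. intros z [<-|[]]. lra.
  - destruct (IH y ltac:(left; reflexivity)) as [b [Ib Hb]].
    destruct (Rle_dec (f x) (f b)) as [L|L].
    + exists b. split; [right; exact Ib|]. intros z [<-|Hz]; auto.
    + exists x. split; [left; reflexivity|]. intros z [<-|Hz]; [lra|]. specialize (Hb z Hz). lra.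
Qed.

(** Without a maximum the sublevel sets f v < f w, with w in X, would cover X; in a finite subcover
    the w of largest value is not covered. Openness of sublevel sets is upper semicontinuity. *)
Lemma compact_max (X : C -> Prop) (f : C -> R) : C_compact X ->
  (forall c, C_open (fun w => f w < c)) -> (exists z, X z) ->
  exists z, X z /\ forall w, X w -> f w <= f z.
Proof.
  intros Hc Ho [z0 Hz0]. apply NNPP. intros Hn.
  assert (Up : forall z, X z -> exists w, X w /\ f z < f w).
  { intros z Xz. apply NNPP. intros Hw. apply Hn. exists z. split; [exact Xz|].
    intros w Xw. apply Rnot_lt_le. intros L. apply Hw. exists w. tauto. }
  destruct (Hc (fun U => exists w, X w /\ U = (fun v => f v < f w))) as [l [Hl Hcov]].
  - intros U [w [_ ->]]. apply Ho.
  - intros z Xz. destruct (Up z Xz) as [w [Xw L]]. exists (fun v => f v < f w). eauto.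
  - assert (Pts : exists lw : list C, (forall w, In w lw -> X w) /\
      forall z, X z -> exists w, In w lw /\ f z < f w).
    { assert (G : forall l : list (C -> Prop),
        (forall U, In U l -> exists w, X w /\ U = (fun v => f v < f w)) ->
        exists lw : list C, (forall w, In w lw -> X w) /\
        forall U z, In U l -> U z -> exists w, In w lw /\ f z < f w).
      { clear. induction l as [|U l IH]; intros Hl.
        - exists nil. split; [intros w [] | intros U z []].
        - destruct (IH (fun V HV => Hl V (or_intror HV))) as [lw [A B]].
          destruct (Hl U (or_introl eq_refl)) as [w [Xw ->]].
          exists (w :: lw). split; [intros v [<-|Hv]; auto|].
          intros V z [<-|HV] Vz; [exists w; split; [left; reflexivity | exact Vz]|].
          destruct (B V z HV Vz) as [v [I1 I2]]. exists v. split; [right|]; assumption. }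
      destruct (G l Hl) as [lw [A B]]. exists lw. split; [exact A|].
      intros z Xz. destruct (Hcov z Xz) as [U [IU Uz]]. eauto. }
    destruct Pts as [lw [A B]].
    destruct (B z0 Hz0) as [w0 [Iw0 _]].
    destruct (list_max_exists f lw w0 Iw0) as [b [Ib Hb]].
    destruct (B b (A b Ib)) as [w [Iw L]]. specialize (Hb w Iw). lra.
Qed.

Lemma peval_lipschitz_at p z : exists B, 0 <= B /\
  forall w, Cmod (w - z) <= 1 -> Cmod (peval p w - peval p z) <= B * Cmod (w - z).
Proof.
  induction p as [|a p [B [HB IH]]].
  - exists 0. split; [lra|]. intros w _. simpl.
    replace (0 - 0)%C with (RtoC 0) by ring. rewrite Cmod_0. lra.
  - exists ((Cmod z + 1) * B + Cmod (peval p z)).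
    assert (P1 := Cmod_ge_0 z). assert (P2 := Cmod_ge_0 (peval p z)).
    split; [nra|]. intros w Hw. simpl.
    replace (a + w * peval p w - (a + z * peval p z))%C
      with (w * (peval p w - peval p z) + peval p z * (w - z))%C by ring.
    eapply Rle_trans; [apply Cmod_triangle|]. rewrite !Cmod_mult.
    specialize (IH w Hw).
    assert (W : Cmod w <= Cmod z + 1).
    { assert (T := Cmod_triangle_inv w z). lra. }
    assert (Q : Cmod w * Cmod (peval p w - peval p z) <= (Cmod z + 1) * (B * Cmod (w - z)))
      by (apply Rmult_le_compat; auto using Cmod_ge_0).
    lra.
Qed.

(* Strictly subharmonic for eta > 0. *)
Definition bump p (eta : R) (z : C) : R :=
  Cmod (peval p z) * Cmod (peval p z) + eta * (Cmod z * Cmod z).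

Lemma bump_open p eta c : 0 <= eta -> C_open (fun w => bump p eta w < c).
Proof.
  intros He z Hz. destruct (peval_lipschitz_at p z) as [B [HB HL]].
  set (a := Cmod (peval p z)) in *. set (b := Cmod z).
  assert (Pa : 0 <= a) by apply Cmod_ge_0. assert (Pb : 0 <= b) by apply Cmod_ge_0.
  set (M := B * (2 * a + B) + eta * (2 * b + 1)).
  assert (PM : 0 <= M) by (unfold M; apply Rplus_le_le_0_compat; apply Rmult_le_pos; lra).
  set (gap := c - bump p eta z).
  assert (Pg : 0 < gap) by (unfold gap; lra).
  exists (Rmin 1 (gap / (M + 1))).
  assert (Pq : 0 < gap / (M + 1)) by (apply Rdiv_lt_0_compat; lra).
  split; [apply Rmin_pos; lra|]. intros w Hw. rewrite Cdist_Cmod in Hw.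
  assert (W1 : Cmod (w - z) < 1) by (eapply Rlt_le_trans; [exact Hw | apply Rmin_l]).
  assert (W2 : Cmod (w - z) < gap / (M + 1)) by (eapply Rlt_le_trans; [exact Hw | apply Rmin_r]).
  specialize (HL w ltac:(lra)).
  assert (Pd := Cmod_ge_0 (w - z)). set (d := Cmod (w - z)) in *.
  assert (A1 : Cmod (peval p w) <= a + B * d).
  { assert (T := Cmod_triangle_inv (peval p w) (peval p z)). fold a in T. lra. }
  assert (A2 : Cmod w <= b + d).
  { assert (T := Cmod_triangle_inv w z). fold b d in T. lra. }
  assert (S1 : Cmod (peval p w) * Cmod (peval p w) <= (a + B * d) * (a + B * d))
    by (apply Rmult_le_compat; auto using Cmod_ge_0).
  assert (S2 : Cmod w * Cmod w <= (b + d) * (b + d))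
    by (apply Rmult_le_compat; auto using Cmod_ge_0).
  assert (S3 : eta * (Cmod w * Cmod w) <= eta * ((b + d) * (b + d))) by (apply Rmult_le_compat_l; assumption).
  assert (E : M * d < gap).
  { apply Rle_lt_trans with (M * (gap / (M + 1))); [apply Rmult_le_compat_l; lra|].
    replace gap with ((M + 1) * (gap / (M + 1))) at 2 by (field; lra). nra. }
  assert (Dd : d * d <= d) by nra.
  assert (S4 : B * B * (d * d) <= B * B * d) by (apply Rmult_le_compat_l; nra).
  assert (S5 : eta * (d * d) <= eta * d) by (apply Rmult_le_compat_l; lra).
  unfold gap, bump, M in *. fold a b in E. unfold bump. nra.
Qed.

(** * Averages of polynomials over roots of unity *)

Lemma csum_plus f g n : csum (fun k => (f k + g k)%C) n = (csum f n + csum g n)%C.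
Proof. induction n as [|n IH]; simpl; [ring | rewrite IH; ring]. Qed.

Lemma csum_scal (a : C) f n : csum (fun k => (a * f k)%C) n = (a * csum f n)%C.
Proof. induction n as [|n IH]; simpl; [ring | rewrite IH; ring]. Qed.

Lemma csum_const (a : C) n : csum (fun _ => a) n = (RtoC (INR n) * a)%C.
Proof.
  induction n as [|n IH]; [simpl; ring|]. rewrite S_INR, RtoC_plus. simpl. rewrite IH. ring.
Qed.

Lemma csum_ext f g n : (forall k, f k = g k) -> csum f n = csum g n.
Proof. intros E. induction n as [|n IH]; simpl; [reflexivity | rewrite IH, E; reflexivity]. Qed.

Lemma csum_conj f n : csum (fun k => Cconj (f k)) n = Cconj (csum f n).
Proof.
  induction n as [|n IH]; simpl.
  - symmetry. apply Cconj_RtoC.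
  - rewrite IH, Cplus_conj. reflexivity.
Qed.

Lemma fst_csum f n : fst (csum f n) = rsum (fun k => fst (f k)) n.
Proof. induction n as [|n IH]; simpl; [reflexivity | rewrite IH; reflexivity]. Qed.

Definition unit_root (n : nat) : C := (cos (2 * PI / INR n), sin (2 * PI / INR n)).

Lemma unit_root_pow n k : (unit_root n ^ k)%C = (cos (INR k * (2 * PI / INR n)), sin (INR k * (2 * PI / INR n))).
Proof.
  induction k as [|k IH].
  - simpl. rewrite Rmult_0_l, cos_0, sin_0. reflexivity.
  - change (unit_root n ^ S k)%C with (unit_root n * unit_root n ^ k)%C. rewrite IH, S_INR.
    replace ((INR k + 1) * (2 * PI / INR n)) with (2 * PI / INR n + INR k * (2 * PI / INR n)) by ring.
    rewrite cos_plus, sin_plus. unfold unit_root, Cmult. simpl. f_equal; ring.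
Qed.

Lemma Cmod_unit_root_pow n k : Cmod (unit_root n ^ k) = 1.
Proof.
  rewrite unit_root_pow. unfold Cmod. simpl.
  assert (T := sin2_cos2 (INR k * (2 * PI / INR n))). unfold Rsqr in T.
  transitivity (sqrt 1); [f_equal; lra | apply sqrt_1].
Qed.

Lemma unit_root_conj n k : (Cconj (unit_root n ^ k) * unit_root n ^ k)%C = RtoC 1.
Proof.
  rewrite Cmult_comm, <- Cmod2_conj, Cmod_unit_root_pow. f_equal. ring.
Qed.

Lemma csum_geometric (q : C) n : (csum (fun k => q ^ k) n * (1 - q))%C = (1 - q ^ n)%C.
Proof. induction n as [|n IH]; simpl; [ring|]. rewrite Cmult_plus_distr_r, IH. simpl. ring. Qed.

Lemma Cpow_mult_swap (z : C) j k : ((z ^ j) ^ k)%C = ((z ^ k) ^ j)%C.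
Proof. rewrite <- !Cpow_mult_r. f_equal. lia. Qed.

Lemma unit_root_sum n j : (0 < j < n)%nat -> csum (fun k => ((unit_root n ^ k) ^ j)%C) n = RtoC 0.
Proof.
  intros Hj. set (q := (unit_root n ^ j)%C).
  rewrite (csum_ext _ (fun k => (q ^ k)%C)) by (intros k; apply Cpow_mult_swap).
  assert (Pn : 0 < INR n) by (apply lt_0_INR; lia).
  assert (Qn : (q ^ n)%C = RtoC 1).
  { unfold q. rewrite Cpow_mult_swap.
    replace (unit_root n ^ n)%C with (RtoC 1).
    - clear. induction j as [|j IH]; simpl; [reflexivity | rewrite IH; ring].
    - rewrite unit_root_pow. replace (INR n * (2 * PI / INR n)) with (2 * PI) by (field; lra).
      rewrite cos_2PI, sin_2PI. reflexivity. }
  assert (Q1 : (1 - q)%C <> RtoC 0).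
  { intros E. assert (E' := f_equal fst E). unfold q in E'. rewrite unit_root_pow in E'. simpl in E'.
    set (th := INR j * (PI / INR n)).
    replace (INR j * (2 * PI / INR n)) with (2 * th) in E' by (unfold th; field; lra).
    rewrite cos_2a_sin in E'.
    assert (Pj : 0 < INR j) by (apply lt_0_INR; lia).
    assert (Pjn : INR j < INR n) by (apply lt_INR; lia).
    assert (S : 0 < sin th).
    { assert (PP := PI_RGT_0). apply sin_gt_0; unfold th.
      - apply Rmult_lt_0_compat; [exact Pj | apply Rdiv_lt_0_compat; lra].
      - replace PI with (INR n * (PI / INR n)) at 2 by (field; lra).
        apply Rmult_lt_compat_r; [apply Rdiv_lt_0_compat; lra | exact Pjn]. }
    nra. }
  assert (G := csum_geometric q n). rewrite Qn in G.
  replace (1 - 1)%C with (RtoC 0) in G by ring.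
  apply NNPP. intros Hs. exact (Cmult_neq_0 _ _ Hs Q1 G).
Qed.

Section CircleAverages.
Context (z0 : C) (r : R) (n : nat).

Definition circle_point (k : nat) : C := (z0 + RtoC r * unit_root n ^ k)%C.

(** On a circle a polynomial has Fourier terms on one side only. The discrete mean is exact since j
    + length p <= n excludes aliasing; the induction trades a coefficient for a power of the
    root. *)
Lemma circle_moment_pos p j : (0 < j)%nat -> (j + length p <= n)%nat ->
  csum (fun k => (peval p (circle_point k) * (unit_root n ^ k) ^ j)%C) n = RtoC 0.
Proof.
  revert j. induction p as [|a p IH]; intros j Hj Hl; simpl in *.
  - rewrite (csum_ext _ (fun _ => RtoC 0)) by (intros; ring). rewrite csum_const. ring.
  - rewrite (csum_ext _ (fun k => (a * (unit_root n ^ k) ^ j +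
      (z0 * (peval p (circle_point k) * (unit_root n ^ k) ^ j) +
       RtoC r * (peval p (circle_point k) * (unit_root n ^ k) ^ (S j))))%C)).
    2:{ intros k. unfold circle_point at 1. simpl. ring. }
    rewrite !csum_plus, !csum_scal, unit_root_sum, !IH by lia. ring.
Qed.

Lemma circle_average p : (length p <= n)%nat ->
  csum (fun k => peval p (circle_point k)) n = (RtoC (INR n) * peval p z0)%C.
Proof.
  induction p as [|a p IH]; intros Hl; simpl in *.
  - rewrite csum_const. ring.
  - rewrite (csum_ext _ (fun k => (a + (z0 * peval p (circle_point k) +
       RtoC r * (peval p (circle_point k) * (unit_root n ^ k) ^ 1)))%C)).
    2:{ intros k. unfold circle_point at 1. simpl. ring. }
    rewrite !csum_plus, !csum_scal, csum_const, circle_moment_pos, IH by lia. ring.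
Qed.

Fixpoint pderiv (p : list C) (z : C) : C :=
  match p with
  | nil => RtoC 0
  | c :: p' => (peval p' z + z * pderiv p' z)%C
  end.

(** The first Taylor coefficient at z0, read off as a Fourier coefficient; the constant term
    averages to zero once n >= 2. *)
Lemma circle_moment_neg p : (2 <= n)%nat -> (length p <= n)%nat ->
  csum (fun k => (peval p (circle_point k) * Cconj (unit_root n ^ k))%C) n
    = (RtoC (INR n) * (RtoC r * pderiv p z0))%C.
Proof.
  intros Hn. induction p as [|a p IH]; intros Hl; simpl in *.
  - rewrite (csum_ext _ (fun _ => RtoC 0)) by (intros; ring). rewrite csum_const. ring.
  - rewrite (csum_ext _ (fun k => (a * Cconj ((unit_root n ^ k) ^ 1) +
      (z0 * (peval p (circle_point k) * Cconj (unit_root n ^ k)) +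
       RtoC r * peval p (circle_point k)))%C)).
    2:{ intros k. replace ((unit_root n ^ k) ^ 1)%C with (unit_root n ^ k)%C by (simpl; ring).
        unfold circle_point at 1.
        replace ((a + (z0 + RtoC r * unit_root n ^ k) * peval p (circle_point k)) * Cconj (unit_root n ^ k))%C
          with (a * Cconj (unit_root n ^ k) + z0 * (peval p (circle_point k) * Cconj (unit_root n ^ k))
            + RtoC r * peval p (circle_point k) * (Cconj (unit_root n ^ k) * unit_root n ^ k))%C by ring.
        rewrite unit_root_conj. ring. }
    rewrite !csum_plus, !csum_scal, csum_conj, unit_root_sum, circle_average, IH by lia.
    rewrite Cconj_RtoC. ring.
Qed.

End CircleAverages.

Lemma Cmod_sq_expand (a b : C) :
  Cmod a * Cmod a = Cmod b * Cmod b + 2 * fst (Cconj b * (a - b))%C + Cmod (a - b) * Cmod (a - b).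
Proof. rewrite !Cmod_sq. destruct a, b. simpl. ring. Qed.

(** |p(w)|^2 - |p(z)|^2 is a term linear in p(w) - p(z), which averages to zero over the circle,
    plus a square; the same expansion of eta |w|^2 adds eta r^2. The mean over the circle thus
    exceeds the value at the centre. *)
Lemma bump_no_local_max p eta z r : 0 < eta -> 0 < r ->
  exists w, Cmod (w - z) = r /\ bump p eta z < bump p eta w.
Proof.
  intros He Hr. apply NNPP. intros Hn.
  set (n := Datatypes.S (Datatypes.S (length p))).
  assert (Pn : 0 < INR n) by (apply lt_0_INR; unfold n; lia).
  assert (Cd : forall k, Cmod (circle_point z r n k - z) = r).
  { intros k. unfold circle_point. replace (z + RtoC r * unit_root n ^ k - z)%C
      with (RtoC r * unit_root n ^ k)%C by ring.
    rewrite Cmod_mult, Cmod_unit_root_pow, Cmod_R, Rabs_pos_eq by lra. ring. }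
  assert (A0 := circle_average z r n p ltac:(unfold n; lia)).
  assert (A1 := circle_average z r n (RtoC 0 :: RtoC 1 :: nil) ltac:(unfold n; simpl; lia)).
  set (g := fun k => (RtoC 2 * Cconj (peval p z) * (peval p (circle_point z r n k) - peval p z) +
     RtoC (2 * eta) * Cconj z * (peval (RtoC 0 :: RtoC 1 :: nil) (circle_point z r n k) - z))%C).
  assert (G : csum g n = RtoC 0).
  { unfold g. rewrite csum_plus, !csum_scal.
    rewrite (csum_ext (fun k => (peval p (circle_point z r n k) - peval p z)%C)
      (fun k => (peval p (circle_point z r n k) + (- peval p z))%C)) by (intros; ring).
    rewrite (csum_ext (fun k => (peval (RtoC 0 :: RtoC 1 :: nil) (circle_point z r n k) - z)%C)
      (fun k => (peval (RtoC 0 :: RtoC 1 :: nil) (circle_point z r n k) + (- z))%C)) by (intros; ring).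
    rewrite !csum_plus, !csum_const, A0, A1. simpl. ring. }
  assert (L : rsum (fun k => eta * (r * r) + 1 * fst (g k)) n <= rsum (fun _ => 0 + 0 * 0) n).
  { apply rsum_le. intros k _.
    assert (B : bump p eta (circle_point z r n k) <= bump p eta z).
    { apply Rnot_lt_le. intros L. apply Hn. exists (circle_point z r n k). split; [apply Cd | exact L]. }
    unfold bump in B.
    rewrite (Cmod_sq_expand (peval p (circle_point z r n k)) (peval p z)),
      (Cmod_sq_expand (circle_point z r n k) z), Cd in B.
    assert (P := Rle_0_sqr (Cmod (peval p (circle_point z r n k) - peval p z))). unfold Rsqr in P.
    unfold g. set (w := circle_point z r n k) in *. clearbody w.
    assert (Ew : peval (RtoC 0 :: RtoC 1 :: nil) w = w) by (simpl; ring). rewrite Ew.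
    destruct (peval p w), (peval p z), w, z. simpl in *. nra. }
  rewrite (rsum_affine _ _ (fun k => fst (g k))), (rsum_affine 0 0 (fun _ => 0)), <- fst_csum, G in L.
  simpl fst in L. assert (0 < INR n * (eta * (r * r))) by (repeat apply Rmult_lt_0_compat; lra). lra.
Qed.

(** The maximum of [bump] over X cannot lie in V, so the hypothesis on X minus V bounds it; then eta
    tends to 0. Taking eta > 0 covers the case of a locally constant p. *)
Lemma max_modulus (X V : C -> Prop) RX p M : C_compact X -> bounded_by X RX ->
  (forall z, V z -> exists r, 0 < r /\ forall w, Cmod (w - z) < r -> X w) ->
  0 <= M -> (forall z, X z -> ~ V z -> Cmod (peval p z) <= M) ->
  forall z, X z -> Cmod (peval p z) <= M.
Proof.
  intros Hc HX HV PM HM z Xz.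
  assert (Main : forall eta, 0 < eta -> Cmod (peval p z) * Cmod (peval p z) <= M * M + eta * (RX * RX)).
  { intros eta He.
    destruct (compact_max X (bump p eta) Hc) as [m [Xm Hm]].
    { intros c. apply bump_open. lra. }
    { exists z. exact Xz. }
    assert (Vm : ~ V m).
    { intros Vm. destruct (HV m Vm) as [r [Hr Hd]].
      destruct (bump_no_local_max p eta m (r / 2) He ltac:(lra)) as [w [Hw L]].
      assert (Xw : X w) by (apply Hd; lra). specialize (Hm w Xw). lra. }
    specialize (Hm z Xz). specialize (HM m Xm Vm). unfold bump in Hm.
    assert (P := HX m Xm). assert (P0 := Cmod_ge_0 m). assert (P1 := Cmod_ge_0 (peval p m)).
    assert (P2 := Rle_0_sqr (Cmod z)). unfold Rsqr in P2.
    assert (Cmod (peval p m) * Cmod (peval p m) <= M * M) by (apply Rmult_le_compat; assumption).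
    assert (Cmod m * Cmod m <= RX * RX) by (apply Rmult_le_compat; assumption).
    nra. }
  apply Rsqr_incr_0_var; [|exact PM]. unfold Rsqr.
  apply le_epsilon. intros eps He.
  destruct (exists_small_factor (RX * RX) eps He) as [d [Pd Hd]].
  specialize (Main d Pd). lra.
Qed.

(* The function M - Re (gamma p) is nonnegative on the circle; its first Fourier
   coefficient is therefore dominated by its mean. *)
Lemma disc_derivative_bound p z0 r M : 0 < r ->
  (forall w, Cmod (w - z0) <= r -> Cmod (peval p w) <= M) ->
  r * Cmod (pderiv p z0) <= 2 * (M - Cmod (peval p z0)).
Proof.
  intros Hr HM.
  set (n := Datatypes.S (Datatypes.S (length p))).
  assert (Pn : 0 < INR n) by (apply lt_0_INR; unfold n; lia).
  set (c := circle_point z0 r n).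
  assert (Cd : forall k, Cmod (peval p (c k)) <= M).
  { intros k. apply HM. unfold c, circle_point. replace (z0 + RtoC r * unit_root n ^ k - z0)%C
      with (RtoC r * unit_root n ^ k)%C by ring.
    rewrite Cmod_mult, Cmod_unit_root_pow, Cmod_R, Rabs_pos_eq by lra. lra. }
  (* gam rotates p(z0) onto the nonnegative axis, so that the mean of u is M - |p(z0)|. *)
  assert (Ga : exists gam : C, Cmod gam = 1 /\ (gam * peval p z0)%C = RtoC (Cmod (peval p z0))).
  { destruct (Req_dec (Cmod (peval p z0)) 0) as [E|E].
    - exists (RtoC 1). split; [apply Cmod_1|]. rewrite (Cmod_eq_0 _ E), Cmod_0. ring.
    - assert (N : RtoC (Cmod (peval p z0)) <> RtoC 0) by (intros E'; apply E; apply RtoC_inj; exact E').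
      exists (Cconj (peval p z0) / RtoC (Cmod (peval p z0)))%C. split.
      + rewrite Cmod_div, Cmod_conj, Cmod_R, Rabs_pos_eq by (auto using Cmod_ge_0). field. exact E.
      + replace (Cconj (peval p z0) / RtoC (Cmod (peval p z0)) * peval p z0)%C
          with (peval p z0 * Cconj (peval p z0) / RtoC (Cmod (peval p z0)))%C by (field; exact N).
        rewrite <- Cmod2_conj. simpl. rewrite Rmult_1_r, RtoC_mult. field. exact N. }
  destruct Ga as [gam [G1 G2]].
  set (u := fun k => M - fst (gam * peval p (c k))%C).
  assert (Pu : forall k, 0 <= u k).
  { intros k. unfold u. assert (T := fst_le_Cmod (gam * peval p (c k))). rewrite Cmod_mult, G1 in T.
    assert (T2 := Rle_abs (fst (gam * peval p (c k))%C)). specialize (Cd k). lra. }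
  assert (S0 : rsum u n = INR n * (M - Cmod (peval p z0))).
  { assert (A0 := circle_average z0 r n p ltac:(unfold n; lia)). fold c in A0.
    assert (E : rsum u n = rsum (fun k => M + (-1) * fst (gam * peval p (c k))%C) n).
    { apply Rle_antisym; apply rsum_le; intros; unfold u; lra. }
    rewrite E, (rsum_affine M (-1) (fun k => fst (gam * peval p (c k))%C)), <- fst_csum, csum_scal, A0.
    replace (gam * (RtoC (INR n) * peval p z0))%C with (RtoC (INR n) * (gam * peval p z0))%C by ring.
    rewrite G2. simpl. ring. }
  (* Re (gam p) is half of gam p plus half its conjugate. The constant M and the conjugate half
     average to zero against the conjugate root; the remaining half is the source of the factor
     2. *)
  assert (S1 : csum (fun k => (RtoC (u k) * Cconj (unit_root n ^ k))%C) n =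
    (RtoC (- / 2) * gam * (RtoC (INR n) * (RtoC r * pderiv p z0)))%C).
  { assert (A1 := circle_moment_neg z0 r n p ltac:(unfold n; lia) ltac:(unfold n; lia)).
    assert (A2 := circle_moment_pos z0 r n p 1 ltac:(lia) ltac:(unfold n; lia)).
    fold c in A1, A2.
    rewrite (csum_ext _ (fun k => (RtoC M * Cconj ((unit_root n ^ k) ^ 1) +
      ((RtoC (- / 2) * gam) * (peval p (c k) * Cconj (unit_root n ^ k)) +
       RtoC (- / 2) * Cconj (gam * (peval p (c k) * (unit_root n ^ k) ^ 1))))%C)).
    2:{ intros k. unfold u. replace ((unit_root n ^ k) ^ 1)%C with (unit_root n ^ k)%C by (simpl; ring).
        destruct (unit_root n ^ k)%C as [a b], (peval p (c k)) as [x y], gam as [s t].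
        apply injective_projections; simpl; field. }
    rewrite !csum_plus, !csum_scal, !csum_conj, csum_scal, A1, A2, unit_root_sum by (unfold n; lia).
    replace (gam * 0)%C with (RtoC 0) by ring.
    rewrite Cconj_RtoC.
    ring. }
  assert (L := csum_mod_le (fun k => (RtoC (u k) * Cconj (unit_root n ^ k))%C) n).
  rewrite S1, !Cmod_mult, !Cmod_R, G1, (Rabs_left (- / 2)), (Rabs_pos_eq (INR n)), (Rabs_pos_eq r) in L by lra.
  assert (L2 : rsum (fun k => Cmod (RtoC (u k) * Cconj (unit_root n ^ k))) n <= rsum u n).
  { apply rsum_le. intros k _. rewrite Cmod_mult, Cmod_conj, Cmod_unit_root_pow, Cmod_R, Rabs_pos_eq by apply Pu.
    lra. }
  rewrite S0 in L2.
  apply Rmult_le_reg_l with (INR n); [exact Pn|]. lra.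
Qed.

(** * Discs in the polynomially convex hull of a non-Lavrentieff set *)

Section Hull.
Context (K : C -> Prop) (R0 : R) (HK : bounded_by K R0) (HR0 : 0 < R0).
Context (Hclosed : forall a, ~ K a -> exists d, 0 < d /\ forall z, K z -> d <= Cmod (z - a)).

Definition separated (U V : C -> Prop) : Prop :=
  C_open U /\ C_open V /\ (forall z, ~ K z -> U z \/ V z) /\ (forall z, ~ K z -> U z -> V z -> False).

Lemma segment_same_side U V z1 z2 : separated U V ->
  (forall t, 0 <= t <= 1 -> ~ K (z1 + RtoC t * (z2 - z1))%C) -> U z1 -> U z2.
Proof.
  intros [Uo [Vo [Cov Dis]]] Hs U1.
  set (g := fun t : R => (z1 + RtoC t * (z2 - z1))%C) in *.
  assert (Close : forall W t, C_open W -> W (g t) -> exists d, 0 < d /\ forall s, Rabs (s - t) < d -> W (g s)).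
  { intros W t Wo Wt. destruct (Wo (g t) Wt) as [e [He HW]].
    assert (P := Cmod_ge_0 (z2 - z1)).
    exists (e / (Cmod (z2 - z1) + 1)). split; [apply Rdiv_lt_0_compat; lra|].
    intros s Hst. apply HW. rewrite Cdist_Cmod. unfold g.
    replace (z1 + RtoC s * (z2 - z1) - (z1 + RtoC t * (z2 - z1)))%C
      with (RtoC (s - t) * (z2 - z1))%C by (rewrite RtoC_minus; ring).
    rewrite Cmod_mult, Cmod_R.
    apply Rle_lt_trans with (Rabs (s - t) * (Cmod (z2 - z1) + 1)).
    - apply Rmult_le_compat_l; [apply Rabs_pos | lra].
    - apply Rlt_le_trans with (e / (Cmod (z2 - z1) + 1) * (Cmod (z2 - z1) + 1)).
      + apply Rmult_lt_compat_r; lra.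
      + apply Req_le. field. lra. }
  set (E := fun t => 0 <= t <= 1 /\ forall s, 0 <= s <= t -> U (g s)).
  assert (E0 : E 0).
  { split; [lra|]. intros s Hs'. replace s with 0 by lra. unfold g.
    replace (z1 + 0 * (z2 - z1))%C with z1 by ring. exact U1. }
  destruct (completeness E) as [m [Hm1 Hm2]].
  { exists 1. intros t [Ht _]. lra. }
  { exists 0. exact E0. }
  assert (M0 : 0 <= m) by (apply Hm1, E0).
  assert (M1 : m <= 1) by (apply Hm2; intros t [Ht _]; lra).
  assert (Near : forall d, 0 < d -> exists t, E t /\ m - d < t <= m).
  { intros d Hd. apply NNPP. intros Hn. assert (m <= m - d); [|lra].
    apply Hm2. intros t Et. apply Rnot_lt_le. intros L. apply Hn. exists t.
    split; [exact Et|]. split; [exact L | apply Hm1, Et]. }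
  destruct (Cov (g m) (Hs m ltac:(lra))) as [Um|Vm].
  - destruct (Close U m Uo Um) as [d [Hd HU]].
    destruct (Near d Hd) as [t [[Ht Et] Htm]].
    assert (Ext : E (Rmin 1 (m + d / 2))).
    { assert (A1 := Rmin_l 1 (m + d / 2)). assert (A2 := Rmin_r 1 (m + d / 2)).
      split; [split; [apply Rmin_glb; lra | exact A1]|].
      intros s Hs'. destruct (Rle_dec s t) as [L|L]; [apply Et; lra|].
      apply HU. apply Rabs_def1; lra. }
    assert (B := Hm1 _ Ext).
    assert (Em : m = 1).
    { unfold Rmin in B. destruct (Rle_dec 1 (m + d / 2)); lra. }
    subst m. unfold g in Um. replace (z1 + 1 * (z2 - z1))%C with z2 in Um by ring. exact Um.
  - exfalso. destruct (Close V m Vo Vm) as [d [Hd HV]].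
    destruct (Near d Hd) as [t [[Ht Et] Htm]].
    apply (Dis (g t)).
    + apply Hs. lra.
    + apply Et. lra.
    + apply HV. apply Rabs_def1; lra.
Qed.

Lemma outside_box z : R0 < fst z \/ R0 < snd z \/ fst z < - R0 \/ snd z < - R0 -> ~ K z.
Proof.
  intros Hz Kz. assert (A := HK z Kz). assert (B := fst_le_Cmod z). assert (D := snd_le_Cmod z).
  assert (T1 := Rle_abs (fst z)). assert (T2 := Rle_abs (- fst z)). rewrite Rabs_Ropp in T2.
  assert (T3 := Rle_abs (snd z)). assert (T4 := Rle_abs (- snd z)). rewrite Rabs_Ropp in T4. lra.
Qed.

(** The outside of the square is a union of four half-planes, each convex and disjoint from K; the
    left and lower ones are reached from (R0 + 1, R0 + 1) through a neighbouring corner. *)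
Lemma outside_box_same_side U V z : separated U V -> U (R0 + 1, R0 + 1) ->
  R0 < fst z \/ R0 < snd z \/ fst z < - R0 \/ snd z < - R0 -> U z.
Proof.
  intros HS U0 Hz.
  assert (Seg : forall z1 z2 : C,
    (R0 < fst z1 /\ R0 < fst z2) \/ (R0 < snd z1 /\ R0 < snd z2) \/
    (fst z1 < - R0 /\ fst z2 < - R0) \/ (snd z1 < - R0 /\ snd z2 < - R0) -> U z1 -> U z2).
  { intros z1 z2 H12. apply (segment_same_side U V z1 z2 HS). intros t Ht.
    assert (Cvx : forall a b, R0 < a -> R0 < b -> R0 < a + t * (b - a))
      by (intros a b Ha Hb; destruct (Rle_dec a b); nra).
    apply outside_box. destruct z1 as [a b], z2 as [a' b']. simpl in *.
    destruct H12 as [[A B]|[[A B]|[[A B]|[A B]]]].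
    - assert (T := Cvx a a' A B). lra.
    - assert (T := Cvx b b' A B). lra.
    - assert (T := Cvx (- a) (- a') ltac:(lra) ltac:(lra)). lra.
    - assert (T := Cvx (- b) (- b') ltac:(lra) ltac:(lra)). lra. }
  destruct Hz as [Hz|[Hz|[Hz|Hz]]].
  - apply (Seg (R0 + 1, R0 + 1)); [|exact U0]. simpl. lra.
  - apply (Seg (R0 + 1, R0 + 1)); [|exact U0]. simpl. lra.
  - apply (Seg (- R0 - 1, R0 + 1)); [simpl; lra|].
    apply (Seg (R0 + 1, R0 + 1)); [|exact U0]. simpl. lra.
  - apply (Seg (R0 + 1, - R0 - 1)); [simpl; lra|].
    apply (Seg (R0 + 1, R0 + 1)); [|exact U0]. simpl. lra.
Qed.

(** The closed disc lies in the polynomially convex hull of K. *)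
Definition hull_disc (z0 : C) (r : R) : Prop :=
  0 < r /\ forall p M, 0 <= M -> (forall z, K z -> Cmod (peval p z) <= M) ->
    forall w, Cmod (w - z0) <= r -> Cmod (peval p w) <= M.

(** U contains the outside of the square, so X, the union of K and V, is bounded. It is closed
    because its complement is the part of U off K, and X minus V lies in K, so the maximum principle
    applies. *)
Lemma hull_disc_of_separation U V : separated U V -> U (R0 + 1, R0 + 1) ->
  (exists z, ~ K z /\ V z) -> exists z0 r, hull_disc z0 r.
Proof.
  intros HS U0 [z0 [Kz0 Vz0]].
  assert (HS' := HS). destruct HS' as [Uo [Vo [Cov Dis]]].
  set (X := fun z => K z \/ V z).
  assert (Inside : forall z, ~ K z -> V z -> Cmod z <= 2 * R0).
  { intros z Kz Vz.
    assert (Hn : ~ (R0 < fst z \/ R0 < snd z \/ fst z < - R0 \/ snd z < - R0)).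
    { intros Hb. apply (Dis z Kz); [|exact Vz]. apply (outside_box_same_side U V); assumption. }
    assert (- R0 <= fst z <= R0 /\ - R0 <= snd z <= R0) as [A B].
    { repeat split; apply Rnot_lt_le; intros L; apply Hn; tauto. }
    apply Rabs_le in A. apply Rabs_le in B.
    assert (T := Cmod_le_abs z). lra. }
  assert (HX : bounded_by X (2 * R0)).
  { intros z Xz. destruct (classic (K z)) as [Kz|Kz].
    - specialize (HK z Kz). lra.
    - destruct Xz as [Kz'|Vz]; [contradiction | apply Inside; assumption]. }
  assert (Xc : C_compact X).
  { apply (closed_bounded_compact X (2 * R0) HX). intros a Xa.
    assert (Ka : ~ K a) by (intros Ka; apply Xa; left; exact Ka).
    destruct (Cov a Ka) as [Ua|Va]; [|elim Xa; right; exact Va].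
    destruct (Hclosed a Ka) as [d [Hd HdK]]. destruct (Uo a Ua) as [e [He HeU]].
    exists (Rmin d e). split; [apply Rmin_pos; assumption|].
    intros z Xz. apply Rnot_lt_le. intros L.
    assert (L1 : Cmod (z - a) < d) by (eapply Rlt_le_trans; [exact L | apply Rmin_l]).
    assert (L2 : Cmod (z - a) < e) by (eapply Rlt_le_trans; [exact L | apply Rmin_r]).
    assert (Kz : ~ K z) by (intros Kz; specialize (HdK z Kz); lra).
    destruct Xz as [Kz'|Vz]; [contradiction|].
    apply (Dis z Kz); [|exact Vz]. apply HeU. rewrite Cdist_Cmod. exact L2. }
  destruct (Vo z0 Vz0) as [e [He HeV]].
  exists z0, (e / 2). split; [lra|]. intros p M PM HM w Hw.
  apply (max_modulus X V (2 * R0) p M Xc HX); [| exact PM | |].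
  - intros z Vz. destruct (Vo z Vz) as [e' [He' HeV']]. exists e'. split; [exact He'|].
    intros v Hv. right. apply HeV'. rewrite Cdist_Cmod. exact Hv.
  - intros z [Kz|Vz] Hz; [apply HM, Kz | contradiction].
  - right. apply HeV. rewrite Cdist_Cmod. lra.
Qed.

Lemma hull_disc_exists : ~ lavrentieff K -> exists z0 r, hull_disc z0 r.
Proof.
  intros Hn.
  destruct (classic (C_empty_interior K)) as [Hi|Hi].
  - assert (Hcn : ~ C_connected (fun z => ~ K z)).
    { intros Hc. apply Hn. split; [exact (closed_bounded_compact K R0 HK Hclosed) | split; assumption]. }
    apply NNPP in Hcn. destruct Hcn as [U [V [Uo [Vo [Cov [EU [EV Dis]]]]]]].
    assert (HS : separated U V) by (repeat split; assumption).
    (* The side containing this corner is the unbounded one; the disc is found in the other. *)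
    destruct (Cov (R0 + 1, R0 + 1)) as [U0|V0].
    { apply outside_box. left. simpl. lra. }
    + apply (hull_disc_of_separation U V HS U0). exact EV.
    + apply (hull_disc_of_separation V U); [|exact V0|exact EU].
      repeat split; try assumption.
      * intros z Kz. destruct (Cov z Kz); tauto.
      * intros z Kz Vz Uz. exact (Dis z Kz Uz Vz).
  - apply NNPP in Hi. destruct Hi as [z0 [e [He HeK]]].
    exists z0, (e / 2). split; [lra|]. intros p M _ HM w Hw. apply HM, HeK. rewrite Cdist_Cmod. lra.
Qed.

End Hull.

(** * A unilateral shift *)

Section Shift.
Context {H : InnerProductSpace} (Hc : complete_space H).
Implicit Types (x y z : H).

Definition kron (i j : nat) : C := if Nat.eqb i j then RtoC 1 else RtoC 0.

Definition orthonormal (e : nat -> H) : Prop := forall i j, ip (e i) (e j) = kron i j.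

Lemma ip_lincomb_l n (a : nat -> C) (v : nat -> H) y :
  ip (lincomb n a v) y = csum (fun k => (a k * ip (v k) y)%C) n.
Proof.
  induction n as [|n IH]; simpl; [apply ip_zero_l|]. rewrite ip_add_l, ip_scal_l, IH. reflexivity.
Qed.

Lemma csum_kron n (a : nat -> C) j :
  csum (fun k => (a k * kron k j)%C) n = if Nat.ltb j n then a j else RtoC 0.
Proof.
  induction n as [|n IH]; simpl; [reflexivity|]. rewrite IH. unfold kron.
  destruct (Nat.ltb_spec j n), (Nat.ltb_spec j (S n)), (Nat.eqb_spec n j); subst; try lia; ring.
Qed.

Lemma orthonormal_extension n (e : nat -> H) : infinite_dimensional H ->
  (forall i j, (i < n)%nat -> (j < n)%nat -> ip (e i) (e j) = kron i j) ->
  exists x, ip x x = RtoC 1 /\ forall i, (i < n)%nat -> ip x (e i) = RtoC 0.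
Proof.
  intros Hinf He. destruct (Hinf n e) as [y Hy].
  set (a := fun k => ip y (e k)). set (x := y [-] lincomb n a e).
  assert (Ox : forall i, (i < n)%nat -> ip x (e i) = RtoC 0).
  { intros i Hi. unfold x. rewrite ip_sub_l, ip_lincomb_l.
    assert (G : forall m, (m <= n)%nat -> csum (fun k => (a k * ip (e k) (e i))%C) m
       = csum (fun k => (a k * kron k i)%C) m).
    { induction m as [|m IH]; intros Hm; simpl; [reflexivity|]. rewrite IH, He by lia. reflexivity. }
    rewrite G, csum_kron by lia. destruct (Nat.ltb_spec i n); [|lia]. unfold a. ring. }
  assert (Nx : 0 < vnorm x).
  { destruct (Rle_lt_or_eq_dec _ _ (vnorm_pos x)) as [L|L]; [exact L|]. exfalso. apply Hy.
    exists a. apply vsub_zero. apply vnorm_eq_0. symmetry. exact L. }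
  exists (RtoC (/ vnorm x) [*] x). split.
  - rewrite ip_scal_l, ip_scal_r, ip_self, <- vnorm_sq.
    apply injective_projections; simpl; field; lra.
  - intros i Hi. rewrite ip_scal_l, Ox by exact Hi. ring.
Qed.

Lemma orthonormal_sequence_exists : infinite_dimensional H -> exists e, orthonormal e.
Proof.
  intros Hinf.
  set (next := fun n (f : nat -> H) => epsilon (inhabits (vzero H))
    (fun x => ip x x = RtoC 1 /\ forall i, (i < n)%nat -> ip x (f i) = RtoC 0)).
  (* [P n] tabulates the first n vectors, so that the next choice can depend on all of them; its
     later entries are zero. *)
  set (P := fix P n : nat -> H := match n with
    | O => fun _ => vzero H
    | Datatypes.S m => fun k => if Nat.eqb k m then next m (P m) else P m k end).
  set (e := fun n => next n (P n)).
  assert (Pe : forall n k, (k < n)%nat -> P n k = e k).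
  { induction n as [|n IH]; intros k Hk; [lia|]. simpl.
    destruct (Nat.eqb_spec k n) as [E|E]; [subst; reflexivity | apply IH; lia]. }
  assert (Good : forall n i j, (i < n)%nat -> (j < n)%nat -> ip (e i) (e j) = kron i j).
  { induction n as [|n IH]; intros i j Hi Hj; [lia|].
    assert (En : ip (e n) (e n) = RtoC 1 /\ forall i, (i < n)%nat -> ip (e n) (P n i) = RtoC 0).
    { unfold e at 1 2 3. apply epsilon_spec. apply (orthonormal_extension n (P n) Hinf).
      intros a b Ha Hb. rewrite !Pe by assumption. apply IH; assumption. }
    destruct En as [E1 E2].
    assert (E3 : forall i, (i < n)%nat -> ip (e n) (e i) = RtoC 0).
    { intros k Hk. rewrite <- (Pe n k Hk). apply E2, Hk. }
    unfold kron. destruct (Nat.eqb_spec i j) as [E|E].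
    - subst j. destruct (Nat.eq_dec i n) as [->|Ne]; [exact E1|].
      assert (G := IH i i ltac:(lia) ltac:(lia)). unfold kron in G. rewrite Nat.eqb_refl in G. exact G.
    - destruct (Nat.eq_dec i n) as [->|Ni]; [apply E3; lia|].
      destruct (Nat.eq_dec j n) as [->|Nj].
      + rewrite ip_conj, E3 by lia. apply Cconj_RtoC.
      + assert (G := IH i j ltac:(lia) ltac:(lia)). unfold kron in G.
        destruct (Nat.eqb_spec i j); [contradiction | exact G]. }
  exists e. intros i j. apply (Good (Datatypes.S (i + j))); lia.
Qed.

Definition hlim (u : nat -> H) (l : H) : Prop :=
  forall eps, 0 < eps -> exists n0, forall n, (n0 <= n)%nat -> vnorm (u n [-] l) < eps.

(** Passes an adjoint relation from partial sums to limits; with a constant sequence on the right it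
    also computes coordinates. *)
Lemma hlim_ip u v l l' x y n0 : hlim u l -> hlim v l' ->
  (forall n, (n0 <= n)%nat -> ip (u n) y = ip x (v n)) -> ip l y = ip x l'.
Proof.
  intros Hu Hv E.
  assert (Px := vnorm_pos x). assert (Py := vnorm_pos y).
  assert (D : Cmod (ip l y - ip x l') <= 0).
  { apply le_epsilon. intros eps He. rewrite Rplus_0_l.
    set (d := eps / (vnorm x + vnorm y + 1)).
    assert (Pd : 0 < d) by (apply Rdiv_lt_0_compat; lra).
    destruct (Hu d Pd) as [n1 H1]. destruct (Hv d Pd) as [n2 H2].
    specialize (H1 (n0 + n1 + n2)%nat ltac:(lia)). specialize (H2 (n0 + n1 + n2)%nat ltac:(lia)).
    specialize (E (n0 + n1 + n2)%nat ltac:(lia)). set (n := (n0 + n1 + n2)%nat) in *.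
    replace (ip l y - ip x l')%C with (ip x (v n [-] l') - ip (u n [-] l) y)%C
      by (rewrite ip_sub_l, ip_sub_r, E; ring).
    eapply Rle_trans; [apply Cmod_triangle_sub|].
    assert (C1 := cauchy_schwarz x (v n [-] l')). assert (C2 := cauchy_schwarz (u n [-] l) y).
    assert (Ed : d * (vnorm x + vnorm y + 1) = eps) by (unfold d; field; lra).
    nra. }
  assert (Z : (ip l y - ip x l')%C = RtoC 0).
  { apply Cmod_eq_0. apply Rle_antisym; [exact D | apply Cmod_ge_0]. }
  replace (ip l y) with (ip l y - ip x l' + ip x l')%C by ring. rewrite Z. ring.
Qed.

Lemma hlim_const x : hlim (fun _ => x) x.
Proof.
  intros eps He. exists O. intros n _. replace (x [-] x) with (vzero H) by vring. rewrite vnorm_zero. exact He.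
Qed.

Lemma hlim_sub u v l l' : hlim u l -> hlim v l' -> hlim (fun n => u n [-] v n) (l [-] l').
Proof.
  intros Hu Hv eps He. destruct (Hu (eps / 2)) as [n1 H1]; [lra|]. destruct (Hv (eps / 2)) as [n2 H2]; [lra|].
  exists (n1 + n2)%nat. intros n Hn. specialize (H1 n ltac:(lia)). specialize (H2 n ltac:(lia)).
  replace (u n [-] v n [-] (l [-] l')) with ((u n [-] l) [-] (v n [-] l')) by vring.
  eapply Rle_lt_trans; [apply vnorm_triangle_sub|]. lra.
Qed.

Lemma hlim_shift u l : hlim u l -> hlim (fun n => u (Datatypes.S n)) l.
Proof.
  intros Hu eps He. destruct (Hu eps He) as [n0 Hn]. exists n0. intros n Hle. apply Hn. lia.
Qed.


Lemma hlim_unique u l l' : hlim u l -> hlim u l' -> l = l'.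
Proof.
  intros Hu Hv. apply vnorm_small_eq. intros eps He.
  destruct (Hu (eps / 2)) as [n1 H1]; [lra|]. destruct (Hv (eps / 2)) as [n2 H2]; [lra|].
  specialize (H1 (n1 + n2)%nat ltac:(lia)). specialize (H2 (n1 + n2)%nat ltac:(lia)).
  assert (T := vnorm_sub_triangle l (u (n1 + n2)%nat) l').
  rewrite (vnorm_sub_sym l (u _)) in T. lra.
Qed.

Definition sqsum (a : nat -> C) (n : nat) : R := rsum (fun k => Cmod (a k) * Cmod (a k)) n.

Lemma nsq_lincomb_step (f : nat -> H) (a : nat -> C) m k : orthonormal f ->
  nsq (lincomb (m + k) a f [-] lincomb m a f) = sqsum a (m + k) - sqsum a m.
Proof.
  intros Hf. induction k as [|k IH].
  - rewrite Nat.add_0_r. replace (lincomb m a f [-] lincomb m a f) with (vzero H) by vring.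
    unfold nsq. rewrite ip_zero_l. simpl. ring.
  - rewrite Nat.add_succ_r. unfold sqsum in *. simpl.
    replace (lincomb (m + k) a f [+] a (m + k)%nat [*] f (m + k)%nat [-] lincomb m a f)
      with ((lincomb (m + k) a f [-] lincomb m a f) [+] a (m + k)%nat [*] f (m + k)%nat) by vring.
    rewrite nsq_add, IH, nsq_scal, ip_scal_r, ip_sub_l, !ip_lincomb_l.
    assert (Nf : nsq (f (m + k)%nat) = 1).
    { unfold nsq. rewrite Hf. unfold kron. rewrite Nat.eqb_refl. reflexivity. }
    assert (G : forall j, (j <= m + k)%nat ->
      csum (fun i => (a i * ip (f i) (f (m + k)%nat))%C) j = RtoC 0).
    { intros j Hj. rewrite (csum_ext _ (fun i => (a i * kron i (m + k))%C)) by (intros; rewrite Hf; reflexivity).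
      rewrite csum_kron. destruct (Nat.ltb_spec (m + k) j); [lia | reflexivity]. }
    rewrite !G, Nf by lia. simpl. ring.
Qed.

Lemma rsum_mono (f : nat -> R) m k : (forall i, 0 <= f i) -> rsum f m <= rsum f (m + k).
Proof.
  intros Hf. induction k as [|k IH]; [rewrite Nat.add_0_r; lra|].
  rewrite Nat.add_succ_r. simpl. specialize (Hf (m + k)%nat). lra.
Qed.

Lemma lincomb_converges (f : nat -> H) (a : nat -> C) M : orthonormal f ->
  (forall n, sqsum a n <= M) -> exists l, hlim (fun n => lincomb n a f) l.
Proof.
  intros Hf HM.
  assert (Mono : forall m k, sqsum a m <= sqsum a (m + k)).
  { intros m k. apply rsum_mono. intros i. apply Rle_0_sqr. }
  destruct (completeness (fun s => exists n, s = sqsum a n)) as [s [Hs1 Hs2]].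
  { exists M. intros s [n ->]. apply HM. }
  { exists (sqsum a 0), O. reflexivity. }
  destruct (Hc (fun n => lincomb n a f)) as [l Hl]; [|exists l; exact Hl].
  intros eps He.
  assert (exists n0, s - eps * eps < sqsum a n0) as [n0 Hn0].
  { apply NNPP. intros Hn. assert (s <= s - eps * eps); [|nra].
    apply Hs2. intros t [n ->]. apply Rnot_lt_le. intros L. apply Hn. exists n. exact L. }
  assert (G : forall n m, (n0 <= n)%nat -> (n <= m)%nat -> vnorm (lincomb m a f [-] lincomb n a f) < eps).
  { intros n m Hn Hm. apply Rnot_le_lt. intros L.
    assert (E := nsq_lincomb_step f a n (m - n) Hf). replace (n + (m - n))%nat with m in E by lia.
    rewrite <- vnorm_sq in E.
    assert (A := Mono n0 (n - n0)%nat). replace (n0 + (n - n0))%nat with n in A by lia.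
    assert (B : sqsum a m <= s) by (apply Hs1; exists m; reflexivity). nra. }
  exists n0. intros n m Hn Hm. destruct (Nat.le_ge_cases n m) as [L|L].
  - rewrite vnorm_sub_sym. apply G; assumption.
  - apply G; assumption.
Qed.

Lemma bessel (e : nat -> H) x n : orthonormal e -> sqsum (fun k => ip x (e k)) n <= nsq x.
Proof.
  intros He. set (a := fun k => ip x (e k)).
  assert (N := nsq_lincomb_step e a 0 n He). simpl in N.
  assert (P := nsq_pos (x [-] lincomb n a e)). rewrite nsq_sub in P.
  replace (lincomb n a e [-] vzero H) with (lincomb n a e) in N by vring.
  rewrite N in P. unfold sqsum at 2 in N.
  assert (E : fst (ip x (lincomb n a e)) = sqsum a n).
  { rewrite ip_conj, ip_lincomb_l. simpl. rewrite fst_csum.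
    apply Rle_antisym; apply rsum_le; intros k _; rewrite (ip_conj x (e k)); fold (a k);
      rewrite Cmod_sq; simpl; lra. }
  rewrite E in P. unfold sqsum at 3 in P. simpl in P. lra.
Qed.

(** The e_k need not span H, so S is the unilateral shift on their closed span and the identity on
    its orthogonal complement: 1 + U - L, where U x sums <x, e_k> e_(k+1) and L is the projection
    onto the span. Bessel's inequality and completeness make the series converge. *)
Lemma shift_exists : infinite_dimensional H -> exists (S Ss : H -> H) (e0 : H),
  is_adjoint S Ss /\ (forall x, Ss (S x) = x) /\ ip e0 e0 = RtoC 1 /\ forall x, ip (S x) e0 = RtoC 0.
Proof.
  intros Hinf. destruct (orthonormal_sequence_exists Hinf) as [e He].
  set (f := fun n => e (Datatypes.S n)).
  assert (Hf : orthonormal f) by (intros i j; unfold f; rewrite He; reflexivity).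
  set (a := fun x k => ip x (e k)).
  set (b := fun x k => (ip x (f k) - ip x (e k))%C).
  assert (ExU : forall x, exists l, hlim (fun n => lincomb n (a x) f) l).
  { intros x. apply (lincomb_converges f (a x) (nsq x) Hf). intros n. apply bessel, He. }
  assert (ExL : forall x, exists l, hlim (fun n => lincomb n (a x) e) l).
  { intros x. apply (lincomb_converges e (a x) (nsq x) He). intros n. apply bessel, He. }
  assert (ExW : forall x, exists l, hlim (fun n => lincomb n (b x) e) l).
  { intros x. apply (lincomb_converges e (b x) (4 * nsq x) He). intros n.
    assert (B1 := bessel e x n He). assert (B2 := bessel f x n Hf).
    enough (sqsum (b x) n <= 2 * sqsum (fun k => ip x (f k)) n + 2 * sqsum (fun k => ip x (e k)) n) by lra.
    clear. unfold sqsum. induction n as [|n IH]; simpl; [lra|].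
    change (b x n) with (ip x (f n) - ip x (e n))%C. rewrite (Cmod_sq (ip x (f n) - ip x (e n))), !(Cmod_sq (ip x _)).
    destruct (ip x (f n)) as [p q], (ip x (e n)) as [u v]. simpl.
    assert (A1 := Rle_0_sqr (p + u)). assert (A2 := Rle_0_sqr (q + v)). unfold Rsqr in *. lra. }
  destruct (choice_function _ ExU) as [U HU]. destruct (choice_function _ ExL) as [L HL].
  destruct (choice_function _ ExW) as [W HW].
  set (S := fun x => x [+] (U x [-] L x)). set (Ss := fun x => x [+] W x).
  assert (Coord : forall g h (c : nat -> C) l k, orthonormal g -> hlim (fun n => lincomb n c g) l ->
    h = g k -> ip l h = c k).
  { intros g h c l k Hg Hl ->.
    replace (c k) with (ip (c k [*] g k) (g k)).
    2:{ rewrite ip_scal_l, Hg. unfold kron. rewrite Nat.eqb_refl. ring. }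
    apply (hlim_ip (fun n => lincomb n c g) (fun _ => g k) l (g k) (c k [*] g k) (g k) (Datatypes.S k) Hl
      (hlim_const (g k))).
    intros n Hn. rewrite ip_lincomb_l, (csum_ext _ (fun i => (c i * kron i k)%C)) by (intros; rewrite Hg; reflexivity).
    rewrite csum_kron, ip_scal_l, Hg. unfold kron. rewrite Nat.eqb_refl.
    destruct (Nat.ltb_spec k n); [ring | lia]. }
  assert (U0 : forall x, ip (U x) (e O) = RtoC 0).
  { intros x. rewrite (hlim_ip _ (fun _ => e O) (U x) (e O) (vzero H) (e O) O (HU x) (hlim_const (e O))).
    - apply ip_zero_l.
    - intros n _. rewrite ip_lincomb_l, (csum_ext _ (fun _ => RtoC 0)).
      + rewrite csum_const, ip_zero_l. ring.
      + intros k. unfold f. rewrite He. unfold kron. simpl. ring. }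
  assert (C0 : forall x, ip (S x) (e O) = RtoC 0).
  { intros x. unfold S. rewrite ip_add_l, ip_sub_l, U0, (Coord e (e O) (a x) (L x) O He (HL x) eq_refl).
    unfold a. ring. }
  assert (CS : forall x k, ip (S x) (e (Datatypes.S k)) = a x k).
  { intros x k. unfold S. rewrite ip_add_l, ip_sub_l,
      (Coord e (e (Datatypes.S k)) (a x) (L x) (Datatypes.S k) He (HL x) eq_refl),
      (Coord f (e (Datatypes.S k)) (a x) (U x) k Hf (HU x) eq_refl).
    unfold a. ring. }
  exists S, Ss, (e O). split; [|split; [|split]].
  - intros x y. change (ip (S x) y = ip x (Ss y)). unfold S, Ss.
    rewrite ip_add_l, ip_add_r. f_equal.
    apply (hlim_ip (fun n => lincomb n (a x) f [-] lincomb n (a x) e) (fun n => lincomb n (b y) e)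
      (U x [-] L x) (W y) x y O); [apply hlim_sub; auto | auto |].
    intros n _. rewrite ip_sub_l, (ip_conj (lincomb n (b y) e) x), !ip_lincomb_l, <- csum_conj.
    induction n as [|n IH]; simpl; [ring|].
    rewrite <- IH, Cmult_conj. unfold b. rewrite Cminus_conj, <- !ip_conj. unfold a.
    ring.
  - intros x. unfold Ss.
    (* The coordinates of S x are 0, a_0, a_1, ..., so n + 1 terms along [e] match only n terms
       along [f]. *)
    assert (Tel : forall n, lincomb (Datatypes.S n) (b (S x)) e =
       lincomb (Datatypes.S n) (a x) e [-] lincomb n (a x) f).
    { induction n as [|n IH].
      - simpl. unfold b, f. rewrite C0, CS. vring.
      - change (lincomb (Datatypes.S n) (b (S x)) e [+] b (S x) (Datatypes.S n) [*] e (Datatypes.S n) =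
          lincomb (Datatypes.S n) (a x) e [+] a x (Datatypes.S n) [*] e (Datatypes.S n) [-]
          (lincomb n (a x) f [+] a x n [*] f n)).
        rewrite IH. unfold b. change (f (Datatypes.S n)) with (e (Datatypes.S (Datatypes.S n))).
        rewrite !CS. change (f n) with (e (Datatypes.S n)).
        generalize (lincomb (Datatypes.S n) (a x) e) (lincomb n (a x) f). intros u v. vring. }
    assert (E : W (S x) = L x [-] U x).
    { apply (hlim_unique (fun n => lincomb (Datatypes.S n) (b (S x)) e)).
      - apply (hlim_shift (fun n => lincomb n (b (S x)) e)), HW.
      - intros eps Heps.
        destruct (hlim_sub _ _ _ _ (hlim_shift _ _ (HL x)) (HU x) eps Heps) as [n0 Hn].
        exists n0. intros n Hle. rewrite Tel. apply Hn, Hle. }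
    rewrite E. unfold S. vring.
  - rewrite He. reflexivity.
  - exact C0.
Qed.

End Shift.

(** * The non-normal model *)

Section Backward.
Context {H : InnerProductSpace}.
Implicit Types (x y z : H).

Context (N V Vs : H -> H) (c : R) (LN : linear_op N) (Pc : 0 <= c) (HN : opbound N c).
Context (VE : is_adjoint V Vs) (VV : forall x, Vs (V x) = x).
Context (e0 e1 : H) (E00 : ip e0 e0 = RtoC 1) (E11 : ip e1 e1 = RtoC 1) (E10 : ip e1 e0 = RtoC 0).
Context (V0 : forall x, ip (V x) e0 = RtoC 0) (V1 : forall x, ip (V x) e1 = RtoC 0).
Context (z0 : C) (rho : R) (Pr : 0 < rho).

Let LV : linear_op V := adjoint_linear V Vs VE.
Let LVs : linear_op Vs := adjoint_linear Vs V (adjoint_sym _ _ VE).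

(** The orthogonal projection onto the complement of the range of the isometry V. *)
Definition range_defect x : H := x [-] V (Vs x).

(* N on the range of V; on its orthogonal complement, z0 plus the nilpotent rho <., e0> e1. *)
Definition model (x : H) : H :=
  V (N (Vs x)) [+] z0 [*] range_defect x [+] (RtoC rho * ip x e0)%C [*] e1.

Lemma Vs_e1 : Vs e1 = vzero H.
Proof.
  apply vext. intros z. rewrite (adjoint_ip Vs V (adjoint_sym _ _ VE)), ip_conj, V1, ip_zero_l.
  apply Cconj_RtoC.
Qed.

Lemma Vs_e0 : Vs e0 = vzero H.
Proof.
  apply vext. intros z. rewrite (adjoint_ip Vs V (adjoint_sym _ _ VE)), ip_conj, V0, ip_zero_l.
  apply Cconj_RtoC.
Qed.

Lemma Vs_defect x : Vs (range_defect x) = vzero H.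
Proof. unfold range_defect. rewrite (lin_sub Vs LVs), VV. vring. Qed.

Lemma nsq_V x : nsq (V x) = nsq x.
Proof. unfold nsq. rewrite (adjoint_ip V Vs VE), VV. reflexivity. Qed.

Lemma ip_V_defect x y : ip (V x) (range_defect y) = RtoC 0.
Proof. rewrite (adjoint_ip V Vs VE), Vs_defect. apply ip_zero_r. Qed.

Lemma nsq_split x : nsq x = nsq (Vs x) + nsq (range_defect x).
Proof.
  replace x with (V (Vs x) [+] range_defect x) at 1 by (unfold range_defect; vring).
  rewrite nsq_add, ip_V_defect, nsq_V. simpl. ring.
Qed.

Lemma ip_defect_e0 x : ip (range_defect x) e0 = ip x e0.
Proof. unfold range_defect. rewrite ip_sub_l, V0. ring. Qed.

(** The nilpotent part squares to zero because e1 is orthogonal to e0, so the Taylor expansion of p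
    at z0 stops at the first derivative. *)
Lemma poly_op_model p x :
  poly_op p model x = V (poly_op p N (Vs x)) [+]
    (peval p z0 [*] range_defect x [+] (RtoC rho * pderiv p z0 * ip x e0)%C [*] e1).
Proof.
  induction p as [|a p IH]; simpl.
  - rewrite (lin_zero V LV). vring.
  - rewrite IH. set (w := poly_op p N (Vs x)). set (P := peval p z0). set (D := pderiv p z0).
    set (y := V w [+] (P [*] range_defect x [+] (RtoC rho * D * ip x e0)%C [*] e1)).
    assert (Ey : Vs y = w).
    { unfold y. rewrite !(lin_add Vs LVs), !(lin_scal Vs LVs), VV, Vs_defect, Vs_e1. vring. }
    assert (Dy : range_defect y = P [*] range_defect x [+] (RtoC rho * D * ip x e0)%C [*] e1).
    { unfold range_defect at 1. rewrite Ey. unfold y. vring. }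
    assert (Iy : ip y e0 = (P * ip x e0)%C).
    { unfold y. rewrite !ip_add_l, !ip_scal_l, V0, E10, ip_defect_e0. ring. }
    unfold model at 1. rewrite Ey, Dy, Iy, (lin_add V LV), (lin_scal V LV).
    replace (a [*] x) with (a [*] V (Vs x) [+] a [*] range_defect x) by (unfold range_defect; vring).
    vring.
Qed.

Lemma model_linear : linear_op model.
Proof.
  unfold model, range_defect. split; intros.
  - rewrite !(lin_add Vs LVs), !(lin_add N LN), !(lin_add V LV), ip_add_l. vring.
  - rewrite !(lin_scal Vs LVs), !(lin_scal N LN), !(lin_scal V LV), ip_scal_l. vring.
Qed.

Lemma vnorm_e1 : vnorm e1 = 1.
Proof. change (sqrt (nsq e1) = 1). unfold nsq. rewrite E11. apply sqrt_1. Qed.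

Lemma vnorm_e0 : vnorm e0 = 1.
Proof. change (sqrt (nsq e0) = 1). unfold nsq. rewrite E00. apply sqrt_1. Qed.

Lemma block_bound p M x :
  rho * Cmod (pderiv p z0) <= M - Cmod (peval p z0) ->
  vnorm (peval p z0 [*] range_defect x [+] (RtoC rho * pderiv p z0 * ip x e0)%C [*] e1) <= M * vnorm (range_defect x).
Proof.
  intros HM. eapply Rle_trans; [apply vnorm_triangle|].
  rewrite !vnorm_scal, vnorm_e1, !Cmod_mult, Cmod_R, Rabs_pos_eq by lra.
  assert (A := cauchy_schwarz (range_defect x) e0). rewrite ip_defect_e0, vnorm_e0 in A.
  assert (P := vnorm_pos (range_defect x)).
  assert (Q : rho * Cmod (pderiv p z0) * Cmod (ip x e0) <= (M - Cmod (peval p z0)) * vnorm (range_defect x)).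
  { apply Rmult_le_compat; try lra; [|apply Cmod_ge_0].
    apply Rmult_le_pos; [lra | apply Cmod_ge_0]. }
  lra.
Qed.

(** The two blocks act on orthogonal subspaces, so p(A) is bounded by M exactly when both blocks
    are; the hypothesis makes the second block obey every bound that the first does. *)
Lemma model_opbound_iff p M : 0 <= M ->
  (opbound (poly_op p N) M -> rho * Cmod (pderiv p z0) <= M - Cmod (peval p z0)) ->
  (opbound (poly_op p model) M <-> opbound (poly_op p N) M).
Proof.
  intros PM Hd. split.
  - intros HA x. specialize (HA (V x)). rewrite poly_op_model, VV, V0 in HA.
    assert (Dv : range_defect (V x) = vzero H) by (unfold range_defect; rewrite VV; vring).
    rewrite Dv in HA.
    rewrite <- (vnorm_eq_sq _ _ (nsq_V x)), <- (vnorm_eq_sq _ _ (nsq_V (poly_op p N x))).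
    match type of HA with vnorm ?u <= _ => replace (V (poly_op p N x)) with u by vring end.
    exact HA.
  - intros HpN x. specialize (Hd HpN).
    assert (B := block_bound p M x Hd). specialize (HpN (Vs x)).
    rewrite poly_op_model.
    set (w := poly_op p N (Vs x)) in *.
    assert (O : ip (V w) (peval p z0 [*] range_defect x [+] (RtoC rho * pderiv p z0 * ip x e0)%C [*] e1) = RtoC 0).
    { rewrite ip_add_r, !ip_scal_r, ip_V_defect, V1. ring. }
    apply vnorm_le_sq; [apply Rmult_le_pos; [exact PM | apply vnorm_pos]|].
    rewrite nsq_add, O, nsq_V, <- (vnorm_sq w), <- vnorm_sq.
    replace (M * vnorm x * (M * vnorm x)) with (M * M * (vnorm x * vnorm x)) by ring.
    rewrite (vnorm_sq x), nsq_split, <- !vnorm_sq.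
    assert (A1 := Rmult_le_compat _ _ _ _ (vnorm_pos _) (vnorm_pos _) HpN HpN).
    assert (A2 := Rmult_le_compat _ _ _ _ (vnorm_pos _) (vnorm_pos _) B B).
    simpl. lra.
Qed.

Lemma model_bounded : bounded_op model.
Proof.
  split; [exact model_linear|].
  exists (c + Cmod z0 + rho). intros x.
  assert (S := nsq_split x). rewrite <- !vnorm_sq in S.
  assert (P0 := vnorm_pos x). assert (P1 := vnorm_pos (Vs x)). assert (P2 := vnorm_pos (range_defect x)).
  assert (B1 : vnorm (Vs x) <= vnorm x) by (apply Rsqr_incr_0_var; [unfold Rsqr; nra | exact P0]).
  assert (B2 : vnorm (range_defect x) <= vnorm x) by (apply Rsqr_incr_0_var; [unfold Rsqr; nra | exact P0]).
  unfold model. eapply Rle_trans; [apply vnorm_triangle|].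
  assert (T := vnorm_triangle (V (N (Vs x))) (z0 [*] range_defect x)).
  rewrite vnorm_scal in T |- *. rewrite vnorm_e1, Cmod_mult, Cmod_R, Rabs_pos_eq by lra.
  rewrite (vnorm_eq_sq _ _ (nsq_V (N (Vs x)))) in T.
  assert (A := HN (Vs x)). assert (B := cauchy_schwarz x e0). rewrite vnorm_e0 in B.
  assert (Pz := Cmod_ge_0 z0). nra.
Qed.

(** e1 is an eigenvector for z0, so normality would make it an eigenvector of the adjoint for conj
    z0. Then <A e0, e1> = z0 <e0, e1> = 0, while it equals rho. *)
Lemma model_not_normal : ~ normal_op model.
Proof.
  intros [S [HE HC]].
  assert (De1 : range_defect e1 = e1) by (unfold range_defect; rewrite Vs_e1, (lin_zero V LV); vring).
  assert (De0 : range_defect e0 = e0) by (unfold range_defect; rewrite Vs_e0, (lin_zero V LV); vring).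
  assert (A1 : model e1 = z0 [*] e1).
  { unfold model. rewrite De1, Vs_e1, (lin_zero N LN), (lin_zero V LV), E10. vring. }
  assert (A0 : model e0 = z0 [*] e0 [+] RtoC rho [*] e1).
  { unfold model. rewrite De0, Vs_e0, (lin_zero N LN), (lin_zero V LV), E00. vring. }
  destruct (bounded_opbound model model_bounded) as [b [Pb Hb]].
  destruct (normal_shift model S HE HC b Hb z0) as [TE [TC _]].
  assert (Nn := normal_norm _ _ TE TC e1). cbv beta in Nn.
  rewrite A1 in Nn. replace (z0 [*] e1 [-] z0 [*] e1) with (vzero H) in Nn by vring.
  rewrite vnorm_zero in Nn. apply vnorm_eq_0, vsub_zero in Nn.
  assert (Q := adjoint_ip model S HE e0 e1). rewrite A0, Nn in Q.
  rewrite ip_add_l, !ip_scal_l, ip_scal_r, Cconj_conj, E11 in Q.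
  assert (E01 : ip e0 e1 = RtoC 0) by (rewrite ip_conj, E10; apply Cconj_RtoC).
  rewrite E01 in Q. apply (f_equal fst) in Q. simpl in Q. lra.
Qed.

End Backward.

Theorem theorem3p5 (H : InnerProductSpace)
  (Hcomplete : complete_space H) (Hsep : separable_space H)
  (Hinf : infinite_dimensional H)
  (N : H -> H) (HNb : bounded_op N) (HNn : normal_op N) :
  lavrentieff (spectrum N) <->
  (forall A : H -> H, bounded_op A ->
     (forall (p : list Cpx) (r : R), is_opnorm (poly_op p A) r <-> is_opnorm (poly_op p N) r) ->
     normal_op A).
Proof.
  destruct HNn as [Ns [HE HC]].
  destruct (bounded_opbound N HNb) as [c [Pc HN]].
  assert (LN := proj1 HNb).
  assert (Pc0 : 0 <= c) by lra.
  assert (HK : bounded_by (spectrum N) c)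
    by exact (spectrum_bounded Hcomplete N Ns HE HC c Pc0 HN).
  assert (Hcl := spectrum_closed Hcomplete N Ns HE HC c Pc0 HN).
  split.
  - intros [_ [Hconn Hint]] A HAb Hnorm.
    destruct (bounded_opbound A HAb) as [cA [PcA HA]].
    apply (normal_of_polynomial_norms Hcomplete N Ns A c cA HE Pc0 HN (proj1 HAb)); [lra | exact HA | |].
    + intros eps He.
      destruct (approx_conj (spectrum N) c HK ltac:(lra) Hcl Hconn Hint eps He) as [p Hp].
      exists p. apply (poly_minus_adjoint_opbound Hcomplete N Ns HE HC c Pc0 HN p eps); [lra | exact Hp].
    + intros p b Pb Hpb.
      destruct (opbound_is_opnorm _ b Pb Hpb) as [r [Hr L]].
      apply Hnorm in Hr.
      destruct (is_opnorm_opbound _ r (poly_op_linear A p (proj1 HAb)) Hr) as [_ B].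
      exact (opbound_weaken _ r b L B).
  - intros Hall. apply NNPP. intros Hn.
    destruct (hull_disc_exists (spectrum N) c HK ltac:(lra) Hcl Hn) as [z0 [r [Pr Hdisc]]].
    destruct (shift_exists Hcomplete Hinf) as [S [Ss [e0 [SE [SS [E00 S0]]]]]].
    (* The complement of the range of the squared shift contains the orthonormal pair e0, S e0,
       which is the room the nilpotent block needs. *)
    set (V := fun x => S (S x)). set (Vs := fun x => Ss (Ss x)). set (e1 := S e0).
    assert (VE : is_adjoint V Vs).
    { intros x y. change (ip (V x) y = ip x (Vs y)). unfold V, Vs.
      rewrite !(adjoint_ip S Ss SE). reflexivity. }
    assert (VV : forall x, Vs (V x) = x) by (intros x; unfold V, Vs; rewrite !SS; reflexivity).
    assert (E11 : ip e1 e1 = RtoC 1) by (unfold e1; rewrite (adjoint_ip S Ss SE), SS; exact E00).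
    assert (V1 : forall x, ip (V x) e1 = RtoC 0)
      by (intros x; unfold V, e1; rewrite (adjoint_ip S Ss SE (S x)), SS; apply S0).
    assert (Prho : 0 < r / 2) by lra.
    apply (model_not_normal N V Vs c LN Pc0 HN VE VV e0 e1 E00 E11 (S0 e0) (fun x => S0 (S x)) V1 z0 (r / 2) Prho).
    apply Hall.
    + apply (model_bounded N V Vs c LN Pc0 HN VE VV e0 e1 E00 E11 z0 (r / 2) Prho).
    + intros p q.
      set (A := model N V Vs e0 e1 z0 (r / 2)).
      assert (LA : linear_op (poly_op p A)).
      { apply poly_op_linear. apply (model_linear N V Vs LN VE). }
      assert (LpN := poly_op_linear N p LN).
      assert (Iff : forall b, 0 <= b -> opbound (poly_op p A) b <-> opbound (poly_op p N) b).
      { intros b Pb. apply (model_opbound_iff N V Vs VE VV e0 e1 E00 E11 (S0 e0) (fun x => S0 (S x)) V1 z0 (r / 2) Prho p b Pb).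
        intros Hb.
        assert (D := disc_derivative_bound p z0 r b Pr (Hdisc p b Pb
          (fun z Hz => spectrum_peval_le Hcomplete N Ns HE HC c Pc0 HN p z b Hz Hb))). lra. }
      split; apply is_opnorm_iff; try assumption. intros b Pb. symmetry. apply Iff, Pb.
Qed.
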